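(* The $C_0((0,1])$-algebra $C_0(G)=C_0(H)\rtimes_{\Theta}\mathbb{Z}$ is a continuous field of C$^*$-algebras over $(0,1]$ with fibers $C_0(G_q)=C_0(H_q)\rtimes_{\Theta_q}\mathbb{Z}$, $q\in(0,1]$.
   Context: All C$^*$-algebras (except multiplier algebras) are separable; all locally compact spaces are Hausdorff and second countable. For a locally compact space $Y$, a $C_0(Y)$-algebra is a C$^*$-algebra $A$ with an injective non-degenerate $^*$-homomorphism of $C_0(Y)$ into the center of the multiplier algebra $M(A)$. The localisation (fiber) $A_y$ at $y\in Y$ is the quotient of $A$ by the closed ideal of all $fa$ with $f\in C_0(Y\setminus\{y\})$, $a\in A$; $a_y$ is the image of $a$ in $A_y$. $A$ is a continuous field of C$^*$-algebras over $Y$ if $y\mapsto\|a_y\|$ is continuous for all $a\in A$. Partial crossed products. A partial automorphism $\Theta=(\theta,H^{(1)},H^{(-1)})$ of a locally compact space $H$ is a homeomorphism $\theta:H^{(1)}\to H^{(-1)}$ between open subsets of $H$. For $k\in\mathbb{Z}$ let $H^{(k)}$ be the (open) domain of $\theta^k$ ($H^{(0)}=H$), so $\theta^k:H^{(k)}\to H^{(-k)}$ is a homeomorphism, and write $\theta^k(f)=f\circ\theta^k\in C_0(H^{(k)})$ for $f\in C_0(H^{(-k)})$. Let $\mathscr{N}_k=\{s^kf\mid f\in C_0(H^{(k)})\}$ (formal symbols). Then $\oplus_k\mathscr{N}_k$ is a $^*$-algebra by $(s^kf)(s^lg)=s^{k+l}\theta^l(f\theta^{-l}(g))$, $(s^kf)^*=s^{-k}\theta^{-k}(f^*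 )$, and $C_0(H)\rtimes_\Theta\mathbb{Z}$ is its universal C$^*$-envelope; it contains $C_0(H)=\mathscr N_0$. The space $H$. For $0<q<1$, $b>0$: $(0,b]_q=\{q^jb\mid j=0,1,2,\dots\}$; for $0<a\le b$ with $a\in\{q^jb\mid j=0,1,2,\ldots\}$: $[a,b]_q=(0,b]_q\setminus(0,qa]_q=\{b,qb,\dots,a\}$; for $q=1$: $(0,b]_1=(0,b]$, $[a,b]_1=[a,b]$. Put $$H=\{(q,t,a)\mid 0<q\le1,\ t\in(0,q]_q,\ a\in[\sqrt{t/q},\sqrt{q/t}]_q\}\subset\mathbb{R}^3$$ with the subspace topology (locally compact), $H^{(1)}=\{(q,t,a)\in H\mid t+t^{-1}-qa^2-q^{-1}a^{-2}\ne0\}$, $H^{(-1)}=\{(q,t,a)\in H\mid t+t^{-1}-q^{-1}a^2-qa^{-2}\neq0\}$, and $\theta:H^{(1)}\to H^{(-1)}$, $\theta(q,t,a)=(q,t,qa)$. The map $H\to(0,1]$, $(q,t,a)\mapsto q$, is open, continuous and surjective and commutes with $\theta$; via pullback along it $C_0((0,1])$ acts on $C_0(G)$. $H_q$ denotes the fiber of $H$ over $q$ and $\Theta_q$ the restriction of $\Theta$ to $H_q$. *)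

(* Defs.v *)
From HB Require Import structures.
From mathcomp Require Import all_boot all_order all_algebra.
From mathcomp Require Import all_classical all_reals all_analysis.
From mathcomp Require Import complex ring.

Set Implicit Arguments.
Unset Strict Implicit.
Unset Printing Implicit Defensive.

Import Order.TTheory GRing.Theory Num.Theory numFieldNormedType.Exports.

Local Open Scope classical_set_scope.
Local Open Scope ring_scope.

(* The complex numbers over R.  The topology, the norm and the module structure
   of a field over itself live on the regular alias. *)
Notation cplx R := ((R[i]%C : Type)^o).

(* C*-algebras, not assumed unital or separable.  The norm of a normed space
   over R[i] takes its values in R[i]. *)
HB.mixin Record isCStarAlg (R : realType) A of CompleteNormedModule R[i]%C A := {
  cmul : A -> A -> A;
  cstar : A -> A;
  cmulA : associative cmul;
  cmul_linl : forall (c : R[i]%C) x y z,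
    cmul (c *: x + y) z = c *: cmul x z + cmul y z;
  cmul_linr : forall (c : R[i]%C) x y z,
    cmul x (c *: y + z) = c *: cmul x y + cmul x z;
  cstar_semilin : forall (c : R[i]%C) x y,
    cstar (c *: x + y) = c^* *: cstar x + cstar y;
  cstarM : forall x y, cstar (cmul x y) = cmul (cstar y) (cstar x);
  cstarK : involutive cstar;
  cnormM : forall x y, `|cmul x y| <= `|x| * `|y|;
  cnorm_cstar : forall x, `|cmul (cstar x) x| = `|x| ^+ 2
}.

#[short(type="cstarAlgType")]
HB.structure Definition CStarAlg (R : realType) :=
  {A of isCStarAlg R A & CompleteNormedModule R[i]%C A}.

Section Cstar.
Context {R : realType}.
Implicit Types A B : cstarAlgType R.

Definition rnorm A (a : A) : R := complex.Re `|a|.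

(* f restricts to a *-homomorphism on the *-subalgebra D of V.  The operations
   are explicit because V is also used for spaces of functions. *)
Definition star_hom (V W : lmodType R[i]%C) (D : set V)
    (mulV : V -> V -> V) (starV : V -> V)
    (mulW : W -> W -> W) (starW : W -> W) (f : V -> W) : Prop :=
  [/\ forall (c : R[i]%C) x y, D x -> D y -> f (c *: x + y) = c *: f x + f y,
      forall x y, D x -> D y -> f (mulV x y) = mulW (f x) (f y)
    & forall x, D x -> f (starV x) = starW (f x)].

Definition cstar_hom A B (f : A -> B) : Prop :=
  star_hom setT cmul cstar cmul cstar f.

Definition C0 (X : topologicalType) : set (X -> cplx R) :=
  [set f | continuous f /\
           forall e : R[i]%C, 0 < e -> compact [set x | e <= `|f x|]].
Arguments C0 : clear implicits.

Definition fun_mul (X : Type) (f g : X -> cplx R) : X -> cplx R :=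
  fun x => f x * g x.

Definition fun_star (X : Type) (f : X -> cplx R) : X -> cplx R :=
  fun x => (f x : R[i]%C)^*.

(* Multipliers are double centralizers (L, M). *)
Definition is_multiplier A (T : (A -> A) * (A -> A)) : Prop :=
  [/\ (forall (c : R[i]%C) x y, T.1 (c *: x + y) = c *: T.1 x + T.1 y) /\
      continuous T.1,
      (forall (c : R[i]%C) x y, T.2 (c *: x + y) = c *: T.2 x + T.2 y) /\
      continuous T.2,
      forall a b, T.1 (cmul a b) = cmul (T.1 a) b,
      forall a b, T.2 (cmul a b) = cmul a (T.2 b)
    & forall a b, cmul a (T.1 b) = cmul (T.2 a) b].

Definition multiplier_mul A (S T : (A -> A) * (A -> A)) :
  (A -> A) * (A -> A) := (S.1 \o T.1, T.2 \o S.2).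

Definition multiplier_star A (T : (A -> A) * (A -> A)) :
  (A -> A) * (A -> A) :=
  (fun a => cstar (T.2 (cstar a)), fun a => cstar (T.1 (cstar a))).

Definition multiplier_center A : set ((A -> A) * (A -> A)) :=
  [set T | is_multiplier T /\
           forall S, is_multiplier S ->
             multiplier_mul S T = multiplier_mul T S].

Definition action (Y : topologicalType) A
    (m : (Y -> cplx R) -> (A -> A) * (A -> A)) (f : Y -> cplx R) (a : A) : A :=
  (m f).1 a.

Definition is_C0_algebra (Y : topologicalType) A
    (m : (Y -> cplx R) -> (A -> A) * (A -> A)) : Prop :=
  [/\ forall f, C0 Y f -> multiplier_center (m f),
      star_hom (C0 Y) (@fun_mul Y) (@fun_star Y)
        (@multiplier_mul A) (@multiplier_star A) m,
      {in C0 Y &, injective m}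
    & dense [set x : A | exists n (f : 'I_n -> Y -> cplx R) (a : 'I_n -> A),
        (forall i, C0 Y (f i)) /\ x = \sum_(i < n) action m (f i) (a i)]].

Definition fiber_ideal (Y : topologicalType) A
    (m : (Y -> cplx R) -> (A -> A) * (A -> A)) (y : Y) : set A :=
  [set x | exists f a, [/\ C0 Y f, f y = 0 & x = action m f a]].

Definition quotient_norm A (I : set A) (a : A) : R :=
  inf [set rnorm (a - i) | i in I].

(* pi exhibits B as the C*-algebra A / I. *)
Definition is_quotient A (I : set A) B (pi : A -> B) : Prop :=
  [/\ cstar_hom pi, forall b, exists a, pi a = b,
      forall a, pi a = 0 <-> I a
    & forall a, rnorm (pi a) = quotient_norm I a].

Definition is_continuous_field (Y : topologicalType) A
    (m : (Y -> cplx R) -> (A -> A) * (A -> A)) : Prop :=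
  is_C0_algebra m /\
  forall a : A, continuous (fun y : Y => quotient_norm (fiber_ideal m y) a).

End Cstar.
Arguments C0 R X : clear implicits.

(* Partial maps are option-valued.  Taking U := setT in the last two fields,
   both domains are open. *)
Record partial_aut (X : topologicalType) := PartialAut {
  pa_fwd : X -> option X;
  pa_bwd : X -> option X;
  pa_fwdK : forall x y, pa_fwd x = Some y <-> pa_bwd y = Some x;
  pa_fwd_open : forall U, open U ->
    open [set x | exists2 y, pa_fwd x = Some y & U y];
  pa_bwd_open : forall U, open U ->
    open [set x | exists2 y, pa_bwd x = Some y & U y]
}.

Section CrossedProduct.
Context {R : realType} {X : topologicalType} (Th : partial_aut X).

Definition pa_pow (k : int) (x : X) : option X :=
  match k with
  | Posz n => iter n (obind (pa_fwd Th)) (Some x)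
  | Negz n => iter n.+1 (obind (pa_bwd Th)) (Some x)
  end.

(* f o theta^k, extended by zero outside the domain of theta^k. *)
Definition pa_pull (k : int) (f : X -> cplx R) : X -> cplx R :=
  fun x => if pa_pow k x is Some y then f y else 0.

(* C_0 of the open domain of theta^k, as an ideal of C_0(X): extension by zero
   identifies C_0(U) with the functions of C_0(X) vanishing off U. *)
Definition C0_dom (k : int) : set (X -> cplx R) :=
  [set f | C0 R X f /\ forall x, pa_pow k x = None -> f x = 0].

(* The element x stands for the finite sum of the s^k (x k). *)
Definition cp_alg : set (int -> X -> cplx R) :=
  [set x | finite_set [set k | x k <> 0] /\ forall k, C0_dom k (x k)].

Definition cp_mul (x y : int -> X -> cplx R) : int -> X -> cplx R :=
  fun m h => \sum_(l \in [set: int])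
    pa_pull l (fun_mul (x (m - l)) (pa_pull (- l) (y l))) h.

Definition cp_star (x : int -> X -> cplx R) : int -> X -> cplx R :=
  fun m => pa_pull m (fun_star (x (- m))).

Definition is_cp_hom (A : cstarAlgType R) (phi : (int -> X -> cplx R) -> A) :
  Prop := star_hom cp_alg cp_mul cp_star cmul cstar phi.

(* (A, iota) is the universal C*-envelope of the *-algebra cp_alg. *)
Definition is_crossed_product (A : cstarAlgType R)
    (iota : (int -> X -> cplx R) -> A) : Prop :=
  is_cp_hom iota /\
  forall (B : cstarAlgType R) (phi : (int -> X -> cplx R) -> B),
    is_cp_hom phi ->
    exists! Phi : A -> B,
      cstar_hom Phi /\ forall x, cp_alg x -> Phi (iota x) = phi x.

End CrossedProduct.

Section Restriction.
Context {X : topologicalType} (Th : partial_aut X) (S : set X).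
Hypothesis invS : forall x y, pa_fwd Th x = Some y -> (S x <-> S y).

Definition res_fwd (x : set_type S) : option (set_type S) :=
  obind insub (pa_fwd Th (set_val x)).
Definition res_bwd (x : set_type S) : option (set_type S) :=
  obind insub (pa_bwd Th (set_val x)).

Lemma res_mapE (g : X -> option X) (x y : set_type S) :
  obind insub (g (set_val x)) = Some y <-> g (set_val x) = Some (set_val y).
Proof.
split; case E : (g _) => [z|] //=.
- by case: insubP => // u _ <- [->].
- by case=> ->; rewrite valK.
Qed.

Lemma res_fwdK x y : res_fwd x = Some y <-> res_bwd y = Some x.
Proof.
by rewrite /res_fwd /res_bwd !res_mapE; exact: pa_fwdK.
Qed.

Lemma res_open (g : X -> option X) :
  (forall x y, g x = Some y -> (S x <-> S y)) ->
  (forall U, open U -> open [set x | exists2 y, g x = Some y & U y]) ->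
  forall U : set (set_type S), open U ->
    open [set x : set_type S |
      exists2 y : set_type S, obind insub (g (set_val x)) = Some y & U y].
Proof.
move=> invg og _ [V oV <-]; exists [set x | exists2 y, g x = Some y & V y].
  exact: og.
apply/seteqP; split => x /= -[y gxy Vy].
- have Sy : S y by apply/(invg _ _ gxy); exact: (set_mem (valP x)).
  by exists (exist _ y (mem_set Sy)) => //; apply/res_mapE.
- by exists (set_val y) => //; apply/res_mapE.
Qed.

Lemma invS_bwd x y : pa_bwd Th x = Some y -> (S x <-> S y).
Proof. by move/pa_fwdK/invS => ->. Qed.

Definition pa_restrict : partial_aut (set_type S) :=
  PartialAut res_fwdK (@res_open _ invS (@pa_fwd_open _ Th))
    (@res_open _ invS_bwd (@pa_bwd_open _ Th)).

End Restriction.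

Section SpaceH.
Context {R : realType}.
Implicit Types (q t a b : R) (h : R * R * R).

(* (0, b]_q *)
Definition qray q b : set R :=
  if q == 1 then `]0, b]%classic else [set x | exists j : nat, x = q ^+ j * b].

(* [a, b]_q *)
Definition qseg q a b : set R :=
  if q == 1 then `[a, b]%classic else qray q b `\` qray q (q * a).

Definition H_set : set (R * R * R) :=
  [set h | let: (q, t, a) := h in
    [/\ 0 < q <= 1, qray q q t
      & qseg q (Num.sqrt (t / q)) (Num.sqrt (q / t)) a]].

Definition H_fwd_fun h : R :=
  let: (q, t, a) := h in t + t^-1 - q * a ^+ 2 - q^-1 * a ^- 2.

Definition H_bwd_fun h : R :=
  let: (q, t, a) := h in t + t^-1 - q^-1 * a ^+ 2 - q * a ^- 2.

Definition theta h : R * R * R := let: (q, t, a) := h in (q, t, q * a).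
Definition theta_inv h : R * R * R := let: (q, t, a) := h in (q, t, q^-1 * a).

Definition unit_itv : set R := `]0, 1]%classic.

End SpaceH.

Notation Hspace R := (set_type (@H_set R)).
Notation Yspace R := (set_type (@unit_itv R)).

Section Theta.
Context {R : realType}.

Definition H1 : set (Hspace R) := [set h | H_fwd_fun (set_val h) != 0].
Definition Hm1 : set (Hspace R) := [set h | H_bwd_fun (set_val h) != 0].

Definition theta_fwd (h : Hspace R) : option (Hspace R) :=
  if H_fwd_fun (set_val h) != 0 then insub (theta (set_val h)) else None.
Definition theta_bwd (h : Hspace R) : option (Hspace R) :=
  if H_bwd_fun (set_val h) != 0 then insub (theta_inv (set_val h)) else None.

Lemma H_pos (h : R * R * R) : H_set h -> [/\ 0 < h.1.1, 0 < h.1.2 & 0 < h.2].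
Proof.
move: h => [[q t] a] /= [/andP[q0 q1]].
have qrayP b x : 0 < b -> qray q b x -> 0 < x.
  rewrite /qray; case: ifP => _ b0 /=; first by rewrite in_itv /= => /andP[].
  by case=> j ->; rewrite mulr_gt0// exprn_gt0.
move=> /(qrayP _ _ q0) t0; rewrite /qseg; case: ifP => _ /=.
  rewrite in_itv /= => /andP[sa _]; split => //.
  by apply: lt_le_trans sa; rewrite sqrtr_gt0 divr_gt0.
case=> /qrayP Ha _; split => //; apply: Ha.
by rewrite sqrtr_gt0 divr_gt0.
Qed.

Lemma qpow_inj (q : R) i j : 0 < q -> q < 1 -> q ^+ i = q ^+ j -> i = j.
Proof.
move=> q0 q1 /eqP; rewrite eq_le !ler_iXn2l // => /andP[ij ji].
by apply/eqP; rewrite eqn_leq ij ji.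
Qed.

(* A point of H with q < 1 has t = q^(j+1) and a = q^i sqrt(q^(-j)), i <= j. *)
Lemma HsetP (q t a : R) : q != 1 ->
  H_set (q, t, a) <-> [/\ 0 < q, q < 1 & exists i j : nat,
    [/\ (i <= j)%N, t = q ^+ j.+1 & a = q ^+ i * Num.sqrt (q ^- j)]].
Proof.
move=> qn1; rewrite /H_set /= /qseg /qray (negbTE qn1) /=.
have key j : 0 < q -> [/\ q / (q ^+ j * q) = q ^- j
    & Num.sqrt (q ^+ j * q / q) = q ^+ j * Num.sqrt (q ^- j)].
  move=> q0; have qj0 : 0 < q ^+ j by rewrite exprn_gt0.
  split; first by field; rewrite !gt_eqF.
  apply: (@pexpIrn _ 2); rewrite ?nnegrE ?sqrtr_ge0 ?mulr_ge0 ?sqrtr_ge0 ?ltW//.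
  rewrite exprMn !sqr_sqrtr ?divr_ge0 ?mulr_ge0 ?invr_ge0 ?(ltW q0) ?(ltW qj0)//.
  by field; rewrite !gt_eqF.
split.
- move=> [/andP[q0 q1] [j ->]] [[i ->] nI].
  have q1' : q < 1 by rewrite lt_neqAle qn1.
  split => //; exists i, j; have [k1 k2] := key j q0; split.
  + rewrite leqNgt; apply/negP => ji; apply: nI; exists (i - j.+1)%N.
    rewrite k1 k2 [q * (_ * _)]mulrA -exprS mulrA -exprD; congr (_ ^+ _ * _).
    by rewrite subnK.
  + by rewrite exprSr.
  + by rewrite k1.
- move=> [q0 q1 [i [j [ij -> ->]]]]; have [k1 k2] := key j q0.
  rewrite q0 ltW //; split => //; first by exists j; rewrite exprSr.
  rewrite exprSr k1 k2; split; first by exists i.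
  move=> [l]; rewrite [q * (_ * _)]mulrA -exprS mulrA -exprD => /mulIf E.
  suff: i = (l + j.+1)%N by move=> Ei; move: ij; rewrite Ei addnS ltnNge leq_addl.
  apply: (qpow_inj q0 q1); apply: E.
  by rewrite gt_eqF// sqrtr_gt0 invr_gt0 exprn_gt0.
Qed.

Lemma H_fwd_factor (q t a : R) : q != 0 -> t != 0 -> a != 0 ->
  t + t^-1 - q * a ^+ 2 - q^-1 * a ^- 2 =
  - (q * a ^+ 2 - t) * (q * a ^+ 2 - t^-1) / (q * a ^+ 2).
Proof. by move=> q0 t0 a0; field; rewrite q0 t0 a0. Qed.

Lemma H_bwd_factor (q t a : R) : q != 0 -> t != 0 -> a != 0 ->
  t + t^-1 - q^-1 * a ^+ 2 - q * a ^- 2 =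
  - (q^-1 * a ^+ 2 - t) * (q^-1 * a ^+ 2 - t^-1) / (q^-1 * a ^+ 2).
Proof. by move=> q0 t0 a0; field; rewrite q0 t0 a0. Qed.

Lemma theta_mem (h : R * R * R) :
  H_set h -> H_fwd_fun h != 0 -> H_set (theta h).
Proof.
move: h => [[q t] a] Hh; have [/= q0 t0 a0] := H_pos Hh.
have [q1|qn1] := eqVneq q 1; first by move=> _; move: Hh; rewrite q1 mul1r.
move: Hh => /(HsetP _ _ qn1)[_ q1 [i [j [ij tE aE]]]].
rewrite /H_fwd_fun (H_fwd_factor (lt0r_neq0 q0) (lt0r_neq0 t0) (lt0r_neq0 a0)) => F0.
apply/(HsetP _ _ qn1); split => //; exists i.+1, j; split => //.
- rewrite ltn_neqAle ij andbT; apply: contraNneq F0 => ijE.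
  have -> : q * a ^+ 2 = t; last by rewrite subrr oppr0 !mul0r.
  rewrite aE tE ijE exprMn sqr_sqrtr ?invr_ge0 ?exprn_ge0 ?ltW// [q ^+ j.+1]exprS.
  have : q ^+ j != 0 by rewrite lt0r_neq0// exprn_gt0.
  by move: (q ^+ j) => z z0; field.
- by rewrite aE exprS mulrA.
Qed.

Lemma theta_inv_mem (h : R * R * R) :
  H_set h -> H_bwd_fun h != 0 -> H_set (theta_inv h).
Proof.
move: h => [[q t] a] Hh; have [/= q0 t0 a0] := H_pos Hh.
have [q1|qn1] := eqVneq q 1.
  have E : (1 : R)^-1 * a = a by rewrite invr1 mul1r.
  by move=> _; move: Hh; rewrite q1 /theta_inv E.
move: Hh => /(HsetP _ _ qn1)[_ q1 [i [j [ij tE aE]]]].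
rewrite /H_bwd_fun (H_bwd_factor (lt0r_neq0 q0) (lt0r_neq0 t0) (lt0r_neq0 a0)) => F0.
apply/(HsetP _ _ qn1); split => //.
case: i ij aE => [|i] ij aE; last first.
  exists i, j; split; rewrite ?(ltnW ij)// aE exprS !mulrA mulVf ?mul1r//.
  by rewrite gt_eqF.
move/eqP: F0; case.
have -> : q^-1 * a ^+ 2 = t^-1; last by rewrite subrr mulr0 mul0r.
rewrite aE tE expr0 mul1r sqr_sqrtr ?invr_ge0 ?exprn_ge0 ?ltW// [q ^+ j.+1]exprS.
have : q ^+ j != 0 by rewrite lt0r_neq0// exprn_gt0.
have := lt0r_neq0 q0.
by move: (q ^+ j) => z q0' z0; field; rewrite q0' z0.
Qed.

Lemma theta_fwdP (x y : Hspace R) : theta_fwd x = Some y <->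
  H1 x /\ set_val y = theta (set_val x).
Proof.
rewrite /theta_fwd /H1 /=; case: ifPn => F0; split => //.
- by case: insubP => // u _ uE [<-].
- by case=> _ <-; rewrite valK.
- by case.
Qed.

Lemma theta_bwdP (x y : Hspace R) : theta_bwd x = Some y <->
  Hm1 x /\ set_val y = theta_inv (set_val x).
Proof.
rewrite /theta_bwd /Hm1 /=; case: ifPn => F0; split => //.
- by case: insubP => // u _ uE [<-].
- by case=> _ <-; rewrite valK.
- by case.
Qed.

(* theta_fwd and theta_bwd are defined exactly on H^(1) and H^(-1). *)
Lemma theta_fwd_dom (x : Hspace R) : H1 x <-> exists y, theta_fwd x = Some y.
Proof.
split=> [H1x|[y /theta_fwdP[]]//].
exists (exist _ (theta (set_val x)) (mem_set (theta_mem (set_mem (valP x)) H1x))).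
exact/theta_fwdP.
Qed.

Lemma theta_bwd_dom (x : Hspace R) : Hm1 x <-> exists y, theta_bwd x = Some y.
Proof.
split=> [H1x|[y /theta_bwdP[]]//].
exists (exist _ (theta_inv (set_val x))
  (mem_set (theta_inv_mem (set_mem (valP x)) H1x))).
exact/theta_bwdP.
Qed.

Lemma theta_fwdK (x y : Hspace R) :
  theta_fwd x = Some y <-> theta_bwd y = Some x.
Proof.
rewrite theta_fwdP theta_bwdP /H1 /Hm1 /=.
have := H_pos (set_mem (valP x)); have := H_pos (set_mem (valP y)).
rewrite !set_valE; move: (\val x) (\val y) => [[q t] a] [[q' t'] a'] /=.
move=> [q'0 t'0 a'0] [q0 t0 a0]; split => -[F0 [E1 E2 E3]].
- subst q' t' a'; split; last by congr (_, _, _); rewrite mulKf ?gt_eqF.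
  apply: contraNN F0 => /eqP <-; apply/eqP; field.
  by rewrite !gt_eqF.
- subst q t a; split; last by congr (_, _, _); rewrite mulVKf ?gt_eqF.
  apply: contraNN F0 => /eqP <-; apply/eqP; field.
  by rewrite !gt_eqF.
Qed.

Let qc (h : Hspace R) : R := (set_val h).1.1.
Let tc (h : Hspace R) : R := (set_val h).1.2.
Let ac (h : Hspace R) : R := (set_val h).2.

Let val_cont : continuous (set_val : Hspace R -> R * R * R).
Proof. exact: initial_continuous. Qed.

Let qc_cont : continuous qc.
Proof.
move=> h; apply: (@continuous_comp _ _ _ (fun h : Hspace R => (set_val h).1) fst).
  by apply: (@continuous_comp _ _ _ set_val fst); [exact: val_cont|exact: cvg_fst].
exact: cvg_fst.
Qed.

Let tc_cont : continuous tc.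
Proof.
move=> h; apply: (@continuous_comp _ _ _ (fun h : Hspace R => (set_val h).1) snd).
  by apply: (@continuous_comp _ _ _ set_val fst); [exact: val_cont|exact: cvg_fst].
exact: cvg_snd.
Qed.

Let ac_cont : continuous ac.
Proof.
by move=> h; apply: (@continuous_comp _ _ _ set_val snd);
  [exact: val_cont|exact: cvg_snd].
Qed.

Let coord_gt0 (h : Hspace R) : [/\ 0 < qc h, 0 < tc h & 0 < ac h].
Proof. exact: H_pos (set_mem (valP h)). Qed.

Let qV_cont : continuous (fun h => (qc h)^-1).
Proof.
move=> h; have := @continuousV R (Hspace R) qc h; apply; last exact: qc_cont.
by have [q0 _ _] := coord_gt0 h; exact: lt0r_neq0.
Qed.

Let tV_cont : continuous (fun h => (tc h)^-1).
Proof.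
move=> h; have := @continuousV R (Hspace R) tc h; apply; last exact: tc_cont.
by have [_ t0 _] := coord_gt0 h; exact: lt0r_neq0.
Qed.

Let a2_cont : continuous (fun h => ac h ^+ 2).
Proof. by move=> h; apply: continuousM; exact: ac_cont. Qed.

Let a2V_cont : continuous (fun h => ac h ^- 2).
Proof.
move=> h; have := @continuousV R (Hspace R) (fun h => ac h ^+ 2) h; apply; last exact: a2_cont.
by have [_ _ a0] := coord_gt0 h; rewrite lt0r_neq0// exprn_gt0.
Qed.

Let open_partial (F : R * R * R -> R) (g : R * R * R -> R * R * R)
    (f : Hspace R -> option (Hspace R)) :
  continuous (F \o (set_val : Hspace R -> _)) ->
  continuous (g \o (set_val : Hspace R -> _)) ->
  (forall x y, f x = Some y <->
     F (set_val x) != 0 /\ set_val y = g (set_val x)) ->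
  (forall x, F (set_val x) != 0 -> exists y, f x = Some y) ->
  forall U, open U -> open [set x | exists2 y, f x = Some y & U y].
Proof.
move=> /continuousP cF /continuousP cg fP fdom _ [V oV <-].
rewrite (_ : mkset _ = (F \o set_val) @^-1` [set~ 0] `&` (g \o set_val) @^-1` V).
  apply: openI; last exact: cg.
  by apply: cF; apply: closed_openC; exact: closed_eq.
apply/seteqP; split=> x /=.
- by case=> y /fP[/eqP F0 <-] Vy; split.
- case=> /eqP F0 Vg; have [y fxy] := fdom _ F0.
  by exists y => //=; have [_ ->] := (fP _ _).1 fxy.
Qed.

Lemma theta_fwd_open U : open U ->
  open [set x | exists2 y, theta_fwd x = Some y & U y].
Proof.
apply: (open_partial _ _ theta_fwdP (fun x => (theta_fwd_dom x).1)).
- rewrite (_ : _ \o _ = fun h => tc h + (tc h)^-1 - qc h * ac h ^+ 2 -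
      (qc h)^-1 * ac h ^- 2); last first.
    by apply/funext => h; rewrite /= /tc /qc /ac; case: (set_val h) => [[]].
  move=> h.
  exact: (cvgB (cvgB (cvgD (tc_cont (x := h)) (tV_cont (x := h)))
    (cvgM (qc_cont (x := h)) (a2_cont (x := h))))
    (cvgM (qV_cont (x := h)) (a2V_cont (x := h)))).
- rewrite (_ : _ \o _ = fun h => (qc h, tc h, qc h * ac h)); last first.
    by apply/funext => h; rewrite /= /tc /qc /ac; case: (set_val h) => [[]].
  move=> h.
  exact: (cvg_pair (cvg_pair (qc_cont (x := h)) (tc_cont (x := h)))
    (cvgM (qc_cont (x := h)) (ac_cont (x := h)))).
Qed.

Lemma theta_bwd_open U : open U ->
  open [set x | exists2 y, theta_bwd x = Some y & U y].
Proof.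
apply: (open_partial _ _ theta_bwdP (fun x => (theta_bwd_dom x).1)).
- rewrite (_ : _ \o _ = fun h => tc h + (tc h)^-1 - (qc h)^-1 * ac h ^+ 2 -
      qc h * ac h ^- 2); last first.
    by apply/funext => h; rewrite /= /tc /qc /ac; case: (set_val h) => [[]].
  move=> h.
  exact: (cvgB (cvgB (cvgD (tc_cont (x := h)) (tV_cont (x := h)))
    (cvgM (qV_cont (x := h)) (a2_cont (x := h))))
    (cvgM (qc_cont (x := h)) (a2V_cont (x := h)))).
- rewrite (_ : _ \o _ = fun h => (qc h, tc h, (qc h)^-1 * ac h)); last first.
    by apply/funext => h; rewrite /= /tc /qc /ac; case: (set_val h) => [[]].
  move=> h.
  exact: (cvg_pair (cvg_pair (qc_cont (x := h)) (tc_cont (x := h)))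
    (cvgM (qV_cont (x := h)) (ac_cont (x := h)))).
Qed.

Definition Theta : partial_aut (Hspace R) :=
  PartialAut theta_fwdK theta_fwd_open theta_bwd_open.

Lemma H_unit_itv (h : Hspace R) : unit_itv (set_val h).1.1.
Proof.
rewrite /unit_itv /= in_itv /=; have := set_mem (valP h).
by rewrite set_valE; case: (\val h) => [[q t] a] [].
Qed.

(* The projection H -> (0, 1], (q, t, a) |-> q. *)
Definition H_proj (h : Hspace R) : Yspace R :=
  exist _ (set_val h).1.1 (mem_set (H_unit_itv h)).

Definition H_fiber (q : Yspace R) : set (Hspace R) := H_proj @^-1` [set q].

Lemma H_fiber_inv (q : Yspace R) (x y : Hspace R) :
  pa_fwd Theta x = Some y -> (H_fiber q x <-> H_fiber q y).
Proof.
move=> /theta_fwdP[_ E]; rewrite /H_fiber /=.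
have -> // : H_proj x = H_proj y.
by apply: val_inj; rewrite /= E; case: (set_val x) => [[]].
Qed.

Definition Theta_fiber (q : Yspace R) : partial_aut (set_type (H_fiber q)) :=
  pa_restrict (@H_fiber_inv q).

Definition cp_restrict (q : Yspace R) (x : int -> Hspace R -> cplx R) :
  int -> set_type (H_fiber q) -> cplx R := fun k h => x k (set_val h).

Definition cp_pullback (f : Yspace R -> cplx R) (x : int -> Hspace R -> cplx R) :
  int -> Hspace R -> cplx R := fun k h => f (H_proj h) * x k h.

End Theta.

(* Main.v *)
(* Let x be in the *-algebra of the partial action, supported in |k| <= K, and let
   w_0 = x, w_(n+1) = w_n^* w_n.  In any C*-algebra receiving the *-algebra,
   |w_n| = |x|^(2^n).  Each coefficient of w_(n+1) is bounded by the supremum of its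
   coefficient of degree 0, and there are O(2^n) of them, so up to a factor that is
   linear in 2^n the norm |x|^(2^(n+1)) is at most sup_h (w_(n+1))_0(h).  Conversely
   |z_0(h)| <= |z| holds in the fibre algebras, because the orbits in H_q are finite for
   q < 1 and theta is the identity on its domain for q = 1: evaluation at h in degree 0 is
   a matrix entry of a finite-dimensional representation.  Hence
   |x| = lim_n (sup_h (w_n)_0(h))^(1/2^n) in each fibre, and since (w_n)_0 is in C_0(H)
   and H -> (0, 1] is open, q |-> |x_q| is upper and lower semicontinuous.  The same
   estimate applied to f x, with f a bump function around q, shows that the norm of A
   modulo the fibre ideal is the norm of the crossed product of the fibre; the fibre ideal
   is closed by Cohen factorization, and the quotient map is onto by Tietze extension. *)
Require Import Defs.
From HB Require Import structures.
From mathcomp Require Import all_boot all_order all_algebra.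
From mathcomp Require Import all_classical all_reals all_analysis.
From mathcomp Require Import complex ring lra zify.
Set Implicit Arguments.
Unset Strict Implicit.
Unset Printing Implicit Defensive.
Import Order.TTheory GRing.Theory Num.Theory numFieldNormedType.Exports.
Local Open Scope classical_set_scope.
Local Open Scope ring_scope.

(** * Norms and limits in C*-algebras *)

(** The universal norm is a supremum over all representations, hence accessible from two sides only:
    from above by estimates valid for every [is_cp_hom], from below by exhibiting particular
    representations. The upper estimate depends on [x] only through its support and one function on
    [H], the degree-0 coefficient of some [w_n]; that function is the same for the whole algebra and
    for all fibres, and this uniformity in [q] is what lets topology of [H] decide the continuity of
    the norm. No spectral theory is used. Where it would enter, a self-adjoint contraction [x] is
    completed to a formal unitary [(1 - b) + i x] with [b = 1 - sqrt(1 - x^2)], obtained by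
    iteration in a C*-algebra and pointwise for functions. This yields contractivity of
    star-homomorphisms and the bound of a single coefficient by its supremum norm. Constants are not
    in [C_0((0,1])]. Hence all bounded continuous functions of [q] are made to act, and elements of
    a fibre ideal are produced with an additional cut-off near [q = 0]. *)

Section ComplexAbs.
Context {R : realType}.
Implicit Types (z w : R[i]%C) (r : R).

(** The norm over [R[i]] is complex-valued and the order there is partial; [cabs] and [rnorm] move
    all estimates to [R], where [lra] and [nra] apply. *)
Definition cabs z : R := complex.Re `|z|.

Lemma normcabs z : `|z| = (cabs z)%:C%C.
Proof. by rewrite /cabs RRe_real// normr_real. Qed.

Lemma cabs_ge0 z : 0 <= cabs z.
Proof. by rewrite -(@lecR R) -normcabs normr_ge0. Qed.

Lemma cabsM z w : cabs (z * w) = cabs z * cabs w.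
Proof. by apply: complexI; rewrite rmorphM/= -!normcabs normrM. Qed.

Lemma cabsD z w : cabs (z + w) <= cabs z + cabs w.
Proof. by rewrite -(@lecR R) rmorphD/= -!normcabs ler_normD. Qed.

Lemma cabsN z : cabs (- z) = cabs z.
Proof. by rewrite /cabs normrN. Qed.

Lemma cabs0 : cabs 0 = 0.
Proof. by rewrite /cabs normr0. Qed.

Lemma cabs1 : cabs 1 = 1.
Proof. by rewrite /cabs normr1. Qed.

Lemma cabs_real r : cabs r%:C%C = `|r|.
Proof. by rewrite /cabs normc_def /= expr0n addr0 sqrtr_sqr. Qed.

Lemma cabs_eq0 z : cabs z = 0 -> z = 0.
Proof. by move=> z0; apply/normr0_eq0; rewrite normcabs z0. Qed.

Lemma cabs_gt0 z : (0 < cabs z) = (z != 0).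
Proof.
rewrite lt_neqAle cabs_ge0 andbT eq_sym; apply/idP/idP; apply: contraNN => /eqP.
  by move=> ->; rewrite cabs0.
by move/cabs_eq0 ->.
Qed.

Lemma cabsJ z : cabs (z^*)%R = cabs z.
Proof. by rewrite /cabs norm_conjC. Qed.

Lemma mulJc z : (z^* * z)%R = (cabs z ^+ 2)%:C%C.
Proof. by rewrite mulrC -normCK normcabs rmorphXn. Qed.

Lemma cabs_sum (I : Type) (s : seq I) (P : pred I) (F : I -> R[i]%C) :
  cabs (\sum_(i <- s | P i) F i) <= \sum_(i <- s | P i) cabs (F i).
Proof.
elim/big_rec2 : _ => [|i y x _ ih]; first by rewrite cabs0.
by rewrite (le_trans (cabsD _ _))// lerD2l.
Qed.

Lemma conj_real r : (r%:C%C)^* = r%:C%C :> R[i]%C.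
Proof. by apply: conj_Creal; apply/complex_realP; exists r. Qed.

Lemma cabs_Re z : `|complex.Re z| <= cabs z.
Proof. by rewrite -(@lecR R) -normcabs normc_ge_Re. Qed.

Lemma cabs_Im z : `|complex.Im z| <= cabs z.
Proof.
case: z => a b; rewrite /cabs normc_def /= -{1}sqrtr_sqr ler_sqrt ?lerDr ?sqr_ge0//.
by rewrite addr_ge0 ?sqr_ge0.
Qed.

Lemma cabsi : cabs ('i%R : R[i]%C) = 1.
Proof. by rewrite /cabs normCi. Qed.

Lemma cabs_nat n : cabs (n%:R : R[i]%C) = n%:R.
Proof. by apply: complexI; rewrite -normcabs normr_nat rmorph_nat. Qed.

Lemma cabsV z : cabs z^-1 = (cabs z)^-1.
Proof. by apply: complexI; rewrite fmorphV/= -!normcabs normfV. Qed.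

Lemma cabs_le_ReIm z : cabs z <= `|complex.Re z| + `|complex.Im z|.
Proof.
rewrite {1}[z]complexE (le_trans (cabsD _ _))// cabsM complexiE cabsi mul1r.
by rewrite !cabs_real.
Qed.

End ComplexAbs.

Section RNorm.
Context {R : realType} {A : cstarAlgType R}.
Implicit Types (a b : A) (z : R[i]%C).

Lemma normrnorm a : `|a| = (rnorm a)%:C%C.
Proof. by rewrite /rnorm RRe_real// normr_real. Qed.

Lemma rnorm_ge0 a : 0 <= rnorm a.
Proof. by rewrite -(@lecR R) -normrnorm normr_ge0. Qed.

Lemma rnorm0 : rnorm (0 : A) = 0.
Proof. by rewrite /rnorm normr0. Qed.

Lemma rnorm_eq0 a : rnorm a = 0 -> a = 0.
Proof. by move=> a0; apply/normr0_eq0; rewrite normrnorm a0. Qed.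

Lemma rnormD a b : rnorm (a + b) <= rnorm a + rnorm b.
Proof. by rewrite -(@lecR R) rmorphD/= -!normrnorm ler_normD. Qed.

Lemma rnormN a : rnorm (- a) = rnorm a.
Proof. by rewrite /rnorm normrN. Qed.

Lemma rnormB a b : rnorm (a - b) <= rnorm a + rnorm b.
Proof. by rewrite (le_trans (rnormD _ _))// rnormN. Qed.

Lemma rdistC a b : rnorm (a - b) = rnorm (b - a).
Proof. by rewrite -rnormN opprB. Qed.

Lemma rdistD a b c : rnorm (a - c) <= rnorm (a - b) + rnorm (b - c).
Proof. by rewrite (le_trans _ (rnormD _ _))// addrA subrK. Qed.

Lemma rnorm_dist a b : `|rnorm a - rnorm b| <= rnorm (a - b).
Proof.
rewrite ler_norml; apply/andP; split.
  rewrite lerBrDl lerBlDr rdistC -{1}(subrK a b) addrC.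
  by rewrite (le_trans (rnormD _ _))// addrC.
by rewrite lerBlDr -{1}(subrK b a) rnormD.
Qed.

Lemma rnormZ z a : rnorm (z *: a) = cabs z * rnorm a.
Proof. by apply: complexI; rewrite rmorphM/= -normrnorm -normcabs -normrnorm normrZ. Qed.

Lemma rnormM a b : rnorm (cmul a b) <= rnorm a * rnorm b.
Proof. by rewrite -(@lecR R) rmorphM/= -!normrnorm cnormM. Qed.

Lemma rnorm_cstar a : rnorm (cmul (cstar a) a) = rnorm a ^+ 2.
Proof. by apply: complexI; rewrite rmorphXn/= -!normrnorm cnorm_cstar. Qed.

Lemma rnorm_sum (I : Type) (s : seq I) (P : pred I) (F : I -> A) :
  rnorm (\sum_(i <- s | P i) F i) <= \sum_(i <- s | P i) rnorm (F i).
Proof.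
elim/big_rec2 : _ => [|i y x _ ih]; first by rewrite rnorm0.
by rewrite (le_trans (rnormD _ _))// lerD2l.
Qed.

(** From [|b|^2 = |b^* b| <= |b^*| |b|], applied to [a] and to its adjoint. *)
Lemma rnormJ a : rnorm (cstar a) = rnorm a.
Proof.
have le b : rnorm b <= rnorm (cstar b).
  have [->|b0] := eqVneq (rnorm b) 0; first exact: rnorm_ge0.
  have b0' : 0 < rnorm b by rewrite lt_neqAle eq_sym b0 rnorm_ge0.
  by rewrite -(ler_pM2r b0') -expr2 -rnorm_cstar rnormM.
by apply/eqP; rewrite eq_le le andbT -{2}[a]cstarK le.
Qed.

Lemma cmulDl a b c : cmul (a + b) c = cmul a c + cmul b c.
Proof. by have := cmul_linl 1 a b c; rewrite !scale1r. Qed.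

Lemma cmulDr a b c : cmul c (a + b) = cmul c a + cmul c b.
Proof. by have := cmul_linr 1 c a b; rewrite !scale1r. Qed.

Lemma cmul0l c : cmul (0 : A) c = 0.
Proof. by apply: (addrI (cmul (0 : A) c)); rewrite -cmulDl !addr0. Qed.

Lemma cmul0r c : cmul c (0 : A) = 0.
Proof. by apply: (addrI (cmul c (0 : A))); rewrite -cmulDr !addr0. Qed.

Lemma cmulZl z a c : cmul (z *: a) c = z *: cmul a c.
Proof. by have := cmul_linl z a 0 c; rewrite !addr0 cmul0l addr0. Qed.

Lemma cmulZr z a c : cmul c (z *: a) = z *: cmul c a.
Proof. by have := cmul_linr z c a 0; rewrite !addr0 cmul0r addr0. Qed.

Lemma cmulNl a c : cmul (- a) c = - cmul a c.
Proof. by rewrite -scaleN1r cmulZl scaleN1r. Qed.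

Lemma cmulNr a c : cmul c (- a) = - cmul c a.
Proof. by rewrite -scaleN1r cmulZr scaleN1r. Qed.

Lemma cmulBl a b c : cmul (a - b) c = cmul a c - cmul b c.
Proof. by rewrite cmulDl cmulNl. Qed.

Lemma cmulBr a b c : cmul c (a - b) = cmul c a - cmul c b.
Proof. by rewrite cmulDr cmulNr. Qed.

Lemma cstarD a b : cstar (a + b) = cstar a + cstar b.
Proof. by have := cstar_semilin 1 a b; rewrite rmorph1 !scale1r. Qed.

Lemma cstar0 : cstar (0 : A) = 0.
Proof. by apply: (addrI (cstar (0 : A))); rewrite -cstarD !addr0. Qed.

Lemma cstarZ z a : cstar (z *: a) = (z^* *: cstar a)%R.
Proof. by have := cstar_semilin z a 0; rewrite !addr0 cstar0 addr0. Qed.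

Lemma cstarN a : cstar (- a) = - cstar a.
Proof. by rewrite -scaleN1r cstarZ rmorphN rmorph1 scaleN1r. Qed.

Lemma cstarB a b : cstar (a - b) = cstar a - cstar b.
Proof. by rewrite cstarD cstarN. Qed.

End RNorm.

Section Limits.
Context {R : realType} {A : cstarAlgType R}.
Implicit Types (a b : A) (u v : nat -> A).

Lemma nbhs_rnormP a (U : set A) :
  nbhs a U <-> exists2 e : R, 0 < e & forall b, rnorm (a - b) < e -> U b.
Proof.
split.
  move/nbhs_ballP => [e/= e0 eU]; exists (complex.Re e).
    by move: e0; rewrite ltcE => /andP[].
  move=> b ab; apply: eU; rewrite -ball_normE /ball_/= normrnorm.
  by rewrite -(@RRe_real R e) ?ltcR// gtr0_real.
move=> [e e0 eU]; apply/nbhs_ballP; exists e%:C%C => /=; first by rewrite ltcR.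
by move=> b; rewrite -ball_normE /ball_/= normrnorm ltcR; exact: eU.
Qed.

Definition rlim u a := forall e : R, 0 < e ->
  exists N, forall n, (N <= n)%N -> rnorm (u n - a) < e.

Lemma cauchy_rlim u :
  (forall e : R, 0 < e ->
     exists N, forall m n, (N <= m)%N -> (N <= n)%N -> rnorm (u m - u n) < e) ->
  exists a, rlim u a.
Proof.
move=> cu; have : cauchy (u @ \oo).
  apply/cauchy_ballP => e e0.
  have [|N hN] := cu (complex.Re e); first by move: e0; rewrite ltcE => /andP[].
  exists (u @` [set n | (N <= n)%N], u @` [set n | (N <= n)%N]).
    by split; exists N => // n /= Nn; exists n.
  move=> [_ _] [[m /= Nm <-] [n /= Nn <-]]/=.
  rewrite -ball_normE /ball_/= normrnorm.
  by rewrite -(@RRe_real R e) ?ltcR ?gtr0_real//; exact: hN.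
move/cauchy_cvg/cvg_ex => [a ua]; exists a => e e0.
have /ua : nbhs a [set b | rnorm (b - a) < e].
  by apply/nbhs_rnormP; exists e => // b /=; rewrite rdistC.
by case=> N _ hN; exists N => n Nn; exact: hN.
Qed.

Lemma rlim_uniq u a b : rlim u a -> rlim u b -> a = b.
Proof.
move=> ua ub; apply/subr0_eq/rnorm_eq0/eqP; rewrite eq_le rnorm_ge0 andbT.
apply/ler_addgt0Pl => e e0; rewrite addr0.
have e2 : 0 < e / 2 by rewrite divr_gt0.
have [N hN] := ua _ e2; have [M hM] := ub _ e2.
have := hN (maxn N M) (leq_maxl _ _); have := hM (maxn N M) (leq_maxr _ _).
have := rdistD a (u (maxn N M)) b; rewrite (rdistC a (u _)); lra.
Qed.

(** Serves the three successive approximations below: the square root, the Cohen factorization and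
    the lifting along the quotient map. *)
Lemma geometric_rlim u (c s : R) : 0 <= c -> 0 <= s < 1 ->
  (forall n, rnorm (u n.+1 - u n) <= c * s ^+ n) ->
  exists2 a, rlim u a & forall n, rnorm (u n - a) <= c * s ^+ n / (1 - s).
Proof.
move=> c0 /andP[s0 s1] hu.
have s1' : 0 < 1 - s by rewrite subr_gt0.
have key n k : rnorm (u (n + k)%N - u n) <= c * s ^+ n * (1 - s ^+ k) / (1 - s).
  elim: k => [|k ih]; first by rewrite addn0 subrr rnorm0 expr0 subrr mulr0 mul0r.
  rewrite addnS (le_trans (rdistD _ (u (n + k)%N) _))//.
  rewrite (le_trans (lerD (hu _) ih))// exprD exprS le_eqVlt; apply/orP; left.
  by apply/eqP; field; rewrite gt_eqF.
have key2 n k : rnorm (u (n + k)%N - u n) <= c * s ^+ n / (1 - s).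
  rewrite (le_trans (key n k))// ler_pM2r ?invr_gt0// ler_piMr ?mulr_ge0 ?exprn_ge0//.
  by rewrite gerBl exprn_ge0.
have small e : 0 < e -> exists N, c * s ^+ N / (1 - s) < e.
  move=> e0; have : (fun n => s ^+ n) @ \oo --> (0 : R).
    by apply: cvg_expr; rewrite ger0_norm.
  have e' : 0 < e * (1 - s) / (c + 1).
    by rewrite divr_gt0 ?mulr_gt0// ltr_wpDl.
  move=> /cvgrPdist_lt /(_ _ e') [N _ /(_ N (leqnn N))]/=.
  rewrite sub0r normrN ger0_norm ?exprn_ge0// => h; exists N.
  rewrite ltr_pdivrMr//; move: h; rewrite ltr_pdivlMr ?ltr_wpDl// mulrC mulrDl mul1r.
  have := exprn_ge0 N s0; lra.
have [a ua] : exists a, rlim u a.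
  apply: cauchy_rlim => e e0; have [|N hN] := small (e / 2); first by rewrite divr_gt0.
  exists N => m n Nm Nn; have := rdistD (u m) (u N) (u n); rewrite (rdistC (u N) (u n)).
  have := key2 N (m - N)%N; have := key2 N (n - N)%N; rewrite !subnKC//; lra.
exists a => // n; apply/ler_addgt0Pl => e e0.
have [N hN] := ua _ e0; have := hN (n + N)%N (leq_addl _ _).
have := rdistD (u n) (u (n + N)%N) a; rewrite (rdistC (u n) (u (n + N)%N)).
have := key2 n N; lra.
Qed.

Lemma rlimD u v a b : rlim u a -> rlim v b -> rlim (fun n => u n + v n) (a + b).
Proof.
move=> ua vb e e0; have e2 : 0 < e / 2 by rewrite divr_gt0.
have [N hN] := ua _ e2; have [M hM] := vb _ e2; exists (maxn N M) => n.
rewrite geq_max => /andP[/hN h1 /hM h2].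
have -> : u n + v n - (a + b) = (u n - a) + (v n - b) by rewrite opprD addrACA.
have := rnormD (u n - a) (v n - b); lra.
Qed.

Lemma rlim_const a : rlim (fun=> a) a.
Proof. by move=> e e0; exists 0 => n _; rewrite subrr rnorm0. Qed.

Lemma rlim_shift u a : rlim u a -> rlim (fun n => u n.+1) a.
Proof. by move=> ua e /ua[N hN]; exists N => n Nn; apply/hN/leqW. Qed.

Lemma rlim_lip (B : cstarAlgType R) (f : A -> B) u a (c : R) :
  (forall x y, rnorm (f x - f y) <= c * rnorm (x - y)) ->
  rlim u a -> forall e : R, 0 < e ->
  exists N, forall n, (N <= n)%N -> rnorm (f (u n) - f a) < e.
Proof.
move=> fl ua e e0.
have c0 : 0 < `|c| + 1 by rewrite ltr_wpDl.
have [|N hN] := ua (e / (`|c| + 1)); first by rewrite divr_gt0.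
exists N => n /hN; rewrite ltr_pdivlMr// => h; apply: le_lt_trans h.
rewrite (le_trans (fl _ _))// mulrC ler_wpM2l ?rnorm_ge0//.
by rewrite (le_trans (ler_norm _))// lerDl.
Qed.

End Limits.

Lemma rlim_mul {R : realType} {A : cstarAlgType R} (u v : nat -> A) a b :
  rlim u a -> rlim v b -> rlim (fun n => cmul (u n) (v n)) (cmul a b).
Proof.
move=> ua vb e e0.
pose c := rnorm a + rnorm b + 1.
have c1 : 1 <= c by rewrite /c lerDr addr_ge0 ?rnorm_ge0.
have c0 : 0 < c by rewrite (lt_le_trans ltr01).
(* Once both errors are below [d <= 1], the three terms of the expansion add up to at most
   [d * (1 + |a| + |b|) = d * c]. *)
pose d := Num.min 1 (e / (2 * c)).
have d0 : 0 < d by rewrite /d lt_min ltr01 divr_gt0// mulr_gt0.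
have d1 : d <= 1 by rewrite /d ge_min lexx.
have de : d * c <= e / 2.
  have : d <= e / (2 * c) by rewrite /d ge_min lexx orbT.
  by rewrite -(ler_pM2r c0) => /le_trans; apply; rewrite le_eqVlt; apply/orP; left;
    apply/eqP; field; rewrite gt_eqF.
have [N hN] := ua _ d0; have [M hM] := vb _ d0; exists (maxn N M) => n.
rewrite geq_max => /andP[/hN h1 /hM h2].
have -> : cmul (u n) (v n) - cmul a b =
    cmul (u n - a) (v n - b) + cmul (u n - a) b + cmul a (v n - b).
  by rewrite -cmulDr subrK cmulBl cmulBr addrA subrK.
apply: le_lt_trans (rnormD _ _) _; apply: le_lt_trans (lerD (rnormD _ _) (lexx _)) _.
have := rnormM (u n - a) (v n - b); have := rnormM (u n - a) b.
have := rnormM a (v n - b).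
have := rnorm_ge0 (u n - a); have := rnorm_ge0 (v n - b).
have := rnorm_ge0 a; have := rnorm_ge0 b.
move: h1 h2 de; rewrite /c.
move: (rnorm a) (rnorm b) (rnorm (u n - a)) (rnorm (v n - b)) => al be x y.
nra.
Qed.

(** * Star-homomorphisms are contractive *)

Section Contractive.
Context {R : realType}.
Implicit Types A B : cstarAlgType R.

(* With u = 1 - b + i x one has formally u^* u = u u^* = (1 - b)^2 + x^2 = 1, so left
   multiplication by u and u^* is isometric although A need not have a unit;
   and 2 i x = u - u^*. *)
Lemma rnorm_le1_circle A (x b : A) : cstar x = x -> cstar b = b ->
  cmul x b = cmul b x -> b + b - cmul b b = cmul x x -> rnorm x <= 1.
Proof.
move=> xs bs xb E.
(* [L z c] is [(1 - b + z x) c] written without a unit; [z] will be [i] or [- i]. *)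
pose L (z : R[i]%C) c := (c - cmul b c) + z *: cmul x c.
have Lnorm (z : R[i]%C) c : z^* = - z -> z * z = -1 -> rnorm (L z c) = rnorm c.
  move=> zJ zz; apply: (@pexpIrn _ 2); rewrite ?nnegrE ?rnorm_ge0//.
  rewrite -!rnorm_cstar; congr rnorm; rewrite /L.
  have E1 : cmul (cstar (c - cmul b c)) (cmul x c) = cmul (cstar (cmul x c)) (c - cmul b c).
    rewrite cstarB !cstarM xs bs cmulBl cmulBr -!cmulA; congr (_ - cmul _ _).
    by rewrite !cmulA xb.
  have E2 : cmul (cstar (c - cmul b c)) (c - cmul b c) +
      cmul (cstar (cmul x c)) (cmul x c) = cmul (cstar c) c.
    rewrite cstarB !cstarM xs bs cmulBl !cmulBr -!cmulA.
    rewrite [cmul x (cmul x c)]cmulA -E cmulBl cmulDl cmulBr cmulDr -!cmulA.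
    move: (cmul (cstar c) c) (cmul (cstar c) (cmul b c)) => p q.
    move: (cmul (cstar c) (cmul b (cmul b c))) => r.
    by rewrite -[X in X + _ = _]addrA -opprD [q + (q - r)]addrA subrK.
  move: E1 E2; move: (c - cmul b c) (cmul x c) => p r E1 E2.
  rewrite cstarD cstarZ zJ cmulDl !cmulDr !cmulZl !cmulZr E1 scalerA mulNr zz opprK.
  by rewrite scale1r scaleNr addrA addrK.
have half c : rnorm (cmul x c) <= rnorm c.
  have : cmul x c = (2 * 'i%R : R[i]%C)^-1 *: (L 'i%R c - L (- 'i%R) c).
    have -> : L 'i%R c - L (- 'i%R) c = (2 * 'i%R : R[i]%C) *: cmul x c.
      rewrite /L scaleNr opprD opprK addrACA subrr add0r -scalerDl.
      by rewrite mulr_natl mulr2n.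
    by rewrite scalerA mulVf ?scale1r// mulf_neq0 ?pnatr_eq0 ?neq0Ci.
  move=> ->; rewrite rnormZ.
  have : rnorm (L 'i%R c - L (- 'i%R) c) <= rnorm c + rnorm c.
    rewrite (le_trans (rnormB _ _))// !Lnorm ?conjCi// ?rmorphN/= ?conjCi//.
    by rewrite mulrNN -expr2 sqrCi.
    by rewrite -expr2 sqrCi.
  have -> : cabs ((2 * 'i%R : R[i]%C)^-1) = 2^-1.
    by rewrite cabsV cabsM cabsi mulr1 cabs_nat.
  lra.
have [->|x0] := eqVneq (rnorm x) 0; first exact: ler01.
have x0' : 0 < rnorm x by rewrite lt_neqAle eq_sym x0 rnorm_ge0.
(* At [c = x] the estimate [half] reads [|x|^2 <= |x|]. *)
have := half x; rewrite -{1}xs rnorm_cstar expr2 -ler_pdivlMr// divff//.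
Qed.

(** [b] is [1 - sqrt(1 - a^2)], found as the fixed point of [b = (a^2 + b^2) / 2]. Started at [0],
    the iteration stays in the ball of radius [|a| < 1], where the map contracts by the factor
    [|a|]. *)
Lemma half_sqrt_one_sub A (a : A) : cstar a = a -> rnorm a < 1 ->
  exists b : A, [/\ cstar b = b, cmul a b = cmul b a & b + b - cmul b b = cmul a a].
Proof.
move=> sa a1; set s := rnorm a in a1; have s0 : 0 <= s := rnorm_ge0 a.
pose h : R[i]%C := (2^-1)%:C%C.
have hJ : h^* = h by exact: conj_real.
have hh : h + h = 1 by rewrite /h -rmorphD/= (_ : 2^-1 + 2^-1 = 1 :> R) ?rmorph1//; lra.
have ch : cabs h = 2^-1 by rewrite /h cabs_real ger0_norm// invr_ge0.
pose b := fix b n : A := if n is n'.+1 then h *: (cmul a a + cmul (b n') (b n')) else 0.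
have bS n : b n.+1 = h *: (cmul a a + cmul (b n) (b n)) by [].
have bs n : cstar (b n) = b n.
  by elim: n => [|n ih]; rewrite ?cstar0// bS cstarZ cstarD !cstarM sa ih hJ.
have ba n : cmul a (b n) = cmul (b n) a.
  elim: n => [|n ih]; first by rewrite cmul0l cmul0r.
  by rewrite bS cmulZr cmulZl cmulDr cmulDl !cmulA ih -!cmulA ih.
have bn n : rnorm (b n) <= s.
  elim: n => [|n ih]; first by rewrite rnorm0.
  rewrite bS rnormZ ch; have := rnormD (cmul a a) (cmul (b n) (b n)).
  have := rnormM a a; have := rnormM (b n) (b n).
  have := rnorm_ge0 (b n); move: ih s0 a1; rewrite -/s; nra.
have step n : rnorm (b n.+1 - b n) <= s * s ^+ n.
  elim: n => [|n ih]; first by rewrite expr0 mulr1 subr0 bn.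
  rewrite (bS n.+1) [X in _ - X]bS -scalerBr opprD addrACA subrr add0r rnormZ ch.
  have -> : cmul (b n.+1) (b n.+1) - cmul (b n) (b n) =
    cmul (b n.+1 - b n) (b n.+1) + cmul (b n) (b n.+1 - b n).
    by rewrite cmulBl cmulBr addrA subrK.
  have := rnormD (cmul (b n.+1 - b n) (b n.+1)) (cmul (b n) (b n.+1 - b n)).
  have := rnormM (b n.+1 - b n) (b n.+1); have := rnormM (b n) (b n.+1 - b n).
  have := bn n; have := bn n.+1; have := rnorm_ge0 (b n); have := rnorm_ge0 (b n.+1).
  have := rnorm_ge0 (b n.+1 - b n); rewrite [s ^+ n.+1]exprS; move: ih.
  move: (rnorm (b n.+1 - b n)) (rnorm (b n)) (rnorm (b n.+1)) (s * s ^+ n) => d p q t.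
  nra.
have [c bc _] := geometric_rlim s0 (introT andP (conj s0 a1)) step.
have bstar : rlim (fun n => cstar (b n)) (cstar c).
  by move=> e /bc[N hN]; exists N => n /hN; rewrite -cstarB rnormJ.
exists c; split.
- by apply: rlim_uniq bstar _ => e /bc[N hN]; exists N => n /hN; rewrite bs.
- apply: (rlim_uniq (rlim_mul (rlim_const a) bc)) => e e0.
  have [N hN] := rlim_mul bc (rlim_const a) e0.
  by exists N => n /hN; rewrite ba.
- have E : c = h *: (cmul a a + cmul c c).
    apply: (rlim_uniq (rlim_shift bc)) => e e0.
    have [N hN] := rlim_mul bc bc e0; exists N => n /hN.
    rewrite bS -scalerBr opprD addrACA subrr add0r rnormZ ch.
    have := rnorm_ge0 (cmul (b n) (b n) - cmul c c); lra.
  have -> : c + c = cmul a a + cmul c c by rewrite {1 2}E -scalerDl hh scale1r.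
  by rewrite addrK.
Qed.

(** For self-adjoint [a] with [|a| < 1], the relation between [a] and [b] passes to [f a] and [f b],
    so [rnorm_le1_circle] bounds [f a] by 1. Scaling treats all self-adjoint elements, and the
    C*-identity the others. *)
Lemma cstar_hom_norm A B (f : A -> B) : cstar_hom f -> forall a, rnorm (f a) <= rnorm a.
Proof.
move=> [fl fM fs]; have fD a b : f (a + b) = f a + f b.
  by have := fl 1 a b I I; rewrite !scale1r.
have f0 : f 0 = 0 by apply: (addrI (f 0)); rewrite -fD !addr0.
have fZ z a : f (z *: a) = z *: f a by have := fl z a 0 I I; rewrite f0 !addr0.
have fN a : f (- a) = - f a by rewrite -scaleN1r fZ scaleN1r.
have unit a : cstar a = a -> rnorm a < 1 -> rnorm (f a) <= 1.
  move=> sa a1; have [b [sb ab E]] := half_sqrt_one_sub sa a1.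
  apply: (@rnorm_le1_circle _ _ (f b)); rewrite -?fs -?fM ?sa ?sb ?ab//.
  by rewrite -E !fD fN.
have sadj a : cstar a = a -> rnorm (f a) <= rnorm a.
  move=> sa; apply/ler_addgt0Pl => e e0.
  have ae0 : 0 < e + rnorm a by rewrite ltr_pwDl// rnorm_ge0.
  pose t : R[i]%C := (e + rnorm a)^-1%:C%C.
  have ct : cabs t = (e + rnorm a)^-1 by rewrite cabs_real ger0_norm// invr_ge0 ltW.
  have := unit (t *: a); rewrite cstarZ sa conj_real fZ !rnormZ ct.
  rewrite ![_^-1 * _]mulrC ltr_pdivrMr// ler_pdivrMr// mul1r => -> //.
  by rewrite ltrDr.
move=> a; rewrite -(@ler_pXn2r _ 2) ?nnegrE ?rnorm_ge0// -!rnorm_cstar -fs// -fM//.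
by apply: sadj; rewrite cstarM cstarK.
Qed.

End Contractive.

(** * Closed *-subalgebras *)

(** Choose a point at radius [1/(n+1)] of the Cauchy filter for each [n]: completeness of the
    subalgebras and of the matrix algebras can then be checked on sequences. *)
Lemma seq_complete (R : realType) (V : normedModType R[i]%C) :
  (forall u : nat -> V,
    (forall e : R, 0 < e -> exists N, forall m n, (N <= m)%N -> (N <= n)%N ->
       `|u m - u n| < e%:C%C) ->
    exists a, forall e : R, 0 < e -> exists N, forall n, (N <= n)%N ->
       `|u n - a| < e%:C%C) ->
  forall F : set_system V, ProperFilter F -> cauchy F -> cvg F.
Proof.
move=> Vc F PF cF; pose d n : R := n.+1%:R^-1.
have d0 n : 0 < d n by rewrite invr_gt0.
have dle m n : (m <= n)%N -> d n <= d m.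
  by move=> mn; rewrite lef_pV2 ?posrE// ler_nat.
have darch e : 0 < e -> exists N, d N < e.
  move=> e0; exists (Num.truncn e^-1).
  by rewrite -[ltRHS]invrK ltf_pV2 ?posrE ?invr_gt0// Num.Theory.truncnS_gt.
have xex n : exists x, F (ball x (d n)%:C%C).
  by move/cauchyP: cF; apply; rewrite ltcR.
have [u uF] := choice xex.
have uu m n N : (N <= m)%N -> (N <= n)%N -> `|u m - u n| < (d N + d N)%:C%C.
  move=> Nm Nn; have [x [/=]] := filter_ex (filterI (uF m) (uF n)).
  rewrite -!ball_normE /ball_/= => h1 h2.
  rewrite (le_lt_trans (ler_distD x _ _))// [`|x - _|]distrC rmorphD/= ltrD//.
    by rewrite (lt_le_trans h1)// lecR dle.
  by rewrite (lt_le_trans h2)// lecR dle.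
have [|a ua] := Vc u.
  move=> e e0; have [|N hN] := darch (e / 2); first by rewrite divr_gt0.
  exists N => m n Nm Nn; rewrite (lt_le_trans (uu _ _ _ Nm Nn))// lecR; lra.
apply/cvg_ex; exists a; apply/cvg_ballP => e e0.
have e0' : 0 < complex.Re e by move: e0; rewrite ltcE => /andP[].
have eE : e = (complex.Re e)%:C%C by rewrite RRe_real// gtr0_real.
have e2 : 0 < complex.Re e / 2 by rewrite divr_gt0.
have [N hN] := darch _ e2; have [M hM] := ua _ e2.
near=> x; have : ball (u (maxn N M)) (d (maxn N M))%:C%C x by near: x; exact: uF.
rewrite -!ball_normE /ball_/= => h; rewrite eE.
rewrite (le_lt_trans (ler_distD (u (maxn N M)) _ _))// [complex.Re e]splitr rmorphD/=.
rewrite ltrD//; first by rewrite distrC hM// leq_maxr.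
rewrite (lt_trans h)// ltcR (le_lt_trans _ hN)// dle// leq_maxl.
Unshelve. all: by end_near. Qed.

(** Closed star-subalgebras. Each becomes a C*-algebra of its own, so that it can be a target of the
    universal property. *)
Record sub_cstar (R : realType) (A : cstarAlgType R) := SubCStar {
  subc_set : set A;
  subc0 : subc_set 0;
  subc_lin : forall (z : R[i]%C) a b, subc_set a -> subc_set b -> subc_set (z *: a + b);
  subcM : forall a b, subc_set a -> subc_set b -> subc_set (cmul a b);
  subcJ : forall a, subc_set a -> subc_set (cstar a);
  subc_lim : forall u a, (forall n : nat, subc_set (u n)) -> rlim u a -> subc_set a
}.

Section SubCStar.
Context {R : realType} {A : cstarAlgType R} (S : sub_cstar A).

Definition subc_pred : {pred A} := fun a => a \in subc_set S.

Lemma subc_submod : submod_closed subc_pred.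
Proof.
split; first by rewrite inE; exact: subc0.
by move=> z a b; rewrite !inE; exact: subc_lin.
Qed.

HB.instance Definition _ := GRing.isSubmodClosed.Build R[i]%C A subc_pred subc_submod.

Record subc_type := SubElt { subc_val : A; subc_valP : subc_val \in subc_pred }.

HB.instance Definition _ := [isSub for subc_val].
HB.instance Definition _ := [Choice of subc_type by <:].
HB.instance Definition _ := [SubChoice_isSubLmodule of subc_type by <:].

Definition subc_norm (x : subc_type) : R[i]%C := `|subc_val x|.

Lemma subc_normD x y : subc_norm (x + y) <= subc_norm x + subc_norm y.
Proof. exact: ler_normD. Qed.

Lemma subc_normZ (z : R[i]%C) x : subc_norm (z *: x) = `|z| * subc_norm x.
Proof. exact: normrZ. Qed.

Lemma subc_norm0 x : subc_norm x = 0 -> x = 0.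
Proof. by move=> /normr0_eq0 x0; apply: val_inj. Qed.

HB.instance Definition _ := Lmodule_isNormed.Build R[i]%C subc_type
  subc_normD subc_normZ subc_norm0.

Lemma subc_complete (F : set_system subc_type) : ProperFilter F -> cauchy F -> cvg F.
Proof.
apply: seq_complete => u cu.
have cv e : 0 < e -> exists N, forall m n, (N <= m)%N -> (N <= n)%N ->
    rnorm (subc_val (u m) - subc_val (u n)) < e.
  by move=> /cu[N hN]; exists N => m n Nm Nn; rewrite -ltcR -normrnorm; exact: hN.
have [a ua] := cauchy_rlim cv.
have Sa : subc_set S a.
  by apply: subc_lim ua => n; have := subc_valP (u n); rewrite inE.
exists (SubElt (mem_set Sa)) => e /ua[N hN]; exists N => n /hN.
by rewrite -ltcR -normrnorm.
Qed.

HB.instance Definition _ := Uniform_isComplete.Build subc_type subc_complete.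

Lemma subc_mem (x : subc_type) : subc_set S (subc_val x).
Proof. by have := subc_valP x; rewrite inE. Qed.

Definition subc_mul (x y : subc_type) : subc_type :=
  SubElt (mem_set (subcM (subc_mem x) (subc_mem y))).

Definition subc_star (x : subc_type) : subc_type :=
  SubElt (mem_set (subcJ (subc_mem x))).

Lemma subc_mulA : associative subc_mul.
Proof. by move=> x y z; apply: val_inj; exact: cmulA. Qed.

Lemma subc_linl (c : R[i]%C) x y z :
  subc_mul (c *: x + y) z = c *: subc_mul x z + subc_mul y z.
Proof. by apply: val_inj; exact: cmul_linl. Qed.

Lemma subc_linr (c : R[i]%C) x y z :
  subc_mul x (c *: y + z) = c *: subc_mul x y + subc_mul x z.
Proof. by apply: val_inj; exact: cmul_linr. Qed.

Lemma subc_semilin (c : R[i]%C) x y :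
  subc_star (c *: x + y) = (c^* *: subc_star x + subc_star y)%R.
Proof. by apply: val_inj; exact: cstar_semilin. Qed.

Lemma subc_starM x y : subc_star (subc_mul x y) = subc_mul (subc_star y) (subc_star x).
Proof. by apply: val_inj; exact: cstarM. Qed.

Lemma subc_starK : involutive subc_star.
Proof. by move=> x; apply: val_inj; exact: cstarK. Qed.

Lemma subc_normM (x y : subc_type) : `|subc_mul x y| <= `|x| * `|y|.
Proof. exact: cnormM. Qed.

Lemma subc_norm_star (x : subc_type) : `|subc_mul (subc_star x) x| = `|x| ^+ 2.
Proof. exact: cnorm_cstar. Qed.

HB.instance Definition _ := isCStarAlg.Build R subc_type subc_mulA subc_linl subc_linr
  subc_semilin subc_starM subc_starK subc_normM subc_norm_star.

Definition sub_cstarAlg : cstarAlgType R := subc_type.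

End SubCStar.

(** * Partial powers and functions vanishing at infinity *)

Section PartialPowers.
Context {T : Type} (f g : T -> option T).
Hypothesis fgK : forall x y, f x = Some y <-> g y = Some x.

(** Same body as [pa_pow], for any mutually inverse pair of partial maps: it is also used for
    partial permutations of ['I_n]. *)
Definition ppow (k : int) (x : T) : option T :=
  match k with
  | Posz n => iter n (obind f) (Some x)
  | Negz n => iter n.+1 (obind g) (Some x)
  end.

Lemma ppowSr k x y z : ppow k x = Some y -> f y = Some z -> ppow (k + 1) x = Some z.
Proof.
case: k => [n|[|n]]; first by rewrite (_ : n%:Z + 1 = n.+1) /= => [->|]; last lia.
- by rewrite /= => /fgK + fy; rewrite fy => -[->].
- rewrite (_ : Negz n.+1 + 1 = Negz n); last by lia.
  rewrite /=; case: (obind g (iter n _ _)) => //= w /fgK fw fy.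
  by rewrite -fy fw.
Qed.

Lemma ppowPr k x y z : ppow k x = Some y -> g y = Some z -> ppow (k - 1) x = Some z.
Proof.
case: k => [[|n]|n]; first by move=> /= [->].
- rewrite (_ : Posz n.+1 - 1 = n); last by lia.
  rewrite /=; case: (iter n _ _) => //= w /fgK gw gy.
  by rewrite -gy gw.
- rewrite (_ : Negz n - 1 = Negz n.+1); last by lia.
  by rewrite /= => ->.
Qed.

(** Only this direction holds in general: the power [a + b] extends the composite, whose domain may
    be smaller when [a] and [b] have opposite signs. *)
Lemma ppowD a b x y z : ppow b x = Some y -> ppow a y = Some z ->
  ppow (a + b) x = Some z.
Proof.
move=> bx; case: a => n.
- elim: n z => [|n ih] z; first by move=> /= [<-]; rewrite add0r.
  move=> /=.
  case E : (iter n _ _) => [w|//] /= fw.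
  have -> : Posz n.+1 + b = Posz n + b + 1 by lia.
  by apply: ppowSr fw; exact: ih.
- elim: n z => [|n ih] z.
    by move=> /= gy; rewrite (_ : Negz 0 + b = b - 1); [exact: ppowPr gy|lia].
  move=> /=; case E : (obind g (iter n _ _)) => [w|//] /= fw.
  have -> : Negz n.+1 + b = Negz n + b - 1 by lia.
  by apply: ppowPr fw; exact: ih.
Qed.

Lemma ppow_opp k x y : ppow k x = Some y -> ppow (- k) y = Some x.
Proof.
case: k => n; last have -> : - Negz n = n.+1 by lia.
- suff : iter n (obind f) (Some x) = Some y -> ppow (- n%:Z) y = Some x by [].
  elim: n y => [|n ih] y; first by move=> /= [<-].
  rewrite iterS; case E : (iter n _ _) => [w|//] fw.
  have -> : - n.+1%:Z = - n%:Z + Negz 0 by lia.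
  by apply: (ppowD _ (ih _ E)); apply/fgK.
- suff : forall m, iter m (obind g) (Some x) = Some y -> ppow m%:Z y = Some x.
    by move=> /(_ n.+1); apply.
  move=> m; elim: m y => [|m ih] y; first by move=> /= [<-].
  rewrite iterS; case E : (iter m _ _) => [w|//] /fgK fw.
  have -> : m.+1%:Z = m%:Z + 1 by lia.
  exact: (@ppowD m%:Z 1 y w x fw (ih _ E)).
Qed.

Lemma ppow_sub a b x y z : ppow b x = Some y -> ppow a x = Some z ->
  ppow (a - b) y = Some z.
Proof. by move=> /ppow_opp bx ax; rewrite (ppowD bx ax). Qed.

End PartialPowers.

(** * Finitely supported sums over the integers *)

Section IntSums.

Definition intw (K : nat) : seq int := [seq i%:Z - K%:Z | i <- iota 0 (K + K).+1].

Lemma intw_uniq K : uniq (intw K).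
Proof. by rewrite map_inj_uniq ?iota_uniq// => i j; lia. Qed.

Lemma mem_intw K l : (l \in intw K) = (`|l| <= K)%N.
Proof.
apply/mapP/idP => [[i + ->]|lK]; first by rewrite mem_iota; lia.
by exists (absz (l + K%:Z)); rewrite ?mem_iota; lia.
Qed.

Lemma size_intw K : size (intw K) = (K + K).+1.
Proof. by rewrite size_map size_iota. Qed.

Context {V : nmodType}.
Implicit Types F : int -> V.

Lemma zsum_intw F K : (forall l, (K < `|l|)%N -> F l = 0) ->
  \sum_(l \in [set: int]) F l = \sum_(l <- intw K) F l.
Proof.
move=> FK; rewrite [RHS]fsbig_seq ?intw_uniq//; apply/esym; apply: fsbig_widen => //.
by move=> l [_ /= /negP]; rewrite mem_intw -ltnNge => /FK.
Qed.

Lemma zsum_shift F (k : int) :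
  \sum_(l \in [set: int]) F l = \sum_(l \in [set: int]) F (l + k).
Proof.
apply: (@reindex_fsbigT _ _ _ _ _ (fun l => l + k)).
by exists (fun l => l - k) => l; rewrite ?addrK ?subrK.
Qed.

Lemma zsum_opp F :
  \sum_(l \in [set: int]) F l = \sum_(l \in [set: int]) F (- l).
Proof.
apply: (@reindex_fsbigT _ _ _ _ _ (fun l => - l)).
by exists (fun l => - l) => l; rewrite opprK.
Qed.

Lemma zsum1 F k : (forall l, l != k -> F l = 0) -> \sum_(l \in [set: int]) F l = F k.
Proof.
move=> Fk; rewrite -(@fsbig_widen _ _ _ _ [set k])//; first by rewrite fsbig_set1.
by move=> l [_ /= lk]; rewrite Fk//; apply/eqP => ?; exact: lk.
Qed.

Lemma zsum0 F : (forall l, F l = 0) -> \sum_(l \in [set: int]) F l = 0.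
Proof. by move=> F0; rewrite (@zsum1 _ 0). Qed.

End IntSums.

(** * Functions vanishing at infinity *)

Section C0.
Context {R : realType} {X : topologicalType}.
Implicit Types (f g : X -> cplx R).

Lemma cplx_ctsP f x : {for x, continuous f} <->
  forall e : R, 0 < e -> \forall y \near x, cabs (f x - f y) < e.
Proof.
split=> [fx e e0|h].
  have /cvgrPdist_lt/(_ e%:C%C) := fx; rewrite ltcR => /(_ e0).
  by apply: filterS => y; rewrite normcabs ltcR.
apply/cvgrPdist_lt => e e0; have := h (complex.Re e).
have eE : e = (complex.Re e)%:C%C by rewrite RRe_real// gtr0_real.
move: e0; rewrite eE ltcR => e0 /(_ e0).
by apply: filterS => y; rewrite normcabs ltcR.
Qed.

Lemma C0P f : C0 R X f <-> continuous f /\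
  forall e : R, 0 < e -> compact [set x | e <= cabs (f x)].
Proof.
split=> -[fc h]; split=> // e e0.
  have := h e%:C%C; rewrite ltcR => /(_ e0); congr compact.
  by apply/seteqP; split => x /=; rewrite normcabs lecR.
have eE : e = (complex.Re e)%:C%C by rewrite RRe_real// gtr0_real.
move: e0; rewrite eE ltcR => /h; congr compact.
by apply/seteqP; split => x /=; rewrite normcabs lecR.
Qed.

Lemma cabs_continuous f : continuous f -> continuous (fun x => cabs (f x)).
Proof.
move=> fc x; apply/cvgrPdist_lt => e e0.
have /cplx_ctsP/(_ _ e0) := fc x; apply: filterS => y; apply: le_lt_trans.
rewrite ler_norml; have := cabsD (f x - f y) (f y); have := cabsD (f y - f x) (f x).
by rewrite !subrK -(cabsN (f y - _)) opprB; lra.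
Qed.

Lemma closed_cabs_ge f e : continuous f -> closed [set x | e <= cabs (f x)].
Proof.
move=> /cabs_continuous fc.
rewrite (_ : mkset _ = (fun x => cabs (f x)) @^-1` [set y | e <= y])//.
by apply: closed_comp => [x _|]; [exact: fc|exact: closed_ge].
Qed.

Lemma C0_intro f : continuous f ->
  (forall e : R, 0 < e -> exists2 K, compact K & forall x, e <= cabs (f x) -> K x) ->
  C0 R X f.
Proof.
move=> fc h; apply/C0P; split=> // e /h[K cK fK].
by apply: (subclosed_compact _ cK fK); exact: closed_cabs_ge.
Qed.

Lemma C0_cts f : C0 R X f -> continuous f. Proof. by case. Qed.

Lemma C0_compact f e : C0 R X f -> 0 < e -> compact [set x | e <= cabs (f x)].
Proof. by move=> /C0P[_]; apply. Qed.

Lemma C0_bounded f : C0 R X f -> exists2 M : R, 0 < M & forall x, cabs (f x) <= M.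
Proof.
move=> f0; have K := C0_compact f0 ltr01.
have fc := cabs_continuous (C0_cts f0).
have : compact ((fun x => cabs (f x)) @` [set x | 1 <= cabs (f x)]).
  by apply: continuous_compact K; exact: continuous_subspaceT.
move/compact_bounded => [M [_ hM]]; exists (`|M| + 1).
  by rewrite ltr_wpDl.
move=> x; have [x1|/ltW x1] := leP 1 (cabs (f x)); last by rewrite (le_trans x1)// lerDr.
have := hM (`|M| + 1); rewrite (le_lt_trans (ler_norm M)) ?ltrDl// => /(_ isT).
by move=> /(_ (cabs (f x))); rewrite /= ger0_norm ?cabs_ge0//; apply; exists x.
Qed.

Lemma C0_dominated f g (c : R) : C0 R X f -> continuous g ->
  (forall x, cabs (g x) <= c * cabs (f x)) -> C0 R X g.
Proof.
move=> f0 gc gf; apply: C0_intro => // e e0.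
have c1 : 0 < `|c| + 1 by rewrite ltr_wpDl.
exists [set x | e / (`|c| + 1) <= cabs (f x)].
  by apply: C0_compact; rewrite ?divr_gt0.
move=> x /= ex; rewrite ler_pdivrMr// (le_trans ex)// (le_trans (gf x))// mulrC.
by rewrite ler_wpM2l ?cabs_ge0// (le_trans (ler_norm _))// lerDl.
Qed.

Lemma C0_zero : C0 R X 0.
Proof.
apply: C0_intro; first exact: cst_continuous.
by move=> e e0; exists set0 => [|x /=]; [exact: compact0|rewrite cabs0 leNgt e0].
Qed.

Lemma C0D f g : C0 R X f -> C0 R X g -> C0 R X (f + g).
Proof.
move=> f0 g0; apply: C0_intro.
  by move=> x; apply: continuousD; exact: C0_cts.
move=> e e0; have e2 : 0 < e / 2 by rewrite divr_gt0.
exists ([set x | e / 2 <= cabs (f x)] `|` [set x | e / 2 <= cabs (g x)]).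
  by apply: compactU; exact: C0_compact.
move=> x /= h; apply/orP; rewrite -[_ || _]negbK negb_or -!ltNge.
apply/negP => /andP[h1 h2]; have := cabsD (f x) (g x).
move: (h : e <= cabs ((f x : R[i]%C) + g x)); lra.
Qed.

Lemma C0_mulr f g M : C0 R X f -> continuous g -> (forall x, cabs (g x) <= M) ->
  C0 R X (fun x => g x * f x).
Proof.
move=> f0 gc gM; apply: (C0_dominated (c := M) f0).
  by move=> x; apply: (@continuousM R[i]%C X g f x); [exact: gc|exact: C0_cts].
by move=> x; rewrite cabsM ler_wpM2r ?cabs_ge0.
Qed.

Lemma C0Z (z : R[i]%C) f : C0 R X f -> C0 R X (z *: f).
Proof.
move=> f0; apply: (@C0_mulr f (fun=> z) (cabs z)) => //; exact: cst_continuous.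
Qed.

Lemma conj_cts f : continuous f -> continuous (fun_star f).
Proof.
move=> fc x; apply/cplx_ctsP => e e0; have /cplx_ctsP/(_ _ e0) := fc x.
by apply: filterS => y; rewrite /fun_star -rmorphB cabsJ.
Qed.

Lemma C0_star f : C0 R X f -> C0 R X (fun_star f).
Proof.
move=> f0; apply: (C0_dominated (c := 1) f0); first exact/conj_cts/C0_cts.
by move=> x; rewrite mul1r /fun_star cabsJ.
Qed.

Lemma C0M f g : C0 R X f -> C0 R X g -> C0 R X (fun_mul f g).
Proof. by move=> /[dup] /C0_bounded[M _ fM] /C0_cts fc g0; exact: C0_mulr fM. Qed.

End C0.

(** * The *-algebra of a partial action *)

Section CPAlgebra.
Context {R : realType} {X : topologicalType} (Th : partial_aut X).
Implicit Types (f g : X -> cplx R) (x y : int -> X -> cplx R) (h : X) (k l m : int).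

Lemma pa_powD a b h h1 h2 : pa_pow Th b h = Some h1 -> pa_pow Th a h1 = Some h2 ->
  pa_pow Th (a + b) h = Some h2.
Proof. exact: (ppowD (@pa_fwdK _ Th)). Qed.

Lemma pa_pow_opp k h h1 : pa_pow Th k h = Some h1 -> pa_pow Th (- k) h1 = Some h.
Proof. exact: (ppow_opp (@pa_fwdK _ Th)). Qed.

Lemma pa_pow_sub a b h h1 h2 : pa_pow Th b h = Some h1 -> pa_pow Th a h = Some h2 ->
  pa_pow Th (a - b) h1 = Some h2.
Proof. exact: (ppow_sub (@pa_fwdK _ Th)). Qed.

Lemma pa_pow_open k U : open U -> open [set h | exists2 h', pa_pow Th k h = Some h' & U h'].
Proof.
have aux (p : X -> option X) n :
    (forall U, open U -> open [set h | exists2 h', p h = Some h' & U h']) ->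
    open U -> open [set h | exists2 h', iter n (obind p) (Some h) = Some h' & U h'].
  move=> po; elim: n U => [|n ih] V oV.
    by rewrite (_ : mkset _ = V)//; apply/seteqP; split => h /=; [case=> ? [->]|exists h].
  have := ih _ (po _ oV); congr open; apply/seteqP; split => h /=.
    by case=> h1 -> [h2 ? ?]; exists h2.
  case=> h2; case E : (iter n _ _) => [h1|//] /= ? ?.
  by exists h1 => //; exists h2.
case: k => n oU; first exact: (aux _ _ (@pa_fwd_open _ Th)).
exact: (aux _ n.+1 (@pa_bwd_open _ Th)).
Qed.

(** Openness of the domain and continuity of [theta^k] on it, in one statement. *)
Lemma pa_pow_near k h h1 (P : X -> Prop) : pa_pow Th k h = Some h1 ->
  (\forall y \near h1, P y) ->
  \forall h' \near h, exists2 y, pa_pow Th k h' = Some y & P y.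
Proof.
move=> E hP; have : nbhs h1 [set y | P y] by [].
rewrite nbhsE => -[U [oU Uh1] UP].
change (nbhs h [set h' | exists2 y, pa_pow Th k h' = Some y & P y]); rewrite nbhsE.
exists [set h | exists2 h', pa_pow Th k h = Some h' & U h'].
  by split; [exact: pa_pow_open|exists h1].
by move=> h' [y hy /UP]; exists y.
Qed.

Lemma pa_pullE k f g h : pa_pull Th k (fun_mul f (pa_pull Th (- k) g)) h =
  if pa_pow Th k h is Some h1 then f h1 * g h else 0.
Proof.
rewrite /pa_pull; case E : (pa_pow Th k h) => [h1|//].
by rewrite /fun_mul (pa_pow_opp E).
Qed.

Lemma cp_mulE x y m h : cp_mul Th x y m h = \sum_(l \in [set: int])
  if pa_pow Th l h is Some h1 then x (m - l) h1 * y l h else 0.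
Proof. by apply: eq_fsbigr => l _; rewrite pa_pullE. Qed.

Lemma C0_dom0 k : C0_dom Th k (0 : X -> cplx R).
Proof. by split=> //; exact: C0_zero. Qed.

Lemma C0_domD k f g : C0_dom Th k f -> C0_dom Th k g -> C0_dom Th k (f + g).
Proof.
move=> [f0 fk] [g0 gk]; split; first exact: C0D.
by move=> h /[dup]/fk E /gk E'; rewrite -[LHS]/(f h + g h) E E' addr0.
Qed.

Lemma C0_domZ k (z : R[i]%C) f : C0_dom Th k f -> C0_dom Th k (z *: f).
Proof.
move=> [f0 fk]; split; first exact: C0Z.
by move=> h /fk E; rewrite -[LHS]/(z * f h) E mulr0.
Qed.

Lemma C0_dom_sum k (I : Type) (s : seq I) (F : I -> X -> cplx R) :
  (forall i, C0_dom Th k (F i)) -> C0_dom Th k (\sum_(i <- s) F i).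
Proof.
move=> Fk; elim/big_rec : _ => [|i y _ h]; first exact: C0_dom0.
exact: C0_domD.
Qed.

Lemma C0_dom_C0 k f : C0_dom Th k f -> C0 R X f. Proof. by case. Qed.

(** The coefficient of [(s^k f)(s^l g)]. Inside the domain of [theta^l] continuity follows from
    [pa_pow_near]; outside, [g] vanishes and the bound by [M * |g|] squeezes the product to 0. *)
Lemma C0_dom_mul k l f g : C0_dom Th k f -> C0_dom Th l g ->
  C0_dom Th (k + l) (fun h => if pa_pow Th l h is Some h1 then f h1 * g h else 0).
Proof.
move=> [f0 fk] [g0 gl]; have [M M0 fM] := C0_bounded f0; have [N N0 gN] := C0_bounded g0.
have bd h : cabs (if pa_pow Th l h is Some h1 then f h1 * g h else 0) <= M * cabs (g h).
  case: pa_pow => [h1|]; first by rewrite cabsM ler_wpM2r ?cabs_ge0.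
  by rewrite cabs0 mulr_ge0 ?cabs_ge0// ltW.
split.
  apply: (C0_dominated g0 _ bd) => h; apply/cplx_ctsP => e e0.
  case E : (pa_pow Th l h) => [h1|].
    have [eN eM] : 0 < e / 2 / N /\ 0 < e / 2 / M by rewrite !divr_gt0.
    have /cplx_ctsP/(_ _ eM) gnear := C0_cts g0 (x := h).
    have /cplx_ctsP/(_ _ eN) fnear := C0_cts f0 (x := h1).
    near=> h'.
    have [h1' E' h1'f] : exists2 y, pa_pow Th l h' = Some y & cabs (f h1 - f y) < e / 2 / N.
      by near: h'; exact: pa_pow_near E fnear.
    have gh : cabs (g h - g h') < e / 2 / M by near: h'; exact: gnear.
    rewrite E'; have -> : (f h1 * g h - f h1' * g h' : R[i]%C) =
      f h1 * (g h - g h') + (f h1 - f h1') * g h' by ring.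
    rewrite (le_lt_trans (cabsD _ _))// !cabsM.
    have := fM h1; have := gN h'; have := cabs_ge0 (g h'); have := cabs_ge0 (f h1).
    have := cabs_ge0 (g h - g h'); have := cabs_ge0 (f h1 - f h1').
    move: h1'f gh; rewrite !ltr_pdivlMr//.
    move: (cabs _) (cabs _) (cabs _) (cabs _) => a b c d; nra.
  have eM : 0 < e / M by rewrite divr_gt0.
  have /cplx_ctsP/(_ _ eM) := C0_cts g0 (x := h); apply: filterS => h'.
  rewrite gl// !sub0r !cabsN ltr_pdivlMr// mulrC; exact/le_lt_trans/bd.
move=> h hN; case E : (pa_pow Th l h) => [h1|//].
case E' : (pa_pow Th k h1) => [h2|]; last by rewrite fk// mul0r.
by move: hN; rewrite (pa_powD E E').
Unshelve. all: by end_near. Qed.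

Hypothesis hausX : hausdorff_space X.

(** A superlevel set of the pullback is the image under [theta^(-k)] of one of [f], hence compact,
    hence closed in a Hausdorff space. Its closedness gives continuity at points outside the domain
    of [theta^k]. *)
Lemma C0_dom_pull k f : C0_dom Th (- k) f -> C0_dom Th k (pa_pull Th k f).
Proof.
move=> [f0 fk].
have cpt e : 0 < e -> compact [set h | e <= cabs (pa_pull Th k f h)].
  (* [F] is [theta^(-k)]; its default value is never taken on the superlevel set, where [f] is
     nonzero. *)
  move=> e0; pose F h := odflt h (pa_pow Th (- k) h).
  have : compact (F @` [set h | e <= cabs (f h)]).
    apply: continuous_compact; last exact: C0_compact.
    apply: continuous_in_subspaceT => h1; rewrite inE /= => eh1.
    have [h2 E] : exists h2, pa_pow Th (- k) h1 = Some h2.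
      case E : (pa_pow Th (- k) h1) => [h2|]; first by exists h2.
      by move: eh1; rewrite fk// cabs0 leNgt e0.
    have FE : F h1 = h2 by rewrite /F E.
    move=> U; rewrite FE => hU; have := pa_pow_near E hU.
    by apply: filterS => h' [y Ey Uy]; rewrite /= /F Ey.
  congr compact; apply/seteqP; split => h /=.
    case=> h1 eh1; rewrite /F; case E : (pa_pow Th (- k) h1) => [h2|]; last first.
      by move: eh1; rewrite fk// cabs0 leNgt e0.
    by move=> /= <-; rewrite /pa_pull; have := pa_pow_opp E; rewrite opprK => ->.
  rewrite /pa_pull; case E : (pa_pow Th k h) => [h1|]; last by rewrite cabs0 leNgt e0.
  by move=> eh1; exists h1 => //; rewrite /F (pa_pow_opp E).
split; last by move=> h E; rewrite /pa_pull E.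
apply/C0P; split=> //; move=> h; apply/cplx_ctsP => e e0.
case E : (pa_pow Th k h) => [h1|].
  have /cplx_ctsP/(_ _ e0) fnear := C0_cts f0 (x := h1).
  have := pa_pow_near E fnear; apply: filterS => h' [y hy].
  by rewrite /pa_pull E hy.
have : nbhs h (~` [set h | e <= cabs (pa_pull Th k f h)]).
  apply: open_nbhs_nbhs; split.
    by apply: closed_openC; apply: compact_closed => //; exact: cpt.
  by rewrite /= /pa_pull E cabs0; apply/negP; rewrite -ltNge.
apply: filterS => h' /= /negP; rewrite -ltNge.
by rewrite [pa_pull Th k f h]/pa_pull E sub0r cabsN.
Qed.

Lemma cp_supp x : cp_alg Th x -> exists K, forall k, (K < `|k|)%N -> x k = 0.
Proof.
move=> [/finite_seqP[s sE] _]; exists (\max_(k <- s) absz k)%N => k.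
rewrite ltnNge => /negP kK; apply: contrapT => xk; apply: kK.
have ks : k \in s by have : [set k | x k <> 0] k by []; rewrite sE.
exact: (@leq_bigmax_seq _ s xpredT (fun k : int => absz k) k ks isT).
Qed.

Lemma cp_algP x : cp_alg Th x <->
  (exists K, forall k, (K < `|k|)%N -> x k = 0) /\ forall k, C0_dom Th k (x k).
Proof.
split=> [xA|[[K xK] xd]]; first by split; [exact: cp_supp|case: xA].
split=> //; apply: (@sub_finite_set _ _ [set` intw K]); last exact: finite_seq.
by move=> k /= xk; rewrite mem_intw leqNgt; apply/negP => /xK.
Qed.

Lemma cp_alg_dom x k : cp_alg Th x -> C0_dom Th k (x k).
Proof. by case. Qed.

Lemma cp_alg0 : cp_alg Th (0 : int -> X -> cplx R).
Proof. by apply/cp_algP; split; [exists 0%N|move=> k; exact: C0_dom0]. Qed.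

Lemma cp_algD x y : cp_alg Th x -> cp_alg Th y -> cp_alg Th (x + y).
Proof.
move=> /cp_algP[[K xK] xd] /cp_algP[[L yL] yd]; apply/cp_algP; split.
  exists (maxn K L) => k; rewrite gtn_max => /andP[/xK + /yL].
  by rewrite -[(x + y) k]/(x k + y k) => -> ->; rewrite addr0.
by move=> k; exact: C0_domD.
Qed.

Lemma cp_algZ (z : R[i]%C) x : cp_alg Th x -> cp_alg Th (z *: x).
Proof.
move=> /cp_algP[[K xK] xd]; apply/cp_algP; split.
  by exists K => k /xK; rewrite -[(z *: x) k]/(z *: x k) => ->; rewrite scaler0.
by move=> k; exact: C0_domZ.
Qed.

Lemma cp_alg_mul x y : cp_alg Th x -> cp_alg Th y -> cp_alg Th (cp_mul Th x y).
Proof.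
move=> /cp_algP[[K xK] xd] /cp_algP[[L yL] yd]; apply/cp_algP; split.
  exists (K + L)%N => k kKL; apply/funext => h; rewrite cp_mulE zsum0// => l.
  case: pa_pow => [h1|//]; have [/yL ->|lL] := ltnP L `|l|; first by rewrite mulr0.
  by rewrite xK ?mul0r//; lia.
move=> k; have -> : cp_mul Th x y k = \sum_(l <- intw L)
    (fun h => if pa_pow Th l h is Some h1 then x (k - l) h1 * y l h else 0).
  apply/funext => h; rewrite cp_mulE fct_sumE (@zsum_intw _ _ L)// => l /yL ->.
  by case: pa_pow => [h1|//]; rewrite mulr0.
apply: C0_dom_sum => l; rewrite -[X in C0_dom _ X](subrK l).
exact: C0_dom_mul.
Qed.

Lemma cp_alg_star x : cp_alg Th x -> cp_alg Th (cp_star Th x).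
Proof.
move=> /cp_algP[[K xK] xd]; apply/cp_algP; split.
  exists K => k kK; apply/funext => h; rewrite /cp_star /pa_pull.
  by case: pa_pow => [h1|//]; rewrite /fun_star xK ?conjC0//; lia.
move=> k; apply: C0_dom_pull; split; first by apply: C0_star; case: (xd (- k)).
by move=> h E; rewrite /fun_star (xd (- k)).2// conjC0.
Qed.

End CPAlgebra.

(** * Upper bounds valid in every representation *)

Section CPHom.
Context {R : realType} {X : topologicalType} (Th : partial_aut X).
Hypothesis hausX : hausdorff_space X.
Context {A : cstarAlgType R} (phi : (int -> X -> cplx R) -> A).
Hypothesis phiH : is_cp_hom Th phi.
Implicit Types (f g : X -> cplx R) (x y w : int -> X -> cplx R) (h : X) (k l m : int).

Lemma cp_homD x y : cp_alg Th x -> cp_alg Th y -> phi (x + y) = phi x + phi y.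
Proof.
by move=> xA yA; have [/(_ 1 _ _ xA yA) + _ _] := phiH; rewrite !scale1r.
Qed.

Lemma cp_hom0 : phi 0 = 0.
Proof. by apply: (addrI (phi 0)); rewrite -cp_homD ?addr0//; exact: cp_alg0. Qed.

Lemma cp_homZ (z : R[i]%C) x : cp_alg Th x -> phi (z *: x) = z *: phi x.
Proof.
move=> xA; have [/(_ z _ _ xA (cp_alg0 _)) + _ _] := phiH.
by rewrite cp_hom0 !addr0.
Qed.

Lemma cp_homN x : cp_alg Th x -> phi (- x) = - phi x.
Proof. by move=> xA; rewrite -scaleN1r cp_homZ// scaleN1r. Qed.

Lemma cp_homM x y : cp_alg Th x -> cp_alg Th y -> phi (cp_mul Th x y) = cmul (phi x) (phi y).
Proof. by move=> xA yA; have [_ + _] := phiH; apply. Qed.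

Lemma cp_homJ x : cp_alg Th x -> phi (cp_star Th x) = cstar (phi x).
Proof. by move=> xA; have [_ _] := phiH; apply. Qed.

Lemma cp_alg_sum (I : Type) (s : seq I) (F : I -> int -> X -> cplx R) :
  (forall i, cp_alg Th (F i)) -> cp_alg Th (\sum_(i <- s) F i).
Proof.
move=> FA; elim/big_rec : _ => [|i y _ h]; first exact: cp_alg0.
exact: cp_algD.
Qed.

Lemma cp_hom_sum (I : Type) (s : seq I) (F : I -> int -> X -> cplx R) :
  (forall i, cp_alg Th (F i)) -> phi (\sum_(i <- s) F i) = \sum_(i <- s) phi (F i).
Proof.
move=> FA; elim: s => [|i s ih]; first by rewrite !big_nil cp_hom0.
by rewrite !big_cons cp_homD ?ih//; exact: cp_alg_sum.
Qed.

Definition single k f : int -> X -> cplx R := fun l => if l == k then f else 0.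

Lemma cp_alg_single k f : C0_dom Th k f -> cp_alg Th (single k f).
Proof.
move=> fk; apply/cp_algP; split.
  by exists `|k|%N => l kl; rewrite /single ifN//; apply/eqP => E; rewrite E ltnn in kl.
by move=> l; rewrite /single; case: eqP => [->//|_]; exact: C0_dom0.
Qed.

Lemma cp_single_sum x K : (forall k, (K < `|k|)%N -> x k = 0) ->
  x = \sum_(k <- intw K) single k (x k).
Proof.
move=> xK; apply/funext => k; rewrite fct_sumE -zsum_intw.
  by rewrite (@zsum1 _ _ k) /single ?eqxx// => l /negPf; rewrite eq_sym => ->.
by move=> l /xK ->; rewrite /single; case: ifP.
Qed.

(** The pullbacks disappear: the coefficient becomes a correlation between the two points [h] and
    [theta^m h] of one orbit. Terms with [theta^l h] undefined may be added, since [w l h = 0]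
    there. *)
Lemma cp_star_mulE w m h : cp_alg Th w -> cp_mul Th (cp_star Th w) w m h =
  \sum_(l \in [set: int])
    if pa_pow Th m h is Some z then (w (l - m) z : R[i]%C)^* * w l h else 0.
Proof.
move=> wA; rewrite cp_mulE; apply: eq_fsbigr => l _.
case E : (pa_pow Th l h) => [y|]; last first.
  by rewrite (cp_alg_dom l wA).2//; case: pa_pow => // z; rewrite mulr0.
rewrite /cp_star /pa_pull; case E' : (pa_pow Th m h) => [z|].
  by rewrite (pa_pow_sub E E') /fun_star opprB.
case E'' : (pa_pow Th (m - l) y) => [z|]; last by rewrite mul0r.
by have := pa_powD E E''; rewrite subrK E'.
Qed.

(** The value at [h] of the conditional expectation of [x^* x] onto degree 0, as [cp_star_mul0]
    shows. *)
Definition sqsum x h : R := \sum_(l \in [set: int]) cabs (x l h) ^+ 2.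

Lemma sqsum_ge0 x h : 0 <= sqsum x h.
Proof. by apply: fsumr_ge0 => l _; exact: sqr_ge0. Qed.

Lemma cp_star_mul0 w h : cp_alg Th w ->
  cp_mul Th (cp_star Th w) w 0 h = (sqsum w h)%:C%C.
Proof.
move=> wA; have [K wK] := cp_supp wA; rewrite cp_star_mulE// /sqsum.
rewrite !(@zsum_intw _ _ K) ?rmorph_sum/=; last 2 first.
- by move=> l /wK ->; rewrite cabs0 expr0n.
- by move=> l /wK ->; rewrite mulr0.
by apply: eq_bigr => l _; rewrite subr0 mulJc.
Qed.

(* The coefficient of degree m is a correlation sum, to which 2ab <= a^2 + b^2 applies. *)
Lemma cp_star_mul_le w m h M : cp_alg Th w -> (forall h, sqsum w h <= M) ->
  cabs (cp_mul Th (cp_star Th w) w m h) <= M.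
Proof.
move=> wA wM; have [K wK] := cp_supp wA; rewrite cp_star_mulE//.
case E : (pa_pow Th m h) => [z|]; last first.
  by rewrite zsum0// cabs0; exact: le_trans (sqsum_ge0 w h) (wM h).
have wK' l : (K + `|m| < `|l|)%N -> w l = 0 by move=> ?; apply: wK; lia.
have wK'' l : (K + `|m| < `|l|)%N -> w (l - m) = 0 by move=> ?; apply: wK; lia.
rewrite (@zsum_intw _ _ (K + `|m|)); last by move=> l /wK' ->; rewrite mulr0.
have := lerD (wM h) (wM z); rewrite {2}/sqsum (zsum_shift _ (- m)) /sqsum.
rewrite !(@zsum_intw _ _ (K + `|m|)); last 2 first.
- by move=> l /wK' ->; rewrite cabs0 expr0n.
- by move=> l /wK'' ->; rewrite cabs0 expr0n.
rewrite -big_split/= => H.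
have : 2 * cabs (\sum_(l <- intw (K + `|m|)) (w (l - m) z : R[i]%C)^* * w l h) <=
   \sum_(l <- intw (K + `|m|)) (cabs (w l h) ^+ 2 + cabs (w (l - m) z) ^+ 2).
  rewrite (le_trans (ler_wpM2l (ler0n _ 2) (cabs_sum _ _ _)))// mulr_sumr.
  apply: ler_sum => l _; rewrite cabsM cabsJ.
  have := sqr_ge0 (cabs (w l h) - cabs (w (l - m) z)); rewrite sqrrB; lra.
lra.
Qed.

Lemma real_cts (r : X -> R) : continuous r -> continuous (fun h => (r h)%:C%C : cplx R).
Proof.
move=> rc h; apply/cplx_ctsP => e e0.
have /cvgrPdist_lt/(_ _ e0) := rc h; apply: filterS => y.
by rewrite -rmorphB/= cabs_real.
Qed.

Lemma cp_mul_single0 f g : C0 R X g ->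
  cp_mul Th (single 0 f) (single 0 g) = single 0 (fun_mul f g).
Proof.
move=> g0; apply/funext => k; apply/funext => h; rewrite cp_mulE (@zsum1 _ _ 0).
  by rewrite /single /= subr0; case: eqP => //; rewrite mul0r.
by move=> l /negPf l0; rewrite {2}/single l0; case: pa_pow => // ?; rewrite mulr0.
Qed.

Lemma cp_star_single0 f : cp_star Th (single 0 f) = single 0 (fun_star f).
Proof.
apply/funext => k; apply/funext => h; rewrite /cp_star /pa_pull /single oppr_eq0.
case: eqP => [->//|_]; case: pa_pow => // ?; exact: conjC0.
Qed.

Lemma C0_dom_0 f : C0 R X f -> C0_dom Th 0 f.
Proof. by []. Qed.

(** Here [b = 1 - sqrt(1 - r^2)] can be formed pointwise, and [|b| <= |r|] keeps it in [C_0]; then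
    [rnorm_le1_circle] applies to the images. *)
Lemma cp_hom_single0_real1 (r : X -> R) : C0 R X (fun h => (r h)%:C%C) ->
  continuous r -> (forall h, `|r h| <= 1) ->
  rnorm (phi (single 0 (fun h => (r h)%:C%C))) <= 1.
Proof.
move=> r0 rc r1; pose b h := 1 - Num.sqrt (1 - r h ^+ 2).
have r2 h : 0 <= 1 - r h ^+ 2.
  by rewrite subr_ge0 -real_normK ?num_real// expr_le1.
have bb h : b h + b h - b h * b h = r h * r h.
  have := sqr_sqrtr (r2 h); rewrite /b; move: (Num.sqrt _) => s sE; nra.
have bc : continuous b.
  move=> h; apply: cvgB; first exact: cvg_cst.
  apply: continuous_cvg; first exact: sqrt_continuous.
  by apply: cvgB; [exact: cvg_cst|apply: cvgM; exact: rc].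
have br h : `|b h| <= `|r h|.
  have := sqr_sqrtr (r2 h); have := sqrtr_ge0 (1 - r h ^+ 2); have := r1 h.
  rewrite /b; move: (Num.sqrt _) => s s1 s0 sE.
  have sle : s <= 1 by move: (sqr_ge0 (r h)); nra.
  rewrite (@ger0_norm _ (1 - s)) ?subr_ge0//.
  have : (`|r h|) ^+ 2 = r h ^+ 2 by rewrite real_normK ?num_real.
  have := normr_ge0 (r h); move: (`|r h|) (r h ^+ 2) sE s1 => u v; nra.
have b0 : C0 R X (fun h => (b h)%:C%C).
  apply: (C0_dominated (c := 1) r0); first exact: real_cts.
  by move=> h; rewrite mul1r !cabs_real.
have starr (u : X -> R) : fun_star (fun h => (u h)%:C%C) = (fun h => (u h)%:C%C).
  by apply/funext => h; rewrite /fun_star conj_real.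
have [rA bA] := (cp_alg_single (C0_dom_0 r0), cp_alg_single (C0_dom_0 b0)).
apply: (@rnorm_le1_circle _ _ _ (phi (single 0 (fun h => (b h)%:C%C)))).
- by rewrite -cp_homJ// cp_star_single0 starr.
- by rewrite -cp_homJ// cp_star_single0 starr.
- rewrite -!cp_homM// !cp_mul_single0//; congr phi; congr single.
  by apply/funext => h; rewrite /fun_mul mulrC.
have bbA : cp_alg Th (single 0 (fun_mul (fun h => (b h)%:C%C) (fun h => (b h)%:C%C))).
  exact/cp_alg_single/C0_dom_0/C0M.
have nA := cp_algZ (-1) bbA; rewrite scaleN1r in nA.
rewrite -!cp_homM// !cp_mul_single0// -cp_homN// -cp_homD// -cp_homD//; last exact: cp_algD.
congr phi; apply/funext => k; apply/funext => h.
change (single 0 (fun h => (b h)%:C%C) k h + single 0 (fun h => (b h)%:C%C) k h -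
  single 0 (fun_mul (fun h => (b h)%:C%C) (fun h => (b h)%:C%C)) k h =
  single 0 (fun_mul (fun h => (r h)%:C%C) (fun h => (r h)%:C%C)) k h).
rewrite /single; case: eqP => _; last by rewrite subr0 addr0.
by rewrite /fun_mul -!rmorphM/= -rmorphD/= -rmorphB/= bb.
Qed.

(** By the C*-identity the degree can be removed: [(s^k f)^* (s^k f)] is [|f|^2] in degree 0, that
    is [c^2] times a real function bounded by 1. *)
Lemma cp_hom_single_le k f (c : R) : 0 < c -> C0_dom Th k f -> (forall h, cabs (f h) <= c) ->
  rnorm (phi (single k f)) <= c.
Proof.
move=> c0 fk fc; have f0 := C0_dom_C0 fk; have fA := cp_alg_single fk.
have SA : cp_alg Th (cp_star Th (single k f)) by exact: cp_alg_star.
pose r h := (cabs (f h) / c) ^+ 2.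
have rc : continuous r.
  move=> h; apply: cvgM; apply: cvgM; try exact: cvg_cst; exact: cabs_continuous (C0_cts f0) h.
have r1 h : `|r h| <= 1.
  rewrite ger0_norm ?sqr_ge0// expr_le1 ?divr_ge0 ?cabs_ge0 ?(ltW c0)//.
  by rewrite ler_pdivrMr// mul1r.
have rC0 : C0 R X (fun h => (r h)%:C%C).
  apply: (C0_dominated (c := c^-1) f0); first exact: real_cts.
  move=> h; rewrite cabs_real ger0_norm ?sqr_ge0// /r expr2 mulrC [X in X * _]mulrC.
  rewrite ler_piMr ?mulr_ge0 ?invr_ge0 ?cabs_ge0 ?(ltW c0)//.
  by rewrite ler_pdivrMr// mul1r.
have E : cp_mul Th (cp_star Th (single k f)) (single k f) =
    (c ^+ 2)%:C%C *: single 0 (fun h => (r h)%:C%C).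
  apply/funext => m; apply/funext => h.
  change (cp_mul Th (cp_star Th (single k f)) (single k f) m h =
    (c ^+ 2)%:C%C * single 0 (fun h => (r h)%:C%C) m h).
  rewrite [X in _ = _ * X]/single; case: eqP => [->|/eqP m0].
    rewrite cp_star_mul0// -rmorphM; congr (_%:C)%C.
    rewrite /sqsum (@zsum1 _ _ k) /single ?eqxx; last first.
      by move=> l /negPf ->; rewrite cabs0 expr0n.
    by rewrite /r; field; rewrite gt_eqF.
  rewrite cp_star_mulE// mulr0 zsum0// => l; case: pa_pow => // z.
  rewrite /single; case: eqP => [E1|_]; last by rewrite conjC0 mul0r.
  by case: eqP => [E2|]; [case/eqP: m0; lia|rewrite mulr0].
rewrite -(@ler_pXn2r _ 2) ?nnegrE ?rnorm_ge0 ?(ltW c0)// -rnorm_cstar -cp_homJ// -cp_homM//.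
rewrite E cp_homZ; last exact/cp_alg_single/C0_dom_0.
rewrite rnormZ cabs_real ger0_norm ?sqr_ge0// ler_piMr ?sqr_ge0//.
exact: cp_hom_single0_real1.
Qed.

Lemma cp_hom_le x K (c : R) : cp_alg Th x -> (forall k, (K < `|k|)%N -> x k = 0) ->
  0 <= c -> (forall k h, cabs (x k h) <= c) -> rnorm (phi x) <= (K + K).+1%:R * c.
Proof.
move=> xA xK; rewrite le_eqVlt => /predU1P[<-|c0] xc.
  suff -> : x = 0 by rewrite cp_hom0 rnorm0 mulr0.
  apply/funext => k; apply/funext => h; apply: cabs_eq0; apply/eqP.
  by rewrite eq_le cabs_ge0 andbT xc.
have sA k := cp_alg_single (cp_alg_dom k xA).
rewrite {1}(cp_single_sum xK) cp_hom_sum// (le_trans (rnorm_sum _ _ _))//.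
rewrite (le_trans (ler_sum _ (fun k _ => cp_hom_single_le c0 (cp_alg_dom k xA) (xc k))))//.
by rewrite big_const_seq count_predT iter_addr_0 size_intw mulr_natl.
Qed.

Definition wseq x := fix w n := if n is n'.+1 then cp_mul Th (cp_star Th (w n')) (w n') else x.

Lemma wseqS x n : wseq x n.+1 = cp_mul Th (cp_star Th (wseq x n)) (wseq x n).
Proof. by []. Qed.

Lemma cp_alg_wseq x n : cp_alg Th x -> cp_alg Th (wseq x n).
Proof.
move=> xA; elim: n => // n ih; rewrite wseqS.
by apply: cp_alg_mul => //; exact: cp_alg_star.
Qed.

Lemma rnorm_wseq x n : cp_alg Th x -> rnorm (phi (wseq x n)) = rnorm (phi x) ^+ (2 ^ n).
Proof.
move=> xA; elim: n => [|n ih]; first by rewrite expr1.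
have wA := cp_alg_wseq n xA; have sA : cp_alg Th (cp_star Th (wseq x n)) by exact: cp_alg_star.
by rewrite wseqS cp_homM// cp_homJ// rnorm_cstar ih -exprM expnSr.
Qed.

Lemma wseq_supp x K n : cp_alg Th x -> (forall k, (K < `|k|)%N -> x k = 0) ->
  forall k, (2 ^ n * K < `|k|)%N -> wseq x n k = 0.
Proof.
move=> xA xK; elim: n => [|n ih] k; first by rewrite mul1n; exact: xK.
rewrite expnS => kK; apply/funext => h; rewrite wseqS cp_star_mulE; last exact: cp_alg_wseq.
apply: zsum0 => l; case: pa_pow => // z.
have [/ih ->|lL] := ltnP (2 ^ n * K) `|l|; first by rewrite mulr0.
by rewrite ih ?conjC0 ?mul0r//; lia.
Qed.

(* The norms of w_n := wseq x n satisfy |w_n| = |x|^(2^n), while |w_{n+1}| is at most the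
   number of its coefficients, linear in 2^n, times their bound M.  Taking 2^(n+1)-th
   roots the linear factor disappears: this is where the amenability of Z enters. *)
Lemma cp_hom_growth x K n M : cp_alg Th x -> (forall k, (K < `|k|)%N -> x k = 0) ->
  0 <= M -> (forall h, sqsum (wseq x n) h <= M) ->
  rnorm (phi x) ^+ (2 ^ n.+1) <= (2 ^ n.+1 * K + 2 ^ n.+1 * K).+1%:R * M.
Proof.
move=> xA xK M0 xM; rewrite -rnorm_wseq//; apply: cp_hom_le => //.
- exact: cp_alg_wseq.
- exact: wseq_supp.
- by move=> k h; rewrite wseqS; apply: cp_star_mul_le => //; exact: cp_alg_wseq.
Qed.

End CPHom.

(** * Central functions and density *)

Lemma approx_seq (R : realType) (A : cstarAlgType R) (T : Type) (P : T -> Prop) (f : T -> A) a :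
  (forall e : R, 0 < e -> exists2 x, P x & rnorm (a - f x) < e) ->
  exists2 u, (forall n : nat, P (u n)) & rlim (f \o u) a.
Proof.
move=> h; have /choice[u uP] n : exists x, P x /\ rnorm (a - f x) < n.+1%:R^-1.
  by have [|x xA xb] := h n.+1%:R^-1; [rewrite invr_gt0|exists x].
exists u => [n|d d0]; first by have [] := uP n.
exists (Num.truncn d^-1) => n nd; have [_] := uP n; rewrite rdistC => /lt_trans; apply.
rewrite -[ltRHS]invrK ltf_pV2 ?posrE ?invr_gt0//.
by rewrite (lt_le_trans (Num.Theory.truncnS_gt _))// ler_nat.
Qed.

Section CentralFunctions.
Context {R : realType} {X : topologicalType} (Th : partial_aut X).
Implicit Types (F G : X -> cplx R) (x y : int -> X -> cplx R) (h : X) (k l m : int).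

(** Constancy along orbits makes multiplication of all coefficients by [F] commute with the product,
    so these functions become central multipliers. *)
Definition invariant_fun F := [/\ continuous F, exists c : R, forall h, cabs (F h) <= c
  & forall h h', pa_fwd Th h = Some h' -> F h = F h'].

Definition mulF F x : int -> X -> cplx R := fun k h => F h * x k h.

Lemma invariant_pow F k h h' : invariant_fun F -> pa_pow Th k h = Some h' -> F h = F h'.
Proof.
move=> [_ _ Fi].
have aux (p : X -> option X) n h1 : (forall h h', p h = Some h' -> F h = F h') ->
    iter n (obind p) (Some h) = Some h1 -> F h = F h1.
  move=> pF; elim: n h1 => [|n ih] h1 /=; first by move=> [->].
  by case E : (iter n _ _) => [h2|//] /= /pF <-; exact: ih.
case: k => n; first exact: (aux (pa_fwd Th) n h' Fi).
by apply: (aux (pa_bwd Th) n.+1 h') => h1 h2 /pa_fwdK/Fi.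
Qed.

Lemma cp_alg_mulF F x : invariant_fun F -> cp_alg Th x -> cp_alg Th (mulF F x).
Proof.
move=> [Fc [c Fb] _] /cp_algP[[K xK] xd]; apply/cp_algP; split.
  by exists K => k /xK E; apply/funext => h; rewrite /mulF E mulr0.
move=> k; have [x0 xk] := xd k; split; first exact: C0_mulr Fb.
by move=> h /xk E; rewrite /mulF E mulr0.
Qed.

Lemma mulF_mul F G x y : invariant_fun F -> cp_alg Th y ->
  cp_mul Th (mulF F x) (mulF G y) = mulF (fun_mul F G) (cp_mul Th x y).
Proof.
move=> Fi yA; have [K yK] := cp_supp yA; apply/funext => m; apply/funext => h.
rewrite /mulF !cp_mulE !(@zsum_intw _ _ K).
- rewrite mulr_sumr; apply: eq_bigr => l _; case E : (pa_pow Th l h) => [h1|].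
    by rewrite /fun_mul (invariant_pow Fi E); ring.
  by rewrite mulr0.
- by move=> l /yK ->; case: pa_pow => // ?; rewrite mulr0.
- by move=> l /yK ->; case: pa_pow => // ?; rewrite !mulr0.
Qed.

Lemma mulF_star F x : invariant_fun F ->
  cp_star Th (mulF F x) = mulF (fun_star F) (cp_star Th x).
Proof.
move=> Fi; apply/funext => m; apply/funext => h; rewrite /cp_star /mulF /pa_pull.
case E : (pa_pow Th m h) => [h1|]; last by rewrite mulr0.
by rewrite /fun_star rmorphM/= (invariant_pow Fi E).
Qed.

Lemma invariant_star F : invariant_fun F -> invariant_fun (fun_star F).
Proof.
move=> [Fc [c Fb] Fi]; split; first exact: conj_cts.
  by exists c => h; rewrite /fun_star cabsJ.
by move=> h h' /Fi E; rewrite /fun_star E.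
Qed.

Lemma invariantM F G : invariant_fun F -> invariant_fun G -> invariant_fun (fun_mul F G).
Proof.
move=> [Fc [c Fb] Fi] [Gc [d Gb] Gi]; split.
- by move=> h; apply: (@continuousM R[i]%C X F G h); [exact: Fc|exact: Gc].
- by exists (c * d) => h; rewrite /fun_mul cabsM ler_pM ?cabs_ge0.
- by move=> h h' /[dup] /Fi E /Gi E'; rewrite /fun_mul E E'.
Qed.

Lemma invariantD F G : invariant_fun F -> invariant_fun G -> invariant_fun (F + G).
Proof.
move=> [Fc [c Fb] Fi] [Gc [d Gb] Gi]; split.
- by move=> h; apply: continuousD; [exact: Fc|exact: Gc].
- by exists (c + d) => h; rewrite (le_trans (cabsD _ _))// lerD.
- by move=> h h' /[dup] /Fi E /Gi E'; rewrite -[LHS]/(F h + G h) E E'.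
Qed.

Lemma invariant_cst (z : R[i]%C) : invariant_fun (fun=> z).
Proof. by split=> //; [exact: cst_continuous|exists (cabs z)]. Qed.

Lemma invariantZ (z : R[i]%C) F : invariant_fun F -> invariant_fun (z *: F).
Proof. exact: (invariantM (invariant_cst z)). Qed.

Hypothesis hausX : hausdorff_space X.

Section Bound.
Context {A : cstarAlgType R} (phi : (int -> X -> cplx R) -> A).
Hypothesis phiH : is_cp_hom Th phi.

(** [(F x)^* (F x) = |F|^2 x^* x = x^* x]. *)
Lemma mulF_isometry F x : invariant_fun F -> (forall h, cabs (F h) = 1) -> cp_alg Th x ->
  rnorm (phi (mulF F x)) = rnorm (phi x).
Proof.
move=> Fi F1 xA; apply: (@pexpIrn _ 2); rewrite ?nnegrE ?rnorm_ge0//.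
have FA := cp_alg_mulF Fi xA; have [SA SFA] := (cp_alg_star hausX xA, cp_alg_star hausX FA).
rewrite -!rnorm_cstar -!(cp_homJ phiH)// -!(cp_homM phiH)//; congr (rnorm (phi _)).
rewrite (mulF_star _ Fi) (mulF_mul _ _ (invariant_star Fi) xA).
apply/funext => k; apply/funext => h; rewrite /mulF /fun_mul /fun_star mulJc F1.
by rewrite expr1n rmorph1 mul1r.
Qed.

(** [r] is the mean of the unimodular function [u = r + i sqrt(1 - r^2)] and its conjugate, both of
    which act isometrically. *)
Lemma mulF_real_le1 (r : X -> R) x : invariant_fun (fun h => (r h)%:C%C) -> continuous r ->
  (forall h, `|r h| <= 1) -> cp_alg Th x ->
  rnorm (phi (mulF (fun h => (r h)%:C%C) x)) <= rnorm (phi x).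
Proof.
move=> Fi rc r1 xA; pose s h := Num.sqrt (1 - r h ^+ 2).
have r2 h : 0 <= 1 - r h ^+ 2.
  by rewrite subr_ge0 -real_normK ?num_real// expr_le1.
have sc : continuous s.
  move=> h; apply: continuous_cvg; first exact: sqrt_continuous.
  by apply: cvgB; [exact: cvg_cst|apply: cvgM; exact: rc].
have si : invariant_fun (fun h => (s h)%:C%C).
  split; first exact: real_cts.
    exists 1 => h; rewrite cabs_real ger0_norm ?sqrtr_ge0//.
    by rewrite -[leRHS]sqrtr1 ler_sqrt// gerBl sqr_ge0.
  by have [_ _ inv] := Fi; move=> h h' /inv /complexI E; rewrite /s E.
pose u : X -> cplx R := (fun h => (r h)%:C%C) + 'i%R *: (fun h => (s h)%:C%C).
have ui : invariant_fun u by apply: invariantD => //; exact: invariantZ.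
have uE h : u h = (r h)%:C%C + 'i%R * (s h)%:C%C by [].
have uJ h : fun_star u h = (r h)%:C%C - 'i%R * (s h)%:C%C.
  by rewrite /fun_star uE rmorphD rmorphM/= conjCi !conj_real mulNr.
have u1 h : cabs (u h) = 1.
  apply: (@pexpIrn _ 2); rewrite ?nnegrE ?cabs_ge0//; apply: complexI.
  rewrite -mulJc -[(u h)^*]/(fun_star u h) uJ uE expr1n rmorph1.
  have -> : ((r h)%:C - 'i%R * (s h)%:C)%C * ((r h)%:C + 'i%R * (s h)%:C)%C =
    ((r h) ^+ 2)%:C%C - 'i%R ^+ 2 * ((s h) ^+ 2)%:C%C :> R[i]%C.
    by rewrite !rmorphXn/=; ring.
  by rewrite sqrCi mulN1r opprK -rmorphD/= sqr_sqrtr// subrKC rmorph1.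
have uJ1 h : cabs (fun_star u h) = 1 by rewrite /fun_star cabsJ.
have E : mulF (fun h => (r h)%:C%C) x = (2^-1)%:C%C *: (mulF u x + mulF (fun_star u) x).
  apply/funext => k; apply/funext => h.
  change ((r h)%:C%C * x k h = (2^-1)%:C%C * (u h * x k h + fun_star u h * x k h)).
  rewrite uE uJ -mulrDl mulrA; congr (_ * _).
  rewrite addrCA addrAC subrK [X in _ * X](_ : _ = (r h + r h)%:C%C); last first.
    by rewrite rmorphD.
  by rewrite -rmorphM/=; congr (_%:C%C); lra.
have [uA vA] := (cp_alg_mulF ui xA, cp_alg_mulF (invariant_star ui) xA).
rewrite E (cp_homZ phiH); last exact: cp_algD.
rewrite (cp_homD phiH)// rnormZ cabs_real ger0_norm ?invr_ge0//.
have := rnormD (phi (mulF u x)) (phi (mulF (fun_star u) x)).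
rewrite !mulF_isometry//; last exact: invariant_star.
lra.
Qed.

(** Reduction to the real case: [(F x)^* (F x) = c^2 x^* (r x)] with [r = (|F| / c)^2 <= 1]. The
    bound is what allows multiplication by [F] to extend from the image of the finite sums to the
    whole C*-algebra. *)
Lemma mulF_le F x (c : R) : invariant_fun F -> (forall h, cabs (F h) <= c) -> cp_alg Th x ->
  0 <= c -> rnorm (phi (mulF F x)) <= c * rnorm (phi x).
Proof.
move=> Fi Fc xA; rewrite le_eqVlt => /predU1P[c0|c0].
  have -> : mulF F x = 0.
    apply/funext => k; apply/funext => h; rewrite /mulF (@cabs_eq0 _ (F h)) ?mul0r//.
    by apply/eqP; rewrite eq_le cabs_ge0 andbT c0 Fc.
  by rewrite (cp_hom0 phiH) rnorm0 -c0 mul0r.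
pose r h := (cabs (F h) / c) ^+ 2; have [Fcont _ Finv] := Fi.
have rc : continuous r.
  move=> h; apply: cvgM; apply: cvgM; try exact: cvg_cst; exact: cabs_continuous Fcont h.
have r1 h : `|r h| <= 1.
  rewrite ger0_norm ?sqr_ge0// expr_le1 ?divr_ge0 ?cabs_ge0 ?(ltW c0)//.
  by rewrite ler_pdivrMr// mul1r.
have ri : invariant_fun (fun h => (r h)%:C%C).
  split; first exact: real_cts; first by exists 1 => h; rewrite cabs_real.
  by move=> h h' /Finv E; rewrite /r E.
have FA := cp_alg_mulF Fi xA; have [SA SFA] := (cp_alg_star hausX xA, cp_alg_star hausX FA).
have rA := cp_alg_mulF ri xA.
rewrite -(@ler_pXn2r _ 2) ?nnegrE ?mulr_ge0 ?rnorm_ge0 ?(ltW c0)//.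
rewrite -rnorm_cstar -(cp_homJ phiH)// -(cp_homM phiH)//.
have -> : cp_mul Th (cp_star Th (mulF F x)) (mulF F x) =
    (c ^+ 2)%:C%C *: cp_mul Th (cp_star Th x) (mulF (fun h => (r h)%:C%C) x).
  rewrite (mulF_star _ Fi) (mulF_mul _ _ (invariant_star Fi) xA).
  (* [mulF_mul] expects a multiplied factor on either side, so the constant 1 is inserted and
     removed again. *)
  have -> : cp_star Th x = mulF (fun=> 1) (cp_star Th x).
    by apply/funext => k; apply/funext => h; rewrite /mulF mul1r.
  rewrite (mulF_mul _ _ (invariant_cst 1) xA).
  have -> : mulF (fun=> 1) (cp_star Th x) = cp_star Th x.
    by apply/funext => k; apply/funext => h; rewrite /mulF mul1r.
  apply/funext => k; apply/funext => h.
  change (fun_mul (fun_star F) F h * cp_mul Th (cp_star Th x) x k h =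
    (c ^+ 2)%:C%C * (1 * (r h)%:C%C * cp_mul Th (cp_star Th x) x k h)).
  rewrite mulrA mul1r -rmorphM /fun_mul /fun_star mulJc; congr (_%:C%C * _).
  by rewrite /r; field; rewrite gt_eqF.
rewrite (cp_homZ phiH); last exact: cp_alg_mul.
rewrite (cp_homM phiH)// (cp_homJ phiH)// rnormZ cabs_real ger0_norm ?sqr_ge0//.
rewrite exprMn ler_wpM2l ?sqr_ge0// (le_trans (rnormM _ _))// rnormJ expr2.
by rewrite ler_wpM2l ?rnorm_ge0// mulF_real_le1.
Qed.

End Bound.

Section Extension.
Context {A : cstarAlgType R} (iota : (int -> X -> cplx R) -> A).
Hypothesis hA : is_crossed_product Th iota.
Let iH : is_cp_hom Th iota := proj1 hA.

(* Apply the universal property to the closure of the image. *)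
Lemma crossed_product_in_sub (S : sub_cstar A) :
  (forall x, cp_alg Th x -> subc_set S (iota x)) -> forall a, subc_set S a.
Proof.
move=> Si; have [_ univ] := hA.
pose phi x : sub_cstarAlg S :=
  if pselect (subc_set S (iota x)) is left h then SubElt (mem_set h) else 0.
have phiE x : cp_alg Th x -> subc_val (phi x) = iota x.
  by move=> /Si Sx; rewrite /phi; case: pselect.
have phiH : is_cp_hom Th phi.
  split.
  - move=> z x y xA yA; apply: val_inj => /=.
    rewrite -[LHS]/(subc_val _) phiE; last by apply: cp_algD => //; exact: cp_algZ.
    rewrite (cp_homD iH) ?(cp_homZ iH)//; last exact: cp_algZ.
    by rewrite -[RHS]/(z *: subc_val (phi x) + subc_val (phi y)) !phiE.
  - move=> x y xA yA; apply: val_inj => /=.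
    rewrite -[LHS]/(subc_val _) phiE; last exact: cp_alg_mul.
    by rewrite (cp_homM iH)// -[RHS]/(cmul (subc_val _) (subc_val _)) !phiE.
  - move=> x xA; apply: val_inj => /=.
    rewrite -[LHS]/(subc_val _) phiE; last exact: cp_alg_star.
    by rewrite (cp_homJ iH)// -[RHS]/(cstar (subc_val _)) !phiE.
have [Phi [[[Pl PM PJ] PE] _]] := univ _ _ phiH.
(* The inclusion composed with [Phi], and the identity, both extend [iota]; uniqueness identifies
   them, so every element lies in [S]. *)
have [Psi [_ uniq]] := univ _ _ iH.
have E1 : Psi = (@subc_val _ _ S) \o Phi.
  apply: uniq; split; last by move=> x xA /=; rewrite PE// phiE.
  split.
  - by move=> z a b _ _ /=; rewrite Pl.
  - by move=> a b _ _ /=; rewrite PM.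
  - by move=> a _ /=; rewrite PJ.
have E2 : Psi = id by apply: uniq; split.
by move=> a; rewrite -[a]/(id a) -E2 E1 /=; exact: subc_mem.
Qed.

(** The approximable elements themselves form a closed star-subalgebra containing the image of
    [iota], so [crossed_product_in_sub] applies to them. *)
Lemma crossed_product_dense a (e : R) : 0 < e ->
  exists2 x, cp_alg Th x & rnorm (a - iota x) < e.
Proof.
pose D := [set a | forall e : R, 0 < e -> exists2 x, cp_alg Th x & rnorm (a - iota x) < e].
have D0 : D 0.
  by move=> d d0; exists 0; [exact: cp_alg0|rewrite (cp_hom0 iH) subrr rnorm0].
have Dl (z : R[i]%C) b c : D b -> D c -> D (z *: b + c).
  move=> Db Dc d d0.
  have z0 : 0 < cabs z + 1 by rewrite ltr_wpDl ?cabs_ge0.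
  have [|x xA xb] := Db (d / 2 / (cabs z + 1)); first by rewrite !divr_gt0.
  have [|y yA yc] := Dc (d / 2); first by rewrite !divr_gt0.
  have zA : cp_alg Th (z *: x) by exact: cp_algZ.
  exists (z *: x + y); first exact: cp_algD.
  rewrite (cp_homD iH)// (cp_homZ iH)// opprD addrACA -scalerBr.
  rewrite (le_lt_trans (rnormD _ _))// rnormZ.
  move: xb; rewrite ltr_pdivlMr// mulrDr mulr1 mulrC.
  have := rnorm_ge0 (b - iota x); lra.
have DJ b : D b -> D (cstar b).
  move=> Db d /Db[x xA xb]; exists (cp_star Th x); first exact: cp_alg_star.
  by rewrite (cp_homJ iH)// -cstarB rnormJ.
have DM b c : D b -> D c -> D (cmul b c).
  move=> /approx_seq[u uA ub] /approx_seq[v vA vc] d d0.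
  have [N /(_ N (leqnn N)) hN] := rlim_mul ub vc d0.
  exists (cp_mul Th (u N) (v N)); first exact: cp_alg_mul.
  by rewrite (cp_homM iH)// rdistC.
have Dlim u b : (forall n : nat, D (u n)) -> rlim u b -> D b.
  move=> Du ub d d0; have d2 : 0 < d / 2 by rewrite divr_gt0.
  have [N /(_ N (leqnn N)) hN] := ub _ d2; have [x xA xu] := Du N _ d2.
  exists x => //; rewrite rdistC in hN; have := rdistD b (u N) (iota x); lra.
move: a e; apply: (@crossed_product_in_sub (SubCStar D0 Dl DM DJ Dlim)) => x xA d d0 /=.
by exists x => //; rewrite subrr rnorm0.
Qed.

Lemma crossed_product_seq a : exists2 u, (forall n : nat, cp_alg Th (u n)) & rlim (iota \o u) a.
Proof. exact/approx_seq/crossed_product_dense. Qed.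

End Extension.
End CentralFunctions.

(** * Invariant functions as central multipliers *)

Section CentralAction.
Context {R : realType} {X : topologicalType} (Th : partial_aut X).
Hypothesis hausX : hausdorff_space X.
Context {A : cstarAlgType R} (iota : (int -> X -> cplx R) -> A).
Hypothesis hA : is_crossed_product Th iota.
Implicit Types (F G : X -> cplx R) (x y : int -> X -> cplx R) (a b : A).

Let iH : is_cp_hom Th iota := proj1 hA.

(* b is the value at a of the continuous extension of iota x |-> iota (F x). *)
Definition is_mact F a b := forall c : R, 0 <= c -> (forall h, cabs (F h) <= c) ->
  forall x, cp_alg Th x -> rnorm (b - iota (mulF F x)) <= c * rnorm (a - iota x).

(** For invariant [F] the default [0] never occurs, by [mactP]. *)
Definition mact F a : A := if pselect (exists b, is_mact F a b) is left h then projT1 (cid h) else 0.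

Lemma mulFB F x y : mulF F (x - y) = mulF F x - mulF F y.
Proof.
apply/funext => k; apply/funext => h.
change (F h * (x k h - y k h) = F h * x k h - F h * y k h); exact: mulrBr.
Qed.

Lemma mulFD F x y : mulF F (x + y) = mulF F x + mulF F y.
Proof.
apply/funext => k; apply/funext => h.
change (F h * (x k h + y k h) = F h * x k h + F h * y k h); exact: mulrDr.
Qed.

Lemma mulFZ F (z : R[i]%C) x : mulF F (z *: x) = z *: mulF F x.
Proof.
apply/funext => k; apply/funext => h.
change (F h * (z * x k h) = z * (F h * x k h)); exact: mulrCA.
Qed.

Lemma cp_algN x : cp_alg Th x -> cp_alg Th (- x).
Proof. by move=> xA; rewrite -scaleN1r; exact: cp_algZ. Qed.

Lemma mulF_dist F x y (c : R) : invariant_fun Th F -> 0 <= c -> (forall h, cabs (F h) <= c) ->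
  cp_alg Th x -> cp_alg Th y ->
  rnorm (iota (mulF F x) - iota (mulF F y)) <= c * rnorm (iota x - iota y).
Proof.
move=> Fi c0 Fc xA yA; have nyA := cp_algN yA.
have [FxA FyA] := (cp_alg_mulF Fi xA, cp_alg_mulF Fi yA); have nFyA := cp_algN FyA.
rewrite -!(cp_homN iH)// -!(cp_homD iH)// -mulFB; apply: (mulF_le hausX iH) => //.
exact: cp_algD.
Qed.

Lemma mact_ex F a : invariant_fun Th F -> exists b, is_mact F a b.
Proof.
move=> Fi; have [_ [c' Fc'] _] := Fi; pose c := `|c'|.
have c0 : 0 <= c by exact: normr_ge0.
have Fc h : cabs (F h) <= c by rewrite (le_trans (Fc' h))// ler_norm.
have [u uA ua] := crossed_product_seq hausX hA a.
have [b ub] : exists b, rlim (fun n => iota (mulF F (u n))) b.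
  apply: cauchy_rlim => e e0.
  have c1 : 0 < c + 1 by rewrite ltr_wpDl.
  have [|N hN] := ua (e / 2 / (c + 1)); first by rewrite !divr_gt0.
  exists N => m n /hN + /hN; rewrite /= !ltr_pdivlMr// => h1 h2.
  rewrite (le_lt_trans (mulF_dist Fi c0 Fc _ _))//.
  have := rdistD (iota (u m)) a (iota (u n)); rewrite (rdistC a (iota _)).
  have := rnorm_ge0 (iota (u m) - a); have := rnorm_ge0 (iota (u n) - a).
  have := rnorm_ge0 (iota (u m) - iota (u n)).
  move: (rnorm _) (rnorm _) (rnorm _) h1 h2 => p q r; nra.
exists b => d d0 Fd x xA; apply/ler_addgt0Pl => e e0.
have d1 : 0 < d + 1 by rewrite ltr_wpDl.
have [|N hN] := ua (e / 2 / (d + 1)); first by rewrite !divr_gt0.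
have [|M hM] := ub (e / 2); first by rewrite divr_gt0.
pose n := maxn N M; have := hN n (leq_maxl _ _); have := hM n (leq_maxr _ _).
rewrite /= => h1 h2; rewrite ltr_pdivlMr// in h2.
have := rdistD b (iota (mulF F (u n))) (iota (mulF F x)); rewrite (rdistC b (iota (mulF F (u n)))).
have := mulF_dist Fi d0 Fd (uA n) xA.
have := rdistD (iota (u n)) a (iota x).
have := rnorm_ge0 (iota (u n) - a); have := rnorm_ge0 (a - iota x).
move: (rnorm (iota (u n) - a)) (rnorm (a - iota x)) (rnorm (iota (u n) - iota x)) h1 h2
  => p q r; nra.
Qed.

Lemma mactP F a : invariant_fun Th F -> is_mact F a (mact F a).
Proof.
move=> Fi; rewrite /mact; case: pselect => [h|]; first by case: cid.
by move=> /(_ (mact_ex a Fi)).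
Qed.

Lemma mact_iota F x : invariant_fun Th F -> cp_alg Th x -> mact F (iota x) = iota (mulF F x).
Proof.
move=> Fi xA; have [_ [c Fc] _] := Fi; apply/subr0_eq/rnorm_eq0/eqP.
rewrite eq_le rnorm_ge0 andbT.
have := mactP (iota x) Fi (c := `|c|) (normr_ge0 c); rewrite /is_mact => /(_ _ x xA).
by rewrite subrr rnorm0 mulr0; apply => h; rewrite (le_trans (Fc h))// ler_norm.
Qed.

Lemma mact_dist F a b (c : R) : invariant_fun Th F -> 0 <= c -> (forall h, cabs (F h) <= c) ->
  rnorm (mact F a - mact F b) <= c * rnorm (a - b).
Proof.
move=> Fi c0 Fc; apply/ler_addgt0Pl => e e0.
have c1 : 0 < c + 1 by rewrite ltr_wpDl.
have e4 : 0 < e / 4 / (c + 1) by rewrite !divr_gt0.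
have [x xA] := crossed_product_dense hausX hA a e4.
have [y yA] := crossed_product_dense hausX hA b e4.
rewrite !ltr_pdivlMr// => h1 h2.
have := mactP a Fi c0 Fc xA; have := mactP b Fi c0 Fc yA.
have := mulF_dist Fi c0 Fc xA yA.
have := rdistD (mact F a) (iota (mulF F x)) (mact F b).
have := rdistD (iota (mulF F x)) (iota (mulF F y)) (mact F b).
rewrite (rdistC (iota (mulF F y)) (mact F b)).
have := rdistD (iota x) a (iota y); have := rdistD a b (iota y); rewrite (rdistC (iota x) a).
have := rnorm_ge0 (a - iota x); have := rnorm_ge0 (b - iota y); have := rnorm_ge0 (a - b).
move: (rnorm (a - iota x)) (rnorm (b - iota y)) (rnorm (a - b)) (rnorm (iota x - iota y)) h1 h2
  => p q r s; nra.
Qed.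

(** Carries each algebraic identity below from the image of [iota], where it is a computation with
    coefficients, to all of [A]. *)
Lemma mact_rlim F u a : invariant_fun Th F -> rlim u a -> rlim (fun n => mact F (u n)) (mact F a).
Proof.
move=> Fi ua; have [_ [c Fc] _] := Fi => e e0.
apply: (rlim_lip (c := `|c|) (f := mact F)) ua _ e0 => a' b'; apply: mact_dist => // h.
by rewrite (le_trans (Fc h))// ler_norm.
Qed.

Lemma rlimZ (z : R[i]%C) (u : nat -> A) a : rlim u a -> rlim (fun n => z *: u n) (z *: a).
Proof.
move=> ua e e0; apply: (rlim_lip (c := cabs z) (f := fun a => z *: a)) ua _ e0 => b c.
by rewrite -scalerBr rnormZ.
Qed.

Lemma rlimJ (u : nat -> A) a : rlim u a -> rlim (fun n => cstar (u n)) (cstar a).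
Proof.
move=> ua e e0; apply: (rlim_lip (c := 1) (f := fun a => cstar a)) ua _ e0 => b c.
by rewrite -cstarB rnormJ mul1r.
Qed.

Lemma rlim_ext (u v : nat -> A) a : u =1 v -> rlim u a -> rlim v a.
Proof. by move=> uv ua e /ua[N hN]; exists N => n /hN; rewrite uv. Qed.

Lemma mact_lin F (z : R[i]%C) a b : invariant_fun Th F ->
  mact F (z *: a + b) = z *: mact F a + mact F b.
Proof.
move=> Fi; have [u uA ua] := crossed_product_seq hausX hA a.
have [v vA vb] := crossed_product_seq hausX hA b.
apply: (rlim_uniq (mact_rlim Fi (rlimD (rlimZ z ua) vb))).
apply: rlim_ext (rlimD (rlimZ z (mact_rlim Fi ua)) (mact_rlim Fi vb)) => n /=.
have zA := cp_algZ z (uA n); have sA := cp_algD zA (vA n).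
have FuA := cp_alg_mulF Fi (uA n); have FvA := cp_alg_mulF Fi (vA n).
rewrite !mact_iota// -!(cp_homZ iH)// -!(cp_homD iH)//; last exact: cp_algZ.
by rewrite mact_iota// mulFD mulFZ.
Qed.

Lemma mactMl F a b : invariant_fun Th F -> mact F (cmul a b) = cmul (mact F a) b.
Proof.
move=> Fi; have [u uA ua] := crossed_product_seq hausX hA a.
have [v vA vb] := crossed_product_seq hausX hA b.
apply: (rlim_uniq (mact_rlim Fi (rlim_mul ua vb))).
apply: rlim_ext (rlim_mul (mact_rlim Fi ua) vb) => n /=.
have FuA := cp_alg_mulF Fi (uA n); have uvA := cp_alg_mul (uA n) (vA n).
rewrite mact_iota// -!(cp_homM iH)// mact_iota//; congr iota.
have E w : w = mulF (fun=> 1) w :> (int -> X -> cplx R).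
  by apply/funext => k; apply/funext => h; rewrite /mulF mul1r.
rewrite [v n in LHS]E (mulF_mul _ _ Fi (vA n)); congr mulF.
by apply/funext => h; rewrite /fun_mul mulr1.
Qed.

Lemma mactMr F a b : invariant_fun Th F -> mact F (cmul a b) = cmul a (mact F b).
Proof.
move=> Fi; have [u uA ua] := crossed_product_seq hausX hA a.
have [v vA vb] := crossed_product_seq hausX hA b.
apply: (rlim_uniq (mact_rlim Fi (rlim_mul ua vb))).
apply: rlim_ext (rlim_mul ua (mact_rlim Fi vb)) => n /=.
have FvA := cp_alg_mulF Fi (vA n); have uvA := cp_alg_mul (uA n) (vA n).
rewrite mact_iota// -!(cp_homM iH)// mact_iota//; congr iota.
have E w : w = mulF (fun=> 1) w :> (int -> X -> cplx R).
  by apply/funext => k; apply/funext => h; rewrite /mulF mul1r.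
rewrite [u n in LHS]E (mulF_mul _ _ (invariant_cst Th 1) (vA n)); congr mulF.
by apply/funext => h; rewrite /fun_mul mul1r.
Qed.

Lemma mact_comp F G a : invariant_fun Th F -> invariant_fun Th G ->
  mact (fun_mul F G) a = mact F (mact G a).
Proof.
move=> Fi Gi; have FGi := invariantM Fi Gi.
have [u uA ua] := crossed_product_seq hausX hA a.
apply: (rlim_uniq (mact_rlim FGi ua)).
apply: rlim_ext (mact_rlim Fi (mact_rlim Gi ua)) => n /=.
have GuA := cp_alg_mulF Gi (uA n).
rewrite !mact_iota//; congr iota; apply/funext => k; apply/funext => h.
by rewrite /mulF /fun_mul mulrA.
Qed.

Lemma mact_linF (z : R[i]%C) F G a : invariant_fun Th F -> invariant_fun Th G ->
  mact (z *: F + G) a = z *: mact F a + mact G a.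
Proof.
move=> Fi Gi; have zFi := invariantZ z Fi; have FGi := invariantD zFi Gi.
have [u uA ua] := crossed_product_seq hausX hA a.
apply: (rlim_uniq (mact_rlim FGi ua)).
apply: rlim_ext (rlimD (rlimZ z (mact_rlim Fi ua)) (mact_rlim Gi ua)) => n /=.
have [FuA GuA] := (cp_alg_mulF Fi (uA n), cp_alg_mulF Gi (uA n)).
rewrite !mact_iota// -(cp_homZ iH)// -(cp_homD iH)//; last exact: cp_algZ.
congr iota; apply/funext => k; apply/funext => h.
change (z * (F h * u n k h) + G h * u n k h = (z * F h + G h) * u n k h).
by rewrite mulrDl mulrA.
Qed.

Lemma mact_star F a : invariant_fun Th F ->
  cstar (mact F (cstar a)) = mact (fun_star F) a.
Proof.
move=> Fi; have Ji := invariant_star Fi.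
have [u uA ua] := crossed_product_seq hausX hA a.
apply: esym; apply: (rlim_uniq (mact_rlim Ji ua)).
apply: rlim_ext (rlimJ (mact_rlim Fi (rlimJ ua))) => n /=.
have SA := cp_alg_star hausX (uA n); have FA := cp_alg_mulF Fi SA.
rewrite -(cp_homJ iH)// !mact_iota// -(cp_homJ iH)// (mulF_star _ Fi); congr (iota (mulF _ _)).
apply/funext => m; apply/funext => h; rewrite /cp_star /pa_pull.
case E : (pa_pow Th m h) => [h1|]; last by rewrite (cp_alg_dom m (uA n)).2.
by rewrite /fun_star (pa_pow_opp E) opprK conjCK.
Qed.

Lemma mact0 F : invariant_fun Th F -> mact F 0 = 0.
Proof. by move=> Fi; have := mact_lin 1 0 0 Fi; rewrite !scale1r addr0 -{1}[mact F 0]addr0 => /addrI. Qed.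

Lemma mact_le F a (c : R) : invariant_fun Th F -> 0 <= c -> (forall h, cabs (F h) <= c) ->
  rnorm (mact F a) <= c * rnorm a.
Proof. by move=> Fi c0 Fc; have := mact_dist a 0 Fi c0 Fc; rewrite mact0// !subr0. Qed.

Lemma mact1 a : mact (fun=> 1) a = a.
Proof.
have [u uA ua] := crossed_product_seq hausX hA a.
apply: (rlim_uniq (mact_rlim (invariant_cst Th 1) ua)).
apply: rlim_ext ua => n /=; rewrite mact_iota//; last exact: invariant_cst.
by congr iota; apply/funext => k; apply/funext => h; rewrite /mulF mul1r.
Qed.

Lemma rlim_cts (f : A -> A) (c : R) : (forall a b, rnorm (f a - f b) <= c * rnorm (a - b)) ->
  continuous f.
Proof.
move=> fc a U /nbhs_rnormP[e e0 eU]; apply/nbhs_rnormP.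
have c1 : 0 < `|c| + 1 by rewrite ltr_wpDl.
exists (e / (`|c| + 1)); first by rewrite divr_gt0.
move=> b; rewrite ltr_pdivlMr// => h; apply: eU; apply: le_lt_trans (fc a b) _.
apply: le_lt_trans h; rewrite mulrC ler_wpM2l ?rnorm_ge0//.
by rewrite (le_trans (ler_norm _))// lerDl.
Qed.

Lemma mact_multiplier F : invariant_fun Th F -> is_multiplier (mact F, mact F).
Proof.
move=> Fi; have [_ [c Fc] _] := Fi.
have cts : continuous (mact F).
  apply: (@rlim_cts _ `|c|) => a b; apply: mact_dist => // h.
  by rewrite (le_trans (Fc h))// ler_norm.
split => /=.
- by split=> // z a b; exact: mact_lin.
- by split=> // z a b; exact: mact_lin.
- by move=> a b; exact: mactMl.
- by move=> a b; exact: mactMr.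
- by move=> a b; rewrite -mactMl// mactMr.
Qed.

(** Multiply by the adjoint of [a - b] and use the C*-identity. *)
Lemma cmul_injr a b : (forall c, cmul a c = cmul b c) -> a = b.
Proof.
move=> ab; apply/subr0_eq/rnorm_eq0/eqP; rewrite -sqrf_eq0 -rnormJ -rnorm_cstar cstarK.
by rewrite cmulBl ab subrr rnorm0.
Qed.

Lemma cmul_injl a b : (forall c, cmul c a = cmul c b) -> a = b.
Proof.
move=> ab; apply/subr0_eq/rnorm_eq0/eqP; rewrite -sqrf_eq0 -rnorm_cstar.
by rewrite cmulBr ab subrr rnorm0.
Qed.

(** Both sides are tested against an arbitrary factor [c]; in a product, either multiplier can be
    moved to the factor where the other does not act. *)
Lemma mact_center F : invariant_fun Th F -> multiplier_center (mact F, mact F).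
Proof.
move=> Fi; split; first exact: mact_multiplier.
move=> [S1 S2] [_ _ /= SM1 SM2 SM]; rewrite /multiplier_mul /=; congr pair.
- apply/funext => a /=; apply: cmul_injr => c.
  by rewrite -SM1 -mactMl// mactMr// SM1 -mactMr// mactMl.
- apply/funext => a /=; apply: cmul_injl => c.
  by rewrite -[RHS]SM2 -[in RHS]mactMr// [in RHS]mactMl// SM2 -mactMl// mactMr.
Qed.

End CentralAction.

(** * Matrices with the operator norm *)

Lemma real_cauchy (R : realType) (u : nat -> R) :
  (forall e : R, 0 < e -> exists N, forall m n, (N <= m)%N -> (N <= n)%N -> `|u m - u n| < e) ->
  exists l, forall e : R, 0 < e -> exists N, forall n, (N <= n)%N -> `|u n - l| < e.
Proof.
move=> cu; have : cauchy (u @ \oo).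
  apply/cauchy_ballP => e /cu[N hN].
  exists (u @` [set n | (N <= n)%N], u @` [set n | (N <= n)%N]).
    by split; exists N => // n /= Nn; exists n.
  by move=> [_ _] [[m /= Nm <-] [n /= Nn <-]]/=; exact: hN.
move/cauchy_cvg/cvg_ex => [l /cvgrPdist_lt ul]; exists l => e /ul[N _ hN].
by exists N => n Nn; rewrite distrC; exact: hN.
Qed.

Lemma complex_cauchy (R : realType) (u : nat -> R[i]%C) :
  (forall e : R, 0 < e -> exists N, forall m n, (N <= m)%N -> (N <= n)%N -> cabs (u m - u n) < e) ->
  exists l, forall e : R, 0 < e -> exists N, forall n, (N <= n)%N -> cabs (u n - l) < e.
Proof.
move=> cu.
have ReB (z w : R[i]%C) : complex.Re (z - w) = complex.Re z - complex.Re w by case: z w => a b [].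
have ImB (z w : R[i]%C) : complex.Im (z - w) = complex.Im z - complex.Im w by case: z w => a b [].
have [|p pP] := @real_cauchy _ (fun n => complex.Re (u n)).
  move=> e /cu[N hN]; exists N => m n Nm Nn; rewrite -ReB.
  exact: le_lt_trans (cabs_Re _) (hN _ _ Nm Nn).
have [|q qP] := @real_cauchy _ (fun n => complex.Im (u n)).
  move=> e /cu[N hN]; exists N => m n Nm Nn; rewrite -ImB.
  exact: le_lt_trans (cabs_Im _) (hN _ _ Nm Nn).
exists (Complex p q) => e e0; have e2 : 0 < e / 2 by rewrite divr_gt0.
have [N hN] := pP _ e2; have [M hM] := qP _ e2; exists (maxn N M) => n.
rewrite geq_max => /andP[/hN h1 /hM h2]; apply: le_lt_trans (cabs_le_ReIm _) _.
by rewrite ReB ImB /=; lra.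
Qed.

Section OperatorNorm.
Context {R : realType} {n : nat}.
Local Notation C := (R[i]%C).
Implicit Types (A B : 'M[C]_n) (u v w : 'cV[C]_n) (c : R).

Definition sqn v : R := \sum_i cabs (v i 0) ^+ 2.

Definition herm u v : C := \sum_i (u i 0)^* * v i 0.

Definition adjmx A : 'M[C]_n := \matrix_(i, j) (A j i)^*.

Lemma sqn_ge0 v : 0 <= sqn v.
Proof. by apply: sumr_ge0 => i _; exact: sqr_ge0. Qed.

Lemma sqn_le0 v : sqn v <= 0 -> v = 0.
Proof.
move=> v0; apply/colP => i; rewrite mxE; apply: cabs_eq0; apply/eqP.
rewrite -sqrf_eq0 eq_le sqr_ge0 andbT (le_trans _ v0)//.
by rewrite /sqn (bigD1 i)//= lerDl sumr_ge0// => j _; exact: sqr_ge0.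
Qed.

Lemma sqnE v : (sqn v)%:C%C = herm v v.
Proof. by rewrite rmorph_sum; apply: eq_bigr => i _; rewrite /= mulJc. Qed.

Lemma herm_adj A u v : herm u (A *m v) = herm (adjmx A *m u) v.
Proof.
rewrite /herm; under eq_bigr do rewrite mxE mulr_sumr.
under [RHS]eq_bigr do rewrite mxE rmorph_sum mulr_suml.
rewrite exchange_big /=; apply: eq_bigr => j _; apply: eq_bigr => i _.
by rewrite mxE rmorphM/= conjCK; ring.
Qed.

Lemma adjmxK A : adjmx (adjmx A) = A.
Proof. by apply/matrixP => i j; rewrite !mxE conjCK. Qed.

Lemma adjmxM A B : adjmx (A *m B) = adjmx B *m adjmx A.
Proof.
apply/matrixP => i j; rewrite !mxE rmorph_sum; apply: eq_bigr => k _.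
by rewrite !mxE rmorphM mulrC.
Qed.

(** Cauchy-Schwarz in weighted form; the proofs below choose [s] where the usual argument divides by
    a norm. *)
Lemma herm_le u v (s : R) : 0 < s -> 2 * cabs (herm u v) <= s * sqn u + s^-1 * sqn v.
Proof.
move=> s0; rewrite (le_trans (ler_wpM2l (ler0n _ 2) (cabs_sum _ _ _)))//.
rewrite !mulr_sumr -big_split/=; apply: ler_sum => i _; rewrite cabsM cabsJ.
have := sqr_ge0 (s * cabs (u i 0) - cabs (v i 0)) .
move: (cabs _) (cabs _) => a b h.
rewrite -(ler_pM2l s0) [leRHS]mulrDr !mulrA divff ?gt_eqF// mul1r; nra.
Qed.

Definition opbound A : set R := [set c | 0 <= c /\ forall v, sqn (A *m v) <= c ^+ 2 * sqn v].

Definition opnorm A : R := inf (opbound A).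

Definition mxabs A : R := \sum_i \sum_j cabs (A i j).

(** This crude bound makes [opbound A] non-empty. Together with [cabs_entry_le] it shows that
    operator norm and entries define the same convergence, whence completeness. *)
Lemma opbound_mxabs A : opbound A (mxabs A).
Proof.
split=> [|v]; first by do 2!apply: sumr_ge0 => ? _; exact: cabs_ge0.
pose r := Num.sqrt (sqn v); have r0 : 0 <= r := sqrtr_ge0 _.
have rE : r ^+ 2 = sqn v by rewrite sqr_sqrtr// sqn_ge0.
have vr j : cabs (v j 0) <= r.
  rewrite -(@ler_pXn2r _ 2) ?nnegrE ?cabs_ge0// rE /sqn (bigD1 j)//= lerDl.
  by apply: sumr_ge0 => i _; exact: sqr_ge0.
pose x i := (\sum_j cabs (A i j)) * r.
have Ai i : cabs ((A *m v) i 0) <= x i.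
  rewrite mxE (le_trans (cabs_sum _ _ _))// /x mulr_suml; apply: ler_sum => j _.
  by rewrite cabsM ler_wpM2l ?cabs_ge0.
rewrite -rE -exprMn /sqn /mxabs mulr_suml.
have x0 i : 0 <= x i.
  by rewrite mulr_ge0// sumr_ge0// => j _; exact: cabs_ge0.
have sum_sq (s : seq 'I_n) : \sum_(i <- s) x i ^+ 2 <= (\sum_(i <- s) x i) ^+ 2.
  elim: s => [|i s ih]; first by rewrite !big_nil expr0n.
  rewrite !big_cons sqrrD (le_trans (lerD (lexx _) ih))// lerD2r lerDl.
  by rewrite mulrn_wge0// mulr_ge0// sumr_ge0.
apply: le_trans (sum_sq _); apply: ler_sum => i _.
by rewrite ler_pXn2r ?nnegrE ?cabs_ge0.
Qed.

Lemma opbound_has_inf A : has_inf (opbound A).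
Proof.
split; first by exists (mxabs A); exact: opbound_mxabs.
by exists 0 => c [].
Qed.

Lemma opnorm_le A c : opbound A c -> opnorm A <= c.
Proof. by move=> ?; apply: ge_inf => //; case: (opbound_has_inf A). Qed.

Lemma opnorm_ge0 A : 0 <= opnorm A.
Proof. by apply: lb_le_inf; [case: (opbound_has_inf A)|move=> c []]. Qed.

Lemma opnormP A v : sqn (A *m v) <= opnorm A ^+ 2 * sqn v.
Proof.
have N0 := opnorm_ge0 A; apply/ler_addgt0Pl => e e0.
have v0 := sqn_ge0 v; pose t := opnorm A.
(* As [d <= 1], one has [(t + d)^2 - t^2 <= d (2 t + 1)]; the factor [sqn v + 1] absorbs [sqn v] and
   is never zero. *)
pose d := Num.min 1 (e / ((2 * t + 1) * (sqn v + 1))).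
have D0 : 0 < (2 * t + 1) * (sqn v + 1).
  by rewrite mulr_gt0// ltr_wpDl// mulr_ge0.
have d0 : 0 < d by rewrite lt_min ltr01 divr_gt0.
have [c [c0 cP] ct] : exists2 c, opbound A c & c < t + d.
  by apply: inf_adherent => //; exact: opbound_has_inf.
have d1 : d <= 1 by rewrite ge_min lexx.
have de : d * ((2 * t + 1) * (sqn v + 1)) <= e by rewrite -ler_pdivlMr// ge_min lexx orbT.
apply: le_trans (cP v) _.
have : c ^+ 2 <= (t + d) ^+ 2 by rewrite ler_pXn2r ?nnegrE ?addr_ge0 ?(ltW d0) ?(ltW ct).
move/(ler_wpM2r v0) => /le_trans; apply; rewrite -/t.
move: (sqn v) v0 de => s s0 de.
have t0 : 0 <= t by [].
have h1 : 0 <= d * d * s by rewrite !mulr_ge0 ?(ltW d0).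
have h2 : d * d * s <= d * s by rewrite ler_wpM2r// ler_piMr// (ltW d0).
have h3 : 0 <= t * d by rewrite mulr_ge0 ?(ltW d0).
nra.
Qed.

Lemma opnormD A B : opnorm (A + B) <= opnorm A + opnorm B.
Proof.
apply: opnorm_le; split=> [|v]; first by rewrite addr_ge0 ?opnorm_ge0.
have /= := opnormP A v; have := opnormP B v; rewrite mulmxDl.
have := opnorm_ge0 A; have := opnorm_ge0 B.
move: (A *m v) (B *m v) (opnorm A) (opnorm B) => x y a b b0 a0 yb xa.
have key s : 0 < s -> sqn (x + y) <= (1 + s) * sqn x + (1 + s^-1) * sqn y.
  move=> s0; rewrite /sqn !mulr_sumr -big_split/=; apply: ler_sum => i _.
  rewrite mxE; have := cabsD (x i 0) (y i 0).
  have := cabs_ge0 (x i 0 + y i 0).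
  move: (cabs (x i 0)) (cabs (y i 0)) (cabs (_ + _)) => p q r r0 rpq.
  have := sqr_ge0 (s * p - q).
  have : r ^+ 2 <= (p + q) ^+ 2 by rewrite ler_pXn2r ?nnegrE// (le_trans r0).
  move=> /le_trans + h; apply.
  rewrite -(ler_pM2l s0) [leRHS]mulrDr 2!mulrDl 2!mulrDr !mulrA divff ?gt_eqF// !mul1r.
  nra.
have v0 := sqn_ge0 v.
have {a0} := a0; rewrite [0 <= a]le_eqVlt => /predU1P[a0|a0].
  have x0 : sqn x <= 0 by move: xa; rewrite -a0 expr0n mul0r.
  by rewrite (sqn_le0 x0) -a0 !add0r.
have {b0} := b0; rewrite [0 <= b]le_eqVlt => /predU1P[b0|b0].
  have y0 : sqn y <= 0 by move: yb; rewrite -b0 expr0n mul0r.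
  by rewrite (sqn_le0 y0) -b0 !addr0.
(* The optimal weight: [(1 + b/a) a^2 + (1 + a/b) b^2 = (a + b)^2]. *)
have s0 : 0 < b / a by rewrite divr_gt0.
apply: le_trans (key _ s0) _.
have := ler_wpM2l (_ : 0 <= 1 + b / a) xa; have := ler_wpM2l (_ : 0 <= 1 + (b / a)^-1) yb.
move=> /(_ (addr_ge0 ler01 _)) h1 /(_ (addr_ge0 ler01 _)) h2.
apply: le_trans (lerD (h2 _) (h1 _)) _; rewrite ?invr_ge0 ?(ltW s0)//.
rewrite le_eqVlt; apply/orP; left; apply/eqP; field.
by rewrite !gt_eqF.
Qed.

Lemma opnormZ (z : C) A : opnorm (z *: A) = cabs z * opnorm A.
Proof.
have le (w : C) B : opnorm (w *: B) <= cabs w * opnorm B.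
  apply: opnorm_le; split=> [|v]; first by rewrite mulr_ge0 ?cabs_ge0 ?opnorm_ge0.
  rewrite -scalemxAl; have -> : sqn (w *: (B *m v)) = cabs w ^+ 2 * sqn (B *m v).
    by rewrite /sqn mulr_sumr; apply: eq_bigr => i _; rewrite mxE cabsM exprMn.
  by rewrite exprMn -(mulrA (_ ^+ 2)) ler_wpM2l ?sqr_ge0// opnormP.
apply/eqP; rewrite eq_le le /=; have [->|z0] := eqVneq z 0.
  by rewrite cabs0 mul0r opnorm_ge0.
rewrite -{1}[A]scale1r -(mulVf z0) -scalerA mulrC -ler_pdivlMr ?cabs_gt0// mulrC -cabsV.
exact: le.
Qed.

Lemma cabs_entry_le A i j : cabs (A i j) <= opnorm A.
Proof.
rewrite -(@ler_pXn2r _ 2) ?nnegrE ?cabs_ge0 ?opnorm_ge0//.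
have := opnormP A (delta_mx j 0).
have -> : sqn (delta_mx j 0) = 1.
  rewrite /sqn (bigD1 j)//= mxE !eqxx cabs1 expr1n big1 ?addr0// => k /negPf kj.
  by rewrite mxE kj cabs0 expr0n.
rewrite mulr1; apply: le_trans; rewrite /sqn (bigD1 i)//= -colE mxE lerDl.
by apply: sumr_ge0 => k _; exact: sqr_ge0.
Qed.

Lemma opnorm_mxabs A : opnorm A <= mxabs A.
Proof. exact/opnorm_le/opbound_mxabs. Qed.

Lemma opnorm0_eq0 A : opnorm A = 0 -> A = 0.
Proof.
move=> A0; apply/matrixP => i j; rewrite mxE; apply: cabs_eq0; apply/eqP.
by rewrite eq_le cabs_ge0 andbT -A0 cabs_entry_le.
Qed.

Lemma opnormM A B : opnorm (A *m B) <= opnorm A * opnorm B.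
Proof.
apply: opnorm_le; split=> [|v]; first by rewrite mulr_ge0 ?opnorm_ge0.
rewrite -mulmxA (le_trans (opnormP _ _))// exprMn -(mulrA (_ ^+ 2)) ler_wpM2l ?sqr_ge0//.
exact: opnormP.
Qed.

(** [|A^* v|^2 = <v, A A^* v>], and [herm_le] with weight [|A|^2] leaves on the right [|A|^2 |v|^2]
    plus a term at most [|A^* v|^2], which is absorbed. *)
Lemma opnormJ_le A : opnorm (adjmx A) <= opnorm A.
Proof.
apply: opnorm_le; split=> [|v]; first exact: opnorm_ge0.
have v0 := sqn_ge0 v; have x0 := sqn_ge0 (adjmx A *m v).
have := opnormP A (adjmx A *m v); have y0 := sqn_ge0 (A *m (adjmx A *m v)).
have E : sqn (adjmx A *m v) = cabs (herm v (A *m (adjmx A *m v))).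
  by rewrite herm_adj -sqnE cabs_real ger0_norm ?sqn_ge0.
have := opnorm_ge0 A; rewrite [0 <= opnorm A]le_eqVlt => /predU1P[a0|a0].
  rewrite -a0 expr0n !mul0r => Y0; rewrite E.
  by rewrite (sqn_le0 Y0) /herm big1 ?cabs0// => i _; rewrite mxE mulr0.
have a2 : 0 < opnorm A ^+ 2 by rewrite exprn_gt0.
have := herm_le v (A *m (adjmx A *m v)) a2; rewrite -E => h1 h2.
have : (opnorm A ^+ 2)^-1 * sqn (A *m (adjmx A *m v)) <= sqn (adjmx A *m v).
  by rewrite mulrC ler_pdivrMr// mulrC.
lra.
Qed.

(** For the lower estimate, [|A v|^2 = <v, A^* A v>] is bounded by [herm_le] with weight
    [c = |A^* A|]. *)
Lemma opnorm_cstar A : opnorm (adjmx A *m A) = opnorm A ^+ 2.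
Proof.
apply/eqP; rewrite eq_le; apply/andP; split.
  rewrite (le_trans (opnormM _ _))// expr2 ler_wpM2r ?opnorm_ge0//; exact: opnormJ_le.
set c := opnorm (adjmx A *m A).
have c0 : 0 <= c := opnorm_ge0 _.
suff : opnorm A <= Num.sqrt c.
  by rewrite -(@ler_pXn2r _ 2) ?nnegrE ?opnorm_ge0 ?sqrtr_ge0// sqr_sqrtr.
apply: opnorm_le; split=> [|v]; first exact: sqrtr_ge0.
rewrite sqr_sqrtr//; have v0 := sqn_ge0 v.
have := opnormP (adjmx A *m A) v; rewrite -/c -mulmxA.
have E : sqn (A *m v) = cabs (herm v (adjmx A *m (A *m v))).
  by rewrite herm_adj adjmxK -sqnE cabs_real ger0_norm ?sqn_ge0.
move: (c0); rewrite [0 <= c]le_eqVlt => /predU1P[a0|a0].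
  rewrite -a0 expr0n !mul0r => Y0; rewrite E.
  by rewrite (sqn_le0 Y0) /herm big1 ?cabs0// => i _; rewrite mxE mulr0.
have := herm_le v (adjmx A *m (A *m v)) a0; rewrite -E => h1 h2.
have : c^-1 * sqn (adjmx A *m (A *m v)) <= c * sqn v.
  by rewrite mulrC ler_pdivrMr// mulrAC -expr2.
lra.
Qed.

End OperatorNorm.

Section MatrixAlgebra.
Context (R : realType) (n : nat).
Local Notation C := (R[i]%C).

(** The alias carries the operator norm, which satisfies the C*-identity, in place of an entrywise
    norm. *)
Definition opmx := 'M[C]_n.

HB.instance Definition _ := GRing.Lmodule.copy opmx 'M[C]_n.

Definition opmx_norm (A : opmx) : C := (opnorm A)%:C%C.

Lemma opmx_normD (A B : opmx) : opmx_norm (A + B) <= opmx_norm A + opmx_norm B.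
Proof. by rewrite -rmorphD lecR; exact: opnormD. Qed.

Lemma opmx_normZ (z : C) (A : opmx) : opmx_norm (z *: A) = `|z| * opmx_norm A.
Proof. by rewrite normcabs -rmorphM /opmx_norm -opnormZ. Qed.

Lemma opmx_norm0 (A : opmx) : opmx_norm A = 0 -> A = 0.
Proof. by move/complexI/opnorm0_eq0. Qed.

HB.instance Definition _ := Lmodule_isNormed.Build C opmx opmx_normD opmx_normZ opmx_norm0.

Lemma opmx_normE (A : opmx) : `|A| = (opnorm A)%:C%C. Proof. by []. Qed.

Lemma opmx_complete (F : set_system opmx) : ProperFilter F -> cauchy F -> cvg F.
Proof.
apply: seq_complete => u cu.
have cu' e : 0 < e -> exists N, forall m p, (N <= m)%N -> (N <= p)%N ->
    opnorm ((u m : 'M[C]_n) - u p) < e.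
  by move=> /cu[N hN]; exists N => m p Nm Np; rewrite -ltcR; exact: hN.
have lim i j : exists l : C, forall e : R, 0 < e ->
    exists N, forall m, (N <= m)%N -> cabs (u m i j - l) < e.
  apply: complex_cauchy => e /cu'[N hN]; exists N => m p Nm Np.
  apply: le_lt_trans (hN m p Nm Np); have := cabs_entry_le ((u m : 'M[C]_n) - u p) i j.
  by rewrite !mxE.
have /choice[l lP] : forall ij : 'I_n * 'I_n, exists l : C, forall e : R, 0 < e ->
    exists N, forall m, (N <= m)%N -> cabs (u m ij.1 ij.2 - l) < e.
  by move=> ij; exact: lim.
exists (\matrix_(i, j) l (i, j)) => e e0.
have D0 : 0 < #|{: 'I_n * 'I_n}|%:R + 1 :> R by rewrite ltr_wpDl.
have e' : 0 < e / (#|{: 'I_n * 'I_n}|%:R + 1) by rewrite divr_gt0.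
have /choice[N NP] : forall ij : 'I_n * 'I_n, exists N, forall m, (N <= m)%N ->
    cabs (u m ij.1 ij.2 - l ij) < e / (#|{: 'I_n * 'I_n}|%:R + 1).
  by move=> ij; exact: lP.
exists (\max_ij N ij)%N => m Nm; rewrite opmx_normE ltcR.
apply: le_lt_trans (opnorm_mxabs _) _; rewrite /mxabs pair_big/=.
apply: (@le_lt_trans _ _ (\sum_(ij : 'I_n * 'I_n) (e / (#|{: 'I_n * 'I_n}|%:R + 1)))).
  apply: ler_sum => -[i j] _; rewrite !mxE ltW//; apply: (NP (i, j)).
  by apply: leq_trans Nm; exact: leq_bigmax.
rewrite sumr_const -[X in X < _]mulr_natl mulrA ltr_pdivrMr// mulrC ltr_pM2l//.
by rewrite cardE ltrDl.
Qed.

HB.instance Definition _ := Uniform_isComplete.Build opmx opmx_complete.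

Lemma opmx_linl (c : C) (x y z : opmx) :
  ((c *: x + y : opmx) : 'M[C]_n) *m z = c *: ((x : 'M[C]_n) *m z) + (y : 'M[C]_n) *m z.
Proof. by rewrite mulmxDl scalemxAl. Qed.

Lemma opmx_linr (c : C) (x y z : opmx) :
  (x : 'M[C]_n) *m (c *: y + z : opmx) = c *: ((x : 'M[C]_n) *m y) + (x : 'M[C]_n) *m z.
Proof. by rewrite mulmxDr scalemxAr. Qed.

Lemma opmx_semilin (c : C) (x y : opmx) :
  adjmx (c *: x + y : opmx) = (c^* *: adjmx x + adjmx y)%R.
Proof. by apply/matrixP => i j; rewrite !mxE rmorphD rmorphM. Qed.

Lemma opmx_normM (x y : opmx) : `|((x : 'M[C]_n) *m y : opmx)| <= `|x| * `|y|.
Proof. by rewrite !opmx_normE -rmorphM lecR; exact: opnormM. Qed.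

Lemma opmx_norm_cstar (x : opmx) : `|(adjmx x *m x : opmx)| = `|x| ^+ 2.
Proof. by rewrite !opmx_normE -rmorphXn; congr (_%:C%C); exact: opnorm_cstar. Qed.

HB.instance Definition _ := @isCStarAlg.Build R opmx (fun x y => (x : 'M[C]_n) *m y)
  (fun x => adjmx x) (@mulmxA C n n n n) opmx_linl opmx_linr opmx_semilin
  (@adjmxM R n) (@adjmxK R n) opmx_normM opmx_norm_cstar.

Definition opmx_cstarAlg : cstarAlgType R := opmx.

End MatrixAlgebra.

(** * Lower bounds from finite-dimensional representations *)

Lemma ppow_ind (T : Type) (f g : T -> option T) (D : int -> T -> Prop) (x : T) :
  D 0 x -> (forall k y z, D k y -> f y = Some z -> D (k + 1) z) ->
  (forall k y z, D k y -> g y = Some z -> D (k - 1) z) ->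
  forall k y, ppow f g k x = Some y -> D k y.
Proof.
move=> D0 Df Dg [] n.
  elim: n => [|n ih] y; first by move=> /= [<-].
  rewrite /= ; case E : (iter n _ _) => [w|//] /= /(Df n%:Z); rewrite (_ : n%:Z + 1 = n.+1%:Z); last by lia.
  by apply; exact: ih.
elim: n => [|n ih] y; first by rewrite /= => /(Dg 0); apply.
move=> /=; case E : (obind g (iter n _ _)) => [w|//] /= /(Dg (Negz n)).
rewrite (_ : Negz n - 1 = Negz n.+1); last by lia.
by apply; exact: ih.
Qed.

Section MatrixRep.
Context {R : realType} {X : topologicalType} (Th : partial_aut X).
Context (n : nat) (p : 'I_n -> X) (sf sb : 'I_n -> option 'I_n).
Hypothesis sK : forall i j, sf i = Some j <-> sb j = Some i.
Hypothesis pf : forall i, pa_fwd Th (p i) = omap p (sf i).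
Hypothesis pb : forall i, pa_bwd Th (p i) = omap p (sb i).
Implicit Types (x y : int -> X -> cplx R).
Local Notation sp := (ppow sf sb).

Lemma pa_pow_p k i : pa_pow Th k (p i) = omap p (sp k i).
Proof.
have aux (f : X -> option X) s : (forall i, f (p i) = omap p (s i)) ->
    forall m, iter m (obind f) (Some (p i)) = omap p (iter m (obind s) (Some i)).
  by move=> fs; elim=> //= l ->; case: (iter l _ _) => //=.
case: k => m; first exact: aux pf m.
exact: aux pb m.+1.
Qed.

(* p maps the partial permutation sf of 'I_n equivariantly to the partial action on X;
   mxrep is the induced representation on the functions on 'I_n. *)
Definition mxrep x : opmx R n :=
  \matrix_(i, j) \sum_(k \in [set: int]) if sp k j == Some i then x k (p j) : R[i]%C else 0.

Lemma mxrepE x K i j : (forall k, (K < `|k|)%N -> x k = 0) -> (mxrep x : 'M[R[i]%C]_n) i j =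
  \sum_(k <- intw K) if sp k j == Some i then x k (p j) : R[i]%C else 0.
Proof. by move=> xK; rewrite mxE (zsum_intw (K := K))// => k /xK ->; case: eqP. Qed.

Lemma mxrep_lin (z : R[i]%C) x y : cp_alg Th x -> cp_alg Th y ->
  mxrep (z *: x + y) = z *: mxrep x + mxrep y.
Proof.
move=> /cp_supp[K xK] /cp_supp[L yL]; apply/matrixP => i j.
have xKL k : (maxn K L < `|k|)%N -> x k = 0 by rewrite gtn_max => /andP[/xK].
have yKL k : (maxn K L < `|k|)%N -> y k = 0 by rewrite gtn_max => /andP[_ /yL].
rewrite (mxrepE (K := maxn K L)); last first.
  move=> k kKL; rewrite -[LHS]/(z *: x k + y k) xKL// yKL//.
  by rewrite scaler0 addr0.
transitivity (z * (mxrep x : 'M[R[i]%C]_n) i j + (mxrep y : 'M[R[i]%C]_n) i j); last first.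
  by rewrite [in RHS]mxE [in RHS]mxE.
rewrite !(mxrepE (K := maxn K L))//.
rewrite mulr_sumr -big_split; apply: eq_bigr => k _ /=.
by case: eqP => //; rewrite mulr0 addr0.
Qed.

Lemma mxrep_mul x y : cp_alg Th x -> cp_alg Th y ->
  mxrep (cp_mul Th x y) = cmul (mxrep x : opmx R n) (mxrep y).
Proof.
move=> /cp_supp[K xK] /cp_supp[L yL]; apply/matrixP => i j.
(* [T l m] is the contribution of degrees [m - l] and [l] to the entry [(i, j)] in degree [m],
   following [j] through the point [theta^l j]. *)
pose T l m : R[i]%C := if sp m j == Some i then
  (if sp l j is Some j' then x (m - l) (p j') * y l (p j) else 0) else 0.
transitivity (\sum_(l <- intw L) \sum_(m \in [set: int]) T l m).
  transitivity (\sum_(m <- intw (K + L)) \sum_(l <- intw L) T l m).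
    rewrite (mxrepE (K := K + L)); last first.
      move=> k kKL; apply/funext => h; rewrite cp_mulE zsum0// => l.
      case: pa_pow => [h1|//]; have [/yL ->|lL] := ltnP L `|l|; first by rewrite mulr0.
      by rewrite xK ?mul0r//; lia.
    apply: eq_bigr => m _; rewrite /T; case: eqP => _; last by rewrite big1.
    rewrite cp_mulE (zsum_intw (K := L)); last first.
      by move=> l /yL ->; case: pa_pow => // ?; rewrite mulr0.
    by apply: eq_bigr => l _; rewrite pa_pow_p; case: (sp l j).
  rewrite exchange_big/= !big_seq; apply: eq_bigr => l; rewrite mem_intw => lL.
  rewrite (zsum_intw (K := K + L))// => m mKL; rewrite /T; case: eqP => // _.
  by case: (sp l j) => // j'; rewrite xK ?mul0r//; lia.
transitivity (\sum_(l <- intw L) \sum_j' (mxrep x : 'M[R[i]%C]_n) i j' *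
    (if sp l j == Some j' then y l (p j) else 0)); last first.
  rewrite exchange_big/= [RHS]mxE; apply: eq_bigr => j' _.
  by rewrite -mulr_sumr (mxrepE (x := y) (K := L)).
apply: eq_bigr => l _; case E : (sp l j) => [j0|]; last first.
  rewrite zsum0 => [|m]; last by rewrite /T E; case: eqP.
  by rewrite big1// => j' _; rewrite mulr0.
rewrite (bigD1 j0)//= eqxx [X in _ = _ + X]big1 ?addr0; last first.
  by move=> j' /negPf j'0; rewrite (inj_eq Some_inj) eq_sym j'0 mulr0.
(* Substituting [m = k + l]: once [j] is at [j0] after [l] steps, reaching [i] in [k + l] steps from
   [j] means reaching it in [k] steps from [j0]. *)
rewrite (zsum_shift _ l) (mxrepE (K := K))// mulr_suml (zsum_intw (K := K)).
  apply: eq_bigr => k _; rewrite /T E addrK.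
  case: (sp k j0 =P Some i) => [Ek|nEk].
    by rewrite (ppowD sK E Ek) eqxx.
  case: eqP => [Em|_]; last by rewrite mul0r.
  by case: nEk; have := ppow_sub sK E Em; rewrite addrK.
move=> k /xK xk0; rewrite /T E addrK xk0 mul0r; by case: eqP.
Qed.

Lemma mxrep_star x : cp_alg Th x -> mxrep (cp_star Th x) = cstar (mxrep x : opmx R n).
Proof.
move=> /cp_supp[K xK]; apply/matrixP => i j.
have xK' k : (K < `|k|)%N -> x (- k) = 0 by move=> kK; apply: xK; lia.
rewrite [LHS]mxE [RHS]mxE [in RHS]mxE [X in _ = X^*]zsum_opp.
rewrite !(zsum_intw (K := K)); last 2 first.
- move=> k /xK' xk; rewrite /cp_star /pa_pull /fun_star xk; case: eqP => // _.
  by case: pa_pow => // ?; exact: conjC0.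
- by move=> k /xK' ->; case: eqP.
rewrite rmorph_sum; apply: eq_bigr => k _.
case: (sp k j =P Some i) => [E|nE].
  have E' := ppow_opp sK E; rewrite E' eqxx /cp_star /pa_pull.
  by rewrite pa_pow_p E.
case: eqP => [E|_]; last by rewrite rmorph0.
by case: nE; have := ppow_opp sK E; rewrite opprK.
Qed.

Lemma mxrep_hom : is_cp_hom Th (mxrep : _ -> opmx_cstarAlg R n).
Proof. by split; [exact: mxrep_lin|exact: mxrep_mul|exact: mxrep_star]. Qed.

Context {A : cstarAlgType R} (iota : (int -> X -> cplx R) -> A).
Hypothesis hA : is_crossed_product Th iota.

(** The diagonal entry at [i] collects the coefficients whose degree is a period of [i]; the
    hypothesis leaves only degree 0. An entry is at most the operator norm, and representations
    contract. *)
Lemma mxrep_lower x i : cp_alg Th x -> (forall k, k != 0 -> sp k i = Some i -> x k = 0) ->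
  cabs (x 0 (p i)) <= rnorm (iota x).
Proof.
move=> xA xi; have [_ /(_ _ _ mxrep_hom)[Phi [[PhiH PhiE] _]]] := hA.
apply: le_trans (cstar_hom_norm PhiH (iota x)); rewrite PhiE//.
have <- : (mxrep x : 'M[R[i]%C]_n) i i = x 0 (p i).
  rewrite mxE (zsum1 (k := 0)) /= ?eqxx// => k k0.
  by case: eqP => // E; rewrite xi.
have -> : rnorm (mxrep x : opmx_cstarAlg R n) = opnorm (mxrep x) by [].
exact: cabs_entry_le.
Qed.

End MatrixRep.

Section LowerBound.
Context {R : realType} {X : topologicalType} (Th : partial_aut X).
Context {A : cstarAlgType R} (iota : (int -> X -> cplx R) -> A).
Hypothesis hA : is_crossed_product Th iota.
Implicit Types (x : int -> X -> cplx R).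

(* The point h is wrapped around a cycle longer than the support of x. *)
Lemma lower_fixed x h : cp_alg Th x -> pa_fwd Th h = Some h ->
  cabs (x 0 h) <= rnorm (iota x).
Proof.
move=> xA hh; have [K xK] := cp_supp xA.
pose sf (i : 'I_K.+1) := Some (ordS i); pose sb (i : 'I_K.+1) := Some (ord_pred i).
have sK i j : sf i = Some j <-> sb j = Some i.
  by split=> -[<-]; rewrite /sf /sb ?ordSK ?ord_predK.
have hb : pa_bwd Th h = Some h by apply/pa_fwdK.
apply: (@mxrep_lower _ _ _ _ (fun=> h) sf sb sK _ _ _ _ hA x ord0) => // k k0 E.
(* The position after [k] steps is [k] modulo [K + 1], so a return to 0 with [k] nonzero forces
   [|k| > K], outside the support. *)
have key : forall k i, ppow sf sb k ord0 = Some i ->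
    exists c : int, (i : nat)%:Z = k + c * K.+1%:Z.
  apply: ppow_ind => [|l i _ [c ic] [<-]|l i _ [c ic] [<-]].
  - by exists 0; rewrite mul0r.
  - rewrite /= ; have := ltn_ord i; rewrite leq_eqVlt => /predU1P[iK|iK].
      by rewrite iK modnn; exists (c - 1); lia.
    by rewrite modn_small//; exists c; lia.
  - rewrite /=; have := ltn_ord i; case: (nat_of_ord i) ic => [|m] ic iK.
      by rewrite add0n modn_small//; exists (c + 1); lia.
    by rewrite addSn /= modnDr modn_small ?(ltnW iK)//; exists c; lia.
have [c /= Ec] := key _ _ E; apply: xK.
have kE : k = - (c * K.+1%:Z) by lia.
have : (0 < `|c|)%N by rewrite absz_gt0; apply: contra_neq k0 => c0; rewrite kE c0 mul0r oppr0.
by rewrite kE abszN abszM /=; nia.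
Qed.

Lemma lower_isolated x h : cp_alg Th x -> pa_fwd Th h = None -> pa_bwd Th h = None ->
  cabs (x 0 h) <= rnorm (iota x).
Proof.
move=> xA hf hb; pose s (i : 'I_1) : option 'I_1 := None.
apply: (@mxrep_lower _ _ _ _ (fun=> h) s s _ _ _ _ _ hA x ord0) => // k k0 E.
have : forall k i, ppow s s k ord0 = Some i -> k = 0 by apply: ppow_ind.
by move=> /(_ _ _ E) /eqP; rewrite (negPf k0).
Qed.

(** An orbit that stops at both ends has no nonzero period: its representation is by truncated
    shifts on [j + 1] points. *)
Lemma lower_line x j (p : nat -> X) i : cp_alg Th x -> (i <= j)%N ->
  (forall i, (i < j)%N -> pa_fwd Th (p i) = Some (p i.+1)) -> pa_fwd Th (p j) = None ->
  pa_bwd Th (p 0) = None -> cabs (x 0 (p i)) <= rnorm (iota x).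
Proof.
move=> xA ij pS pj p0.
pose sf (i : 'I_j.+1) : option 'I_j.+1 := insub i.+1.
pose sb (i : 'I_j.+1) : option 'I_j.+1 := if (i : nat) is i'.+1 then insub i' else None.
have sfP a b : sf a = Some b <-> b = a.+1 :> nat.
  rewrite /sf; case: insubP => [u _ uE|]; last first.
    by rewrite -leqNgt => h; split=> // E; have := ltn_ord b; rewrite E ltnNge h.
  by split=> [[<-]//|E]; congr Some; apply: val_inj; rewrite /= uE.
have sbP a b : sb a = Some b <-> a = b.+1 :> nat.
  rewrite /sb; case: a => -[|a] aj //=; case: insubP => [u _ uE|]; last first.
    by rewrite -leqNgt => h; split=> // E; have := ltn_ord b; rewrite ltnNge; lia.
  by split=> [[<-]|[E]]; rewrite ?uE//; congr Some; apply: val_inj; rewrite /= uE.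
have sK a b : sf a = Some b <-> sb b = Some a by rewrite sfP sbP.
have pf (a : 'I_j.+1) : pa_fwd Th (p a) = omap (fun i : 'I_j.+1 => p i) (sf a).
  rewrite /sf; case: insubP => [u _ uE|].
    by rewrite /= uE pS// -ltnS; rewrite -uE ltn_ord.
  rewrite -leqNgt => h; have -> : a = j :> nat; last exact: pj.
  by have := ltn_ord a; lia.
have pb (a : 'I_j.+1) : pa_bwd Th (p a) = omap (fun i : 'I_j.+1 => p i) (sb a).
  rewrite /sb; case: a => -[|a] aj //=; case: insubP => [u _ uE|]; last by lia.
  by rewrite /= uE; apply/pa_fwdK; exact: pS.
have ij' : (i < j.+1)%N by [].
apply: (mxrep_lower sK pf pb hA (i := Ordinal ij')) => // k k0 E.
suff : i%:Z = i%:Z + k by move=> E'; case/eqP: k0; lia.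
have : forall k b, ppow sf sb k (Ordinal ij') = Some b -> (b : nat)%:Z = i%:Z + k.
  apply: ppow_ind => [|l a b ia /sfP ab|l a b ia /sbP ab]; first by rewrite addr0.
  - by rewrite ab; lia.
  - by move: ia; rewrite ab; lia.
by move=> /(_ _ _ E).
Qed.

End LowerBound.

(** * Restriction to closed invariant subsets *)

Lemma Re_cts (R : realType) (X : topologicalType) (f : X -> cplx R) :
  continuous f -> continuous (fun h => complex.Re (f h)).
Proof.
move=> fc h; apply/cvgrPdist_lt => d d0; have /cplx_ctsP/(_ _ d0) := fc h.
apply: filterS => h'; apply: le_lt_trans; rewrite (le_trans _ (cabs_Re _))//.
by case: (f h) (f h') => a b [].
Qed.

Lemma Im_cts (R : realType) (X : topologicalType) (f : X -> cplx R) :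
  continuous f -> continuous (fun h => complex.Im (f h)).
Proof.
move=> fc h; apply/cvgrPdist_lt => d d0; have /cplx_ctsP/(_ _ d0) := fc h.
apply: filterS => h'; apply: le_lt_trans; rewrite (le_trans _ (cabs_Im _))//.
by case: (f h) (f h') => a b [].
Qed.

Lemma compact_pos_lower (R : realType) (T : topologicalType) (K : set T) (D : T -> R) :
  compact K -> continuous D -> (forall x, 0 < D x) ->
  exists2 c : R, 0 < c & forall x, K x -> c <= D x.
Proof.
move=> cK Dc Dpos; have : compact ((fun x => (D x)^-1) @` K).
  apply: continuous_compact cK; apply: continuous_subspaceT => x.
  have := @continuousV R T D x; apply; first exact/lt0r_neq0/Dpos.
  exact: Dc.
move/compact_bounded => [B [_ hB]]; have B1 : 0 < `|B| + 1 by rewrite ltr_wpDl.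
exists (`|B| + 1)^-1; first by rewrite invr_gt0.
move=> x Kx; rewrite -[leRHS]invrK lef_pV2 ?posrE ?invr_gt0 ?Dpos//.
have := hB (`|B| + 1); rewrite (le_lt_trans (ler_norm B)) ?ltrDl// => /(_ isT).
move=> /(_ (D x)^-1 (ex_intro2 _ _ x Kx erefl)).
by apply: le_trans; exact: ler_norm.
Qed.

(** * Topology of subspaces *)

Section Subtypes.
Context {X : topologicalType} (S : set X).

Lemma set_val_cts : continuous (set_val : set_type S -> X).
Proof. exact: initial_continuous. Qed.

Lemma continuous_comp_val (T : topologicalType) (f : X -> T) :
  continuous f -> continuous (fun x : set_type S => f (set_val x)).
Proof. by move=> fc x; apply: continuous_comp; [exact: set_val_cts|exact: fc]. Qed.

Lemma set_val_mem (x : set_type S) : S (set_val x).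
Proof. exact: (set_mem (valP x)). Qed.

Lemma set_val_hausdorff : hausdorff_space X -> hausdorff_space (set_type S).
Proof.
rewrite !open_hausdorff => hX x y xy.
have [|[U V] [/= Ux Vy] [oU oV /eqP UV]] := hX (set_val x) (set_val y).
  by apply: contra_neq xy; exact: val_inj.
exists (set_val @^-1` U, set_val @^-1` V) => /=.
  by split; rewrite inE /=; [rewrite inE in Ux|rewrite inE in Vy].
split; try by apply: open_comp => // z _; exact: set_val_cts.
apply/eqP/seteqP; split => // z /= [Uz Vz].
by have : (U `&` V) (set_val z); [|rewrite UV].
Qed.

Lemma compact_set_val K : compact K -> K `<=` S ->
  compact (set_val @^-1` K : set (set_type S)).
Proof.
move=> cK KS F PF FK.
have [|x [Kx clx]] := cK (set_val @ F) _; first exact: FK.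
exists (exist _ x (mem_set (KS _ Kx))); split=> //= A B FA.
rewrite nbhsE => -[_ [[V oV <-] Vx] VB].
have FA' : F (set_val @^-1` (set_val @` A)) by apply: filterS FA => y Ay; exists y.
have nV : nbhs x V by apply: open_nbhs_nbhs; split.
have [z [[y Ay yz] Vz]] := clx (set_val @` A) V FA' nV.
by exists y; split=> //; apply: VB; rewrite /= yz.
Qed.

End Subtypes.

Section Restriction.
Context {R : realType} {X : topologicalType} (Th : partial_aut X) (S : set X).
Hypothesis invS : forall x y, pa_fwd Th x = Some y -> (S x <-> S y).
Local Notation XS := (set_type S).
Local Notation ThS := (pa_restrict invS).
Implicit Types (f g : X -> cplx R) (x y : int -> X -> cplx R) (k l m : int).

Lemma pa_pow_res k (h : XS) : omap set_val (pa_pow ThS k h) = pa_pow Th k (set_val h).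
Proof.
have aux (p : X -> option X) (ps : XS -> option XS) :
    (forall h, ps h = obind insub (p (set_val h))) ->
    (forall h h', p h = Some h' -> (S h <-> S h')) ->
    forall n, omap set_val (iter n (obind ps) (Some h)) = iter n (obind p) (Some (set_val h)).
  move=> psE pS; elim=> //= n <-; case: (iter n _ _) => //= h1.
  rewrite psE; case E : (p _) => [h2|//] /=; case: insubP => [u _ <-//|].
  by move=> /negP[]; apply/mem_set/(pS _ _ E); exact: set_val_mem.
case: k => n; first exact: (aux (pa_fwd Th) (res_fwd Th (S := S)) _ invS n).
exact: (aux (pa_bwd Th) (res_bwd Th (S := S)) _ (invS_bwd invS) n.+1).
Qed.

Definition restr x : int -> XS -> cplx R := fun k h => x k (set_val h).

Hypothesis closedS : closed S.

Lemma C0_restr f : C0 R X f -> C0 R XS (f \o set_val).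
Proof.
move=> f0; have fc := C0_cts f0; apply/C0P; split.
  by move=> h; apply: continuous_comp; [exact: set_val_cts|exact: fc].
move=> e e0; have : compact ([set h | e <= cabs (f h)] `&` S).
  apply: (subclosed_compact _ (C0_compact f0 e0)); last by move=> h [].
  by apply: closedI => //; exact: closed_cabs_ge.
move/compact_set_val => /(_ S) /(_ (@subIsetr _ _ _)); congr compact.
by apply/seteqP; split => h /=; [case|move=> ?; split=> //; exact: set_val_mem].
Qed.

Lemma C0_dom_restr k f : C0_dom Th k f -> C0_dom ThS k (f \o set_val).
Proof.
move=> [f0 fk]; split; first exact: C0_restr.
by move=> h E; apply: fk; rewrite -pa_pow_res E.
Qed.

Lemma cp_alg_restr x : cp_alg Th x -> cp_alg ThS (restr x).
Proof.
move=> /cp_algP[[K xK] xd]; apply/cp_algP; split; last by move=> k; exact: C0_dom_restr.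
by exists K => k /xK E; apply/funext => h; rewrite /restr E.
Qed.

Lemma restr_mul x y : restr (cp_mul Th x y) = cp_mul ThS (restr x) (restr y).
Proof.
apply/funext => m; apply/funext => h; rewrite /restr !cp_mulE; apply: eq_fsbigr => l _.
by rewrite -pa_pow_res; case: (pa_pow ThS l h).
Qed.

Lemma restr_star x : restr (cp_star Th x) = cp_star ThS (restr x).
Proof.
apply/funext => m; apply/funext => h; rewrite /restr /cp_star /pa_pull -pa_pow_res.
by case: (pa_pow ThS m h).
Qed.

Lemma restr_hom (B : cstarAlgType R) (iotaB : (int -> XS -> cplx R) -> B) :
  is_cp_hom ThS iotaB -> is_cp_hom Th (iotaB \o restr).
Proof.
move=> hB; split=> [z x y xA yA|x y xA yA|x xA] /=.
- have := cp_alg_restr xA; have := cp_alg_restr yA => y' x'.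
  by rewrite -(cp_homZ hB)// -(cp_homD hB)//; exact: cp_algZ.
- by rewrite restr_mul (cp_homM hB)//; exact: cp_alg_restr.
- by rewrite restr_star (cp_homJ hB)//; exact: cp_alg_restr.
Qed.

Hypothesis normalX : normal_space X.
(** A strictly positive function in [C_0(X)], used to make bounded extensions vanish at infinity. On
    [H] it will be the coordinate [t]. *)
Context (D : X -> R).
Hypothesis D0 : C0 R X (fun h => (D h)%:C%C).
Hypothesis Dc : continuous D.
Hypothesis Dpos : forall h, 0 < D h.

(** Tietze extension from [S] together with the closed complement [Z] of the domain of [theta^k],
    where the value 0 is prescribed: this keeps the extension in the ideal of degree [k]. *)
Lemma real_extension (r : XS -> R) k M : 0 < M -> continuous r -> (forall h, `|r h| <= M) ->
  (forall h, pa_pow ThS k h = None -> r h = 0) ->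
  exists g : X -> R, [/\ continuous g, forall h, g (set_val h) = r h,
    forall h, pa_pow Th k h = None -> g h = 0 & forall h, `|g h| <= M].
Proof.
move=> M0 rc rM rk; pose Z := [set h | pa_pow Th k h = None].
have cZ : closed Z.
  have := pa_pow_open Th k (@openT X); rewrite -openC; congr open.
  apply/seteqP; split => h; first by case=> y E _; rewrite /Z /= E.
  rewrite /Z /=.
  by case E : (pa_pow Th k h) => [y|] // _; exists y.
pose F (h : X) : R^o := if insub h is Some h' then r h' else 0.
have FE h : F (set_val h) = r h by rewrite /F valK.
have FZ h : Z h -> F h = 0.
  rewrite /F /Z /=; case: insubP => // u _ uh Zh; apply: rk.
  by have := pa_pow_res k u; rewrite set_valE uh Zh; case: (pa_pow ThS k u).
have Fc : {within S `|` Z, continuous F}.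
  apply: withinU_continuous => //.
    apply/subspace_sigL_continuousP; rewrite (_ : sigL S F = r)//.
    by apply/funext => h; exact: FE.
  apply: (@subspace_eq_continuous _ _ _ (fun=> 0)); last exact: cst_continuous.
  by move=> h; rewrite inE => /FZ.
have FM h : (S `|` Z) h -> `|F h| <= M.
  move=> [Sh|/FZ ->]; last by rewrite normr0 ltW.
  by rewrite (FE (exist _ h (mem_set Sh)) : F h = _).
have [g [gF gc gM]] := continuous_bounded_extension normalX (closedU closedS cZ) M0 Fc FM.
exists g; split=> // h.
  by rewrite -FE gF// inE; left; exact: set_val_mem.
by move=> Zh; rewrite -gF ?FZ// inE; right.
Qed.

(** A bounded extension need not vanish at infinity. Multiplication by [psi = min(1, D / c)] repairs
    this, where [c] bounds [D] from below on the compact set [|f| >= e]: there [psi = 1], and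
    elsewhere the error is at most [|f| < e]. *)
Lemma C0_dom_extension (f : XS -> cplx R) k (e : R) : 0 < e -> C0_dom ThS k f ->
  exists2 g, C0_dom Th k g & forall h, cabs (f h - g (set_val h)) <= e.
Proof.
move=> e0 [f0 fk]; have [M M0 fM] := C0_bounded f0; have fc := C0_cts f0.
have [Rec Imc] := (Re_cts fc, Im_cts fc).
have [||g1 [g1c g1E g1k g1M]] := real_extension (k := k) M0 Rec.
- by move=> h; exact: le_trans (cabs_Re _) (fM h).
- by move=> h /fk ->.
have [||g2 [g2c g2E g2k g2M]] := real_extension (k := k) M0 Imc.
- by move=> h; exact: le_trans (cabs_Im _) (fM h).
- by move=> h /fk ->.
pose K := [set h | e <= cabs (f h)]; have cK : compact K by exact: C0_compact.
have [c c0 cD] := compact_pos_lower cK (continuous_comp_val Dc) (fun h => Dpos (set_val h)).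
pose G h : R[i]%C := (g1 h)%:C%C + 'i%R * (g2 h)%:C%C.
have Gc : continuous (G : X -> cplx R).
  move=> h; apply: (@continuousD _ _ _ (fun h => (g1 h)%:C%C : cplx R) (fun h => 'i%R * (g2 h)%:C%C : cplx R)).
    exact: real_cts.
  apply: (@continuousM R[i]%C X (fun=> 'i%R) (fun h => (g2 h)%:C%C)); first exact: cvg_cst.
  exact: real_cts.
have GM h : cabs (G h) <= M + M.
  rewrite (le_trans (cabsD _ _))// cabsM cabsi mul1r !cabs_real lerD//.
have GE h : G (set_val h) = f h by rewrite /G g1E g2E -complexiE -complexE.
pose psi h := Num.min 1 (D h / c).
have psic : continuous psi.
  move=> h; apply: (@continuous_min R X (fun=> 1) (fun h => D h / c) h); first exact: cvg_cst.
  by apply: cvgM; [exact: Dc|exact: cvg_cst].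
have psi01 h : 0 <= psi h <= 1.
  rewrite /psi ge_min lexx andbT le_min ler01 /= divr_ge0 ?(ltW c0)//; exact/ltW/Dpos.
have psi0 : C0 R X (fun h => (psi h)%:C%C).
  apply: (C0_dominated (c := c^-1) D0); first exact: real_cts.
  move=> h; have /andP[p0 p1] := psi01 h; rewrite !cabs_real !ger0_norm ?(ltW (Dpos _))//.
  by rewrite /psi ge_min mulrC lexx orbT.
exists (fun h => G h * (psi h)%:C%C).
  split; first exact: C0_mulr GM.
  by move=> h Eh; rewrite /G g1k// g2k// rmorph0 mulr0 addr0 mul0r.
move=> h; rewrite GE.
have -> : f h - f h * (psi (set_val h))%:C%C = f h * (1 - psi (set_val h))%:C%C :> R[i]%C.
  by rewrite rmorphB/= mulrBr mulr1.
have /andP[p0 p1] := psi01 (set_val h).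
rewrite cabsM cabs_real ger0_norm ?subr_ge0//.
have [eh|/ltW he] := leP e (cabs (f h)).
  suff -> : psi (set_val h) = 1 by rewrite subrr mulr0 ltW.
  by apply/min_idPl; rewrite ler_pdivlMr// mul1r cD.
by rewrite (le_trans _ he)// ler_piMr ?cabs_ge0// gerBl.
Qed.

End Restriction.

(** * The space H *)

Section GeometryOfH.
Context {R : realType}.
Implicit Types (q t a : R).

Lemma Hspace_hausdorff : hausdorff_space (Hspace R).
Proof. by apply: set_val_hausdorff; exact: (@norm_hausdorff R (R * R * R)%type). Qed.

Lemma Yspace_hausdorff : hausdorff_space (Yspace R).
Proof. by apply: set_val_hausdorff; exact: (@norm_hausdorff R R). Qed.

Lemma Hspace_normal : normal_space (Hspace R).
Proof. exact: (@pseudometric_normal R (Hspace R)). Qed.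

Definition Hq (h : Hspace R) : R := (set_val h).1.1.
Definition Ht (h : Hspace R) : R := (set_val h).1.2.
Lemma proj_cts : [/\ continuous (fun h : R * R * R => h.1.1),
  continuous (fun h : R * R * R => h.1.2) & continuous (fun h : R * R * R => h.2)].
Proof.
split=> h.
- apply: (@continuous_comp _ _ _ (fun h : R * R * R => h.1) fst); exact: cvg_fst.
- apply: (@continuous_comp _ _ _ (fun h : R * R * R => h.1) snd); first exact: cvg_fst.
  exact: cvg_snd.
- exact: cvg_snd.
Qed.

Lemma Hq_cts : continuous Hq.
Proof.
have [qc _ _] := proj_cts => h.
by apply: (@continuous_comp _ _ _ set_val (fun h : R * R * R => h.1.1) h); [exact: set_val_cts|exact: qc].
Qed.

Lemma Ht_cts : continuous Ht.
Proof.
have [_ tc _] := proj_cts => h.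
by apply: (@continuous_comp _ _ _ set_val (fun h : R * R * R => h.1.2) h); [exact: set_val_cts|exact: tc].
Qed.

Lemma to_set_type_cts (T X : topologicalType) (S : set X) (f : T -> set_type S) :
  continuous (set_val \o f) -> continuous f.
Proof. by move=> /continuousP fc; apply/continuousP => _ [V oV <-]; exact: fc. Qed.

Lemma H_proj_cts : continuous (@H_proj R).
Proof. by apply: to_set_type_cts; exact: Hq_cts. Qed.

Lemma H_fiber_closed (y : Yspace R) : closed (H_fiber y).
Proof.
apply: closed_comp => [h _|]; first exact: H_proj_cts.
exact/accessible_closed_set1/hausdorff_accessible/Yspace_hausdorff.
Qed.

Lemma Hfiber_hausdorff (y : Yspace R) : hausdorff_space (set_type (H_fiber y)).
Proof. exact/set_val_hausdorff/Hspace_hausdorff. Qed.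

(** Freed of roots and inverses, each pair [(i, j)] gives polynomial conditions, hence a closed set
    in all of [R^3]. *)
Lemma H_set_lt1 q t a : q < 1 -> H_set (q, t, a) <->
  0 < q /\ exists i j : nat, [/\ (i <= j)%N, t = q ^+ j.+1, 0 <= a & a ^+ 2 * q ^+ j = q ^+ (i + i)].
Proof.
move=> q1; have qn1 : q != 1 by rewrite lt_eqF.
rewrite HsetP//; split=> [[q0 _ [i [j [ij tE aE]]]]|[q0 [i [j [ij tE a0 aE]]]]].
  split=> //; exists i, j; split=> //; first by rewrite aE mulr_ge0 ?sqrtr_ge0 ?exprn_ge0 ?ltW.
  rewrite aE exprMn sqr_sqrtr ?invr_ge0 ?exprn_ge0 ?(ltW q0)// -mulrA mulVf ?mulr1 ?expf_neq0 ?gt_eqF//.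
  by rewrite expr2 exprD.
split=> //; exists i, j; split=> //.
have qj : 0 < q ^+ j by rewrite exprn_gt0.
apply: (@pexpIrn _ 2); rewrite ?nnegrE ?mulr_ge0 ?sqrtr_ge0 ?exprn_ge0 ?(ltW q0)//.
rewrite exprMn sqr_sqrtr ?invr_ge0 ?(ltW qj)//; apply: (mulIf (lt0r_neq0 qj)).
by rewrite aE -mulrA mulVf ?mulr1 ?gt_eqF// expr2 exprD.
Qed.

Lemma H_set_eq1 t a : H_set (1, t, a) <-> [/\ 0 < t, t <= 1, 0 < a, t <= a ^+ 2 & t * a ^+ 2 <= 1].
Proof.
rewrite /H_set /= /qseg /qray eqxx /= ltr01 lexx !in_itv /= divr1 div1r; split.
  move=> [_ /andP[t0 t1] /andP[ta at1]].
  have a0 : 0 < a by apply: lt_le_trans ta; rewrite sqrtr_gt0.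
  split=> //; first by rewrite -[t]sqr_sqrtr ?(ltW t0)// ler_pXn2r ?nnegrE ?sqrtr_ge0 ?(ltW a0).
  have : a ^+ 2 <= t^-1.
    by rewrite -[t^-1]sqr_sqrtr ?invr_ge0 ?(ltW t0)// ler_pXn2r ?nnegrE ?sqrtr_ge0 ?(ltW a0).
  by rewrite -(ler_pM2l t0) divff ?gt_eqF.
move=> [t0 t1 a0 ta at1]; split=> //; first by rewrite t0.
have aE : a = Num.sqrt (a ^+ 2) by rewrite sqrtr_sqr ger0_norm ?ltW.
apply/andP; split; first by rewrite [leRHS]aE ler_sqrt ?exprn_ge0 ?(ltW a0).
by rewrite [leLHS]aE ler_sqrt ?invr_ge0 ?(ltW t0)// -(ler_pM2l t0) divff ?gt_eqF.
Qed.

(** These conditions hold over every [q], survive limits apart from strictness, and at [q = 1]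
    describe [H]. They control limit points as [q] tends to 1 and bound [a] on [t >= e]. *)
Lemma H_set_ineq q t a : H_set (q, t, a) ->
  [/\ 0 < q <= 1, t <= q, 0 < a, t <= q * a ^+ 2 & t * a ^+ 2 <= q].
Proof.
move=> Hh; have [/= q0 t0 a0] := H_pos Hh.
have qle : q <= 1 by move: Hh => [/andP[]].
have [q1|qn1] := eqVneq q 1.
  by move: Hh; rewrite q1 => /H_set_eq1[*]; split; rewrite ?mul1r ?ltr01 ?lexx.
have q1 : q < 1 by rewrite lt_neqAle qn1.
have /(H_set_lt1 _ _ q1)[_ [i [j [ij tE _ aE]]]] := Hh.
have qj : 0 < q ^+ j by rewrite exprn_gt0.
have qX m n : (m <= n)%N -> q ^+ n <= q ^+ m by move=> mn; rewrite ler_wiXn2l// ltW.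
split=> //; rewrite ?q0 //.
- by rewrite tE -[leRHS]expr1 qX.
- rewrite tE exprS ler_pM2l// -(ler_pM2r qj) aE -exprD; apply: qX; lia.
- by rewrite tE exprS -mulrA ler_piMr ?(ltW q0)// mulrC aE exprn_ile1 ?ltW.
Qed.

(** A limit point over [q = 1] inherits the inequalities of [H_set_ineq], which suffice there. Near
    a limit point over [q < 1] the parameter stays below some [r < 1], and [t = q^(j+1) >= e] leaves
    finitely many pairs [(i, j)], so a finite union of closed sets decides. *)
Lemma H_closed_t (e : R) : 0 < e -> closed [set h : R * R * R | H_set h /\ e <= h.1.2].
Proof.
move=> e0; have [qc tc ac] := proj_cts.
set E := [set h | _]; pose T := (R * R * R)%type.
pose C0 := [set h : T | 0 <= h.1.1] `&` ([set h : T | h.1.1 <= 1] `&` ([set h : T | e <= h.1.2] `&`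
  ([set h : T | h.1.2 <= h.1.1] `&` ([set h : T | 0 <= h.2] `&`
  ([set h : T | h.1.2 <= h.1.1 * h.2 ^+ 2] `&` [set h : T | h.1.2 * h.2 ^+ 2 <= h.1.1]))))).
have le_closed (f g : R * R * R -> R) : continuous f -> continuous g ->
    closed [set h | f h <= g h].
  move=> fc gc; rewrite (_ : mkset _ = (fun h => g h - f h) @^-1` [set x | 0 <= x]).
    apply: closed_comp => [h _|]; last exact: closed_ge.
    by apply: cvgB; [exact: gc|exact: fc].
  by apply/seteqP; split=> h /=; rewrite subr_ge0.
have eq_closed (f g : R * R * R -> R) : continuous f -> continuous g ->
    closed [set h | f h = g h].
  move=> fc gc; rewrite (_ : mkset _ = [set h | f h <= g h] `&` [set h | g h <= f h]).
    by apply: closedI; exact: le_closed.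
  by apply/seteqP; split=> h /= => [->|[? ?]]; rewrite ?lexx//; apply/eqP; rewrite eq_le; apply/andP.
have cc (x : R) : continuous (fun _ : R * R * R => x) by exact: cst_continuous.
have Xc (f : R * R * R -> R) n : continuous f -> continuous (fun h => f h ^+ n).
  by move=> fc h; apply: (@continuous_comp _ _ _ f (fun x => x ^+ n) h); [exact: fc|exact: exprn_continuous].
have Mc (f g : R * R * R -> R) : continuous f -> continuous g -> continuous (fun h => f h * g h).
  by move=> fc gc h; apply: cvgM; [exact: fc|exact: gc].
have C0c : closed C0.
  by do !apply: closedI; apply: le_closed => //; do ?[apply: Mc => //]; exact: Xc.
have EC : E `<=` C0.
  move=> [[q t] a] [/H_set_ineq[/andP[q0 q1] tq a0 ta at1] /= et].
  by do !split => //=; exact: ltW.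
pose G i j := [set h : R * R * R | h.1.2 = h.1.1 ^+ j.+1] `&` [set h : R * R * R | 0 <= h.2] `&`
  [set h : R * R * R | h.2 ^+ 2 * h.1.1 ^+ j = h.1.1 ^+ (i + i)].
have Gc i j : closed (G i j).
  by do !apply: closedI; [apply: eq_closed|apply: le_closed|apply: eq_closed] => //;
    do ?[apply: Mc => //]; exact: Xc.
move=> [[q t] a] clh; have := C0c _ (closure_subset EC clh).
move=> [/= q0 [/= q1 [/= et [/= tq [/= a0 [/= ta at1]]]]]].
have t0 : 0 < t by exact: lt_le_trans et.
have q0' : 0 < q by exact: lt_le_trans tq.
move: q1; rewrite le_eqVlt => /predU1P[q1|q1].
  split=> //; rewrite q1; apply/H_set_eq1; rewrite q1 mul1r in ta at1 tq; split=> //.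
  rewrite lt_neqAle a0 andbT; apply: contraTneq ta => <-.
  by rewrite expr0n -ltNge.
pose r := (q + 1) / 2; have r0 : 0 < r by rewrite /r; lra.
have r1 : r < 1 by rewrite /r; lra.
have qr : q < r by rewrite /r; lra.
have [J JP] : exists J : nat, r ^+ J < e.
  have : (fun n => r ^+ n) @ \oo --> (0 : R) by apply: cvg_expr; rewrite ger0_norm ?ltW.
  move=> /cvgrPdist_lt /(_ _ e0) [N _ /(_ N (leqnn N))]/=.
  by rewrite sub0r normrN ger0_norm ?exprn_ge0 ?(ltW r0)// => ?; exists N.
pose s := [seq (i, j) | j <- iota 0 J, i <- iota 0 j.+1].
have sP i j : (i, j) \in s = (i <= j < J)%N.
  apply/allpairsPdep/idP => [[j' [i' []]]|/andP[ij jJ]].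
    by rewrite !mem_iota /= !add0n ltnS => jJ ij [-> ->]; rewrite ij.
  by exists j, i; rewrite !mem_iota /= !add0n ltnS.
pose U := \big[setU/set0]_(ij <- s) G ij.1 ij.2.
have Uc : closed U by apply: closed_bigsetU => ij _; exact: Gc.
have [|nU] := pselect (U (q, t, a)).
  rewrite /U -bigcup_seq => -[[i j] ijs] [[/= tE _] aE].
  have /andP[ij _] : (i <= j < J)%N by rewrite -sP.
  split=> //; apply/(H_set_lt1 _ _ q1); split=> //.
  by exists i, j; split.
have nb : nbhs (q, t, a) ((~` U) `&` [set h | h.1.1 < r]).
  apply: filterI; first by apply: open_nbhs_nbhs; split=> //; exact: closed_openC.
  apply: open_nbhs_nbhs; split=> //=.
  rewrite (_ : mkset _ = (fun h : R * R * R => h.1.1) @^-1` [set x | x < r])//.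
  by apply: open_comp => [h _|]; [exact: qc|exact: open_lt].
have [[[q' t'] a'] [[Hh et'] [/= nU' qr']]] := clh _ nb.
case: nU'; have q1' : q' < 1 by exact: lt_trans r1.
have /(H_set_lt1 _ _ q1')[q0'' [i [j [ij tE a0' aE]]]] := Hh.
rewrite /U -bigcup_seq; exists (i, j) => //.
change ((i, j) \in s); rewrite sP ij /= ltnNge; apply/negP => Jj.
have : e <= r ^+ J; last by rewrite leNgt JP.
apply: le_trans et' _; rewrite /= tE.
rewrite (@le_trans _ _ (r ^+ j.+1))//; first by rewrite ler_pXn2r ?nnegrE ?ltW.
by rewrite ler_wiXn2l ?(ltW r0) ?(ltW r1)// leqW.
Qed.

Lemma Ht_C0 : C0 R (Hspace R) (fun h => (Ht h)%:C%C).
Proof.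
apply: C0_intro; first exact: (real_cts Ht_cts).
move=> e e0; pose K := [set h : R * R * R | H_set h /\ e <= h.1.2].
exists (set_val @^-1` K); last first.
  move=> h; rewrite cabs_real; have [_ t0 _] := H_pos (set_val_mem h).
  by rewrite ger0_norm ?(ltW t0)//; split=> //; exact: set_val_mem.
apply: compact_set_val; last by move=> h [].
(* The bound on [a] comes from [t a^2 <= q <= 1] and [t >= e], which give [a^2 <= 1/e]. *)
pose B : set (R * R * R) := (`[0, 1]%classic `*` `[0, 1]%classic) `*` `[0, 1 + e^-1]%classic.
apply: (@subclosed_compact _ K B).
- exact: H_closed_t.
- by do !apply: compact_setX; exact: segment_compact.
move=> [[q t] a] [/H_set_ineq[/andP[q0 q1] tq a0 ta at1] /= et].
have t0 : 0 < t by exact: lt_le_trans et.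
have a2 : a ^+ 2 <= e^-1.
  rewrite -(ler_pM2l e0) divff ?gt_eqF// (le_trans _ q1)// (le_trans _ at1)//.
  by rewrite ler_wpM2r ?sqr_ge0.
split; first by split; rewrite /= in_itv /= ?(ltW q0) ?(ltW t0)//= (le_trans tq).
by rewrite /= in_itv /= (ltW a0) /=; have := sqr_ge0 (a - 1); nra.
Qed.

Lemma Ht_gt0 h : 0 < Ht h.
Proof. by have [] := H_pos (set_val_mem h). Qed.

End GeometryOfH.

(** * Openness of the projection to q *)

Section Openness.
Context {R : realType}.
Implicit Types (q t a b e : R).

Lemma exprn_small q e : 0 < q < 1 -> 0 < e -> exists n : nat, q ^+ n <= e.
Proof.
move=> /andP[q0 q1] e0; have : (fun n => q ^+ n) @ \oo --> (0 : R).
  by apply: cvg_expr; rewrite ger0_norm ?ltW.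
move=> /cvgrPdist_lt /(_ _ e0) [N _ /(_ N (leqnn N))]/=.
by rewrite sub0r normrN ger0_norm ?exprn_ge0 ?(ltW q0)// => /ltW ?; exists N.
Qed.

(** A point over 1 is rounded to the discrete fibre over [q]: [t] is the largest power of [q] with
    positive exponent below [t0], and [a] the largest grid value below [a0], or the lowest one if
    there is none. *)
Lemma H_set_round q t0 a0 : 0 < q < 1 -> H_set (1, t0, a0) ->
  exists t a, [/\ H_set (q, t, a), q * t0 <= t <= t0 & q * a0 <= a /\ q * a <= a0].
Proof.
move=> /[dup] qq /andP[q0 q1] /H_set_eq1[t00 t01 a00 ta at1].
have exj : exists j, q ^+ j.+1 <= t0.
  have [n nt] := exprn_small qq t00; exists n; apply: le_trans nt.
  by rewrite exprS ler_piMl ?exprn_ge0 ?(ltW q0) ?(ltW q1).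
case: (ex_minnP exj) => j jt jmin.
have tj : t0 <= q ^+ j.
  case: j jmin {jt} => [|j] jmin; first by rewrite expr0.
  by rewrite leNgt; apply/negP => /ltW /jmin; rewrite ltnn.
have qj : 0 < q ^+ j by rewrite exprn_gt0.
pose b := Num.sqrt (q ^- j).
have b0 : 0 < b by rewrite sqrtr_gt0 invr_gt0.
have bj : b ^+ 2 * q ^+ j = 1 by rewrite sqr_sqrtr ?invr_ge0 ?(ltW qj)// mulVf ?gt_eqF.
have exi : exists i, q ^+ i * b <= a0.
  have [|n nt] := exprn_small (e := a0 / b) qq; first by rewrite divr_gt0.
  by exists n; rewrite -ler_pdivlMr.
have mem i : (i <= j)%N -> H_set (q, q ^+ j.+1, q ^+ i * b).
  move=> ij; apply/(H_set_lt1 _ _ q1); split=> //; exists i, j; split=> //.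
    by rewrite mulr_ge0 ?exprn_ge0 ?(ltW q0) ?(ltW b0).
  by rewrite exprMn -mulrA bj mulr1 expr2 exprD.
have tt : q * t0 <= q ^+ j.+1 <= t0 by rewrite jt andbT exprS ler_pM2l.
have lesq u v : 0 <= u -> 0 <= v -> u ^+ 2 <= v ^+ 2 -> u <= v.
  by move=> u0 v0; rewrite ler_pXn2r.
have jt' : q * q ^+ j <= t0 by rewrite -exprS.
case: (ex_minnP exi) => i ia imin; have [ij|ji] := leqP i j.
  exists (q ^+ j.+1), (q ^+ i * b); split=> //; first exact: mem.
  split; last by rewrite (le_trans _ ia)// ler_piMl ?mulr_ge0 ?exprn_ge0 ?(ltW q0) ?(ltW b0) ?(ltW q1).
  case: i ia imin ij => [|i] ia imin ij; last first.
    rewrite exprS -mulrA ler_pM2l// leNgt; apply/negP => /ltW /imin.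
    by rewrite ltnn.
  (* Case [i = 0]: the grid ends at [b], and [t0 a0^2 <= 1] prevents [a0] from exceeding it by more
     than the factor [1/q]. *)
  rewrite expr0 mul1r; apply: lesq; rewrite ?mulr_ge0 ?(ltW q0) ?(ltW a00) ?(ltW b0)//.
  rewrite -(ler_pM2r qj) bj exprMn.
  have : q * q ^+ j * a0 ^+ 2 <= 1 by rewrite (le_trans _ at1)// ler_wpM2r ?sqr_ge0.
  have := sqr_ge0 a0; move: (a0 ^+ 2) (q ^+ j) qj => u v v0 u0 h.
  have : 0 <= q * v * u by rewrite !mulr_ge0 ?(ltW q0) ?(ltW v0).
  nra.
(* Here [a0] lies below the whole grid; its lowest point is within the factor [1/q] because
   [t0 <= a0^2]. *)
have aj : a0 < q ^+ j * b by rewrite ltNge; apply/negP => /imin; rewrite leqNgt ji.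
exists (q ^+ j.+1), (q ^+ j * b); split=> //; first exact: mem.
split; first by rewrite (le_trans _ (ltW aj))// ler_piMl ?(ltW a00) ?(ltW q1).
apply: lesq; rewrite ?mulr_ge0 ?exprn_ge0 ?(ltW q0) ?(ltW b0) ?(ltW a00)//.
rewrite !exprMn; apply: le_trans ta; apply: le_trans jt'.
have -> : q ^+ 2 * ((q ^+ j) ^+ 2 * b ^+ 2) = q ^+ 2 * q ^+ j * (b ^+ 2 * q ^+ j) by ring.
by rewrite bj mulr1 ler_pM2r// expr2 ler_piMl ?(ltW q0) ?(ltW q1).
Qed.

(** Over [q0 < 1] the indices [i, j] are kept and [q] varies; over [q0 = 1] the point is rounded to
    a grid whose relative mesh [1 - q] tends to 0. *)
Lemma H_set_near q0 t0 a0 e : H_set (q0, t0, a0) -> 0 < e ->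
  exists2 d : R, 0 < d & forall q, 0 < q <= 1 -> `|q0 - q| < d ->
    exists t a, [/\ H_set (q, t, a), `|t0 - t| < e & `|a0 - a| < e].
Proof.
move=> Hh e0; have [q01|qn1] := eqVneq q0 1.
  move: Hh; rewrite q01 => Hh; have /H_set_eq1[t00 t01 a00 ta at1] := Hh.
  have a1 : 0 < 2 * (a0 + 1) by rewrite mulr_gt0 ?addr_gt0.
  (* Since [q > 1/2], the estimate [q a <= a0] gives [a - a0 <= 2 (1 - q) a0]. *)
  exists (Num.min 2^-1 (e / (2 * (a0 + 1)))); first by rewrite lt_min invr_gt0 ltr0n divr_gt0.
  move=> q /andP[q0' q1]; rewrite lt_min => /andP[h1 h2].
  rewrite ltr_pdivlMr// in h2; have [qE|qn1] := eqVneq q 1.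
    by exists t0, a0; rewrite qE !subrr normr0; split.
  have q1' : q < 1 by rewrite lt_neqAle qn1.
  have nE : `|1 - q| = 1 - q by rewrite ger0_norm ?subr_ge0.
  rewrite nE in h1 h2.
  have [t [a [Hqta /andP[t1 t2] [a2 a3]]]] := H_set_round (introT andP (conj q0' q1')) Hh.
  exists t, a; split=> //.
    rewrite ger0_norm ?subr_ge0//; nra.
  by rewrite ltr_norml; apply/andP; split; nra.
have [q00 q01 [i [j [ij tE aE]]]] := (HsetP _ _ qn1).1 Hh.
have tc : {for q0, continuous (fun q => q ^+ j.+1)} by exact: exprn_continuous.
have ac : {for q0, continuous (fun q => q ^+ i * Num.sqrt (q ^- j))}.
  apply: cvgM; first exact: exprn_continuous.
  apply: continuous_cvg; first exact: sqrt_continuous.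
  have := @continuousV R R (fun q => q ^+ j) q0; apply.
    by rewrite gt_eqF// exprn_gt0.
  exact: exprn_continuous.
have /cvgrPdist_lt/(_ _ e0)/nbhs_ballP[d1 /= d10 d1P] := tc.
have /cvgrPdist_lt/(_ _ e0)/nbhs_ballP[d2 /= d20 d2P] := ac.
exists (Num.min (1 - q0) (Num.min d1 d2)).
  by rewrite !lt_min subr_gt0 q01 d10 d20.
move=> q /andP[qp q1]; rewrite !lt_min => /and3P[h h1 h2].
have q1' : q < 1 by move: h; rewrite ltr_norml => /andP[]; lra.
exists (q ^+ j.+1), (q ^+ i * Num.sqrt (q ^- j)); split.
- by apply/HsetP; rewrite ?lt_eqF//; split=> //; exists i, j.
- by rewrite tE; apply: d1P; rewrite -ball_normE.
- by rewrite aE; apply: d2P; rewrite -ball_normE.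
Qed.

Lemma H_proj_open (h0 : Hspace R) (P : set (Hspace R)) : nbhs h0 P ->
  nbhs (H_proj h0) [set y | exists2 h, P h & H_proj h = y].
Proof.
rewrite nbhsE => -[_ [[V oV <-] Vh0] VP].
have /nbhs_ballP[e /= e0 eV] : nbhs (set_val h0) V by apply: open_nbhs_nbhs; split.
case E : (set_val h0) => [[q0 t0] a0].
have Hh0 : H_set (q0, t0, a0) by rewrite -E; exact: set_val_mem.
have [d d0 dP] := H_set_near Hh0 e0.
have q0E : q0 = set_val (H_proj h0) by rewrite -[RHS]/((set_val h0).1.1) E.
have m0 : 0 < Num.min d e by rewrite lt_min d0.
rewrite nbhsE; exists (set_val @^-1` ball q0 (Num.min d e)).
  split; last by rewrite /= q0E; exact: ballxx.
  by exists (ball q0 (Num.min d e)) => //; exact: ball_open.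
move=> y /= qy; have := set_val_mem y; rewrite /unit_itv /= in_itv /= => y01.
move: qy; rewrite -ball_normE /= lt_min => /andP[qy qye].
have [t [a [Hyta te ae]]] := dP _ y01 qy.
exists (exist _ (set_val y, t, a) (mem_set Hyta)); last by apply: val_inj.
apply: VP; apply: eV; rewrite E; split; last by rewrite /= -ball_normE.
by split; rewrite /= -ball_normE.
Qed.

End Openness.

(** * Evaluation in degree 0 on the fibres *)

Section FiberLower.
Context {R : realType} (y : Yspace R).
Context {B : cstarAlgType R} (iotaB : (int -> set_type (H_fiber y) -> cplx R) -> B).
Hypothesis hB : is_crossed_product (Theta_fiber y) iotaB.

(** Over [q = 1] the two domains coincide, so each point is fixed or isolated. Over [q < 1] the
    orbit is the line [a = q^k sqrt(q^(-j))] with [0 <= k <= j]: by the factorizations it stops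
    forwards where [q a^2 = t], at [k = j], and backwards where [a^2 / q = 1/t], at [k = 0]. *)
Lemma fiber_lower x h : cp_alg (Theta_fiber y) x -> cabs (x 0 h) <= rnorm (iotaB x).
Proof.
move=> xA; case E : (set_val (set_val h)) => [[q t] a].
have Hh : H_set (q, t, a) by rewrite -E; exact: set_val_mem.
have yq : set_val y = q.
  have <- : H_proj (set_val h) = y by exact: (set_val_mem h).
  by rewrite -[LHS]/((set_val (set_val h)).1.1) E.
have fwdE h1 h2 : pa_fwd (Theta_fiber y) h1 = Some h2 <->
    theta_fwd (set_val h1) = Some (set_val h2) by exact: res_mapE.
have bwdE h1 h2 : pa_bwd (Theta_fiber y) h1 = Some h2 <->
    theta_bwd (set_val h1) = Some (set_val h2) by exact: res_mapE.
have [q0 t0 a0] := H_pos Hh; rewrite /= in q0 t0 a0.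
have fwdN h1 : H_fwd_fun (set_val (set_val h1)) = 0 -> pa_fwd (Theta_fiber y) h1 = None.
  move=> F0; case E' : (pa_fwd _ _) => [h2|//]; move/fwdE/theta_fwdP: E' => [].
  by rewrite /H1 /= F0 eqxx.
have bwdN h1 : H_bwd_fun (set_val (set_val h1)) = 0 -> pa_bwd (Theta_fiber y) h1 = None.
  move=> F0; case E' : (pa_bwd _ _) => [h2|//]; move/bwdE/theta_bwdP: E' => [].
  by rewrite /Hm1 /= F0 eqxx.
have [q1|qn1] := eqVneq q 1.
  have FB : H_fwd_fun (set_val (set_val h)) = H_bwd_fun (set_val (set_val h)).
    by rewrite E /= q1 invr1.
  have [F0|F0] := eqVneq (H_fwd_fun (set_val (set_val h))) 0.
    by apply: (lower_isolated hB xA); [exact: fwdN|apply: bwdN; rewrite -FB].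
  apply: (lower_fixed hB xA); apply/fwdE/theta_fwdP; split=> //.
  by rewrite E /= q1 mul1r.
have [_ q1 [i [j [ij tE aE]]]] := (HsetP _ _ qn1).1 Hh.
have mem k : (k <= j)%N -> H_set (q, t, q ^+ k * Num.sqrt (q ^- j)).
  by move=> kj; apply/HsetP => //; split=> //; exists k, j.
pose pt k (kj : (k <= j)%N) : Hspace R := exist _ (_, _, _) (mem_set (mem k kj)).
have ptF k kj : H_fiber y (@pt k kj) by apply: val_inj; exact: (esym yq).
(* The value [h] beyond [j] is a dummy: only the points with [k <= j] are visited. *)
pose p k : set_type (H_fiber y) :=
  if pselect ((k <= j)%N) is left kj then exist _ (pt k kj) (mem_set (@ptF k kj)) else h.
have pE k : (k <= j)%N -> set_val (set_val (p k)) = (q, t, q ^+ k * Num.sqrt (q ^- j)).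
  by move=> kj; rewrite /p; case: pselect.
have qj : 0 < q ^+ j by rewrite exprn_gt0.
have sqE : Num.sqrt (q ^- j) ^+ 2 = (q ^+ j)^-1 by rewrite sqr_sqrtr// invr_ge0 ltW.
have s0 : 0 < Num.sqrt (q ^- j) by rewrite sqrtr_gt0 invr_gt0.
have hp : h = p i by do 2!apply: val_inj; rewrite -!set_valE E pE// aE.
rewrite hp; apply: (lower_line hB (j := j)) => //.
(* For [k < j] one has [t < q a^2 < 1/t], so no factor of the domain function vanishes. *)
- move=> k kj; apply/fwdE/theta_fwdP; rewrite /H1 /= pE ?(ltnW kj)// pE//; split; last first.
    by rewrite /= mulrA exprS.
  have a0' : 0 < q ^+ k * Num.sqrt (q ^- j) by rewrite mulr_gt0 ?exprn_gt0.
  have aE2 : q * (q ^+ k * Num.sqrt (q ^- j)) ^+ 2 = q * ((q ^+ k) ^+ 2 / q ^+ j).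
    by rewrite exprMn sqE.
  have qkj : q ^+ j < q ^+ k by rewrite ltr_iXn2l.
  have h1 : t < q * ((q ^+ k) ^+ 2 / q ^+ j).
    rewrite tE exprS ltr_pM2l// ltr_pdivlMr// -expr2.
    by rewrite ltr_pXn2r ?nnegrE ?exprn_ge0 ?(ltW q0).
  have h2 : q * ((q ^+ k) ^+ 2 / q ^+ j) < t^-1.
    rewrite -(ltr_pM2l t0) divff ?gt_eqF// tE exprS.
    have -> : q * q ^+ j * (q * ((q ^+ k) ^+ 2 / q ^+ j)) = (q * q ^+ k) ^+ 2.
      by field; rewrite gt_eqF.
    by rewrite -exprS -exprM exprn_ilt1 ?(ltW q0).
  rewrite /= (H_fwd_factor (lt0r_neq0 q0) (lt0r_neq0 t0) (lt0r_neq0 a0')) aE2.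
  have A0 : 0 < q * ((q ^+ k) ^+ 2 / q ^+ j) by rewrite mulr_gt0// divr_gt0 ?exprn_gt0.
  by rewrite !mulf_neq0 ?invr_neq0 ?oppr_eq0 ?subr_eq0 ?(gt_eqF h1) ?(lt_eqF h2) ?(gt_eqF A0).
- have a0' : 0 < q ^+ j * Num.sqrt (q ^- j) by rewrite mulr_gt0.
  apply: fwdN; rewrite pE//= (H_fwd_factor (lt0r_neq0 q0) (lt0r_neq0 t0) (lt0r_neq0 a0')).
  rewrite exprMn sqE tE [q ^+ j.+1]exprS.
  have -> : q * ((q ^+ j) ^+ 2 / q ^+ j) = q * q ^+ j by field; rewrite gt_eqF.
  by rewrite subrr oppr0 !mul0r.
- have a0' : 0 < q ^+ 0 * Num.sqrt (q ^- j) by rewrite mulr_gt0.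
  apply: bwdN; rewrite pE//= (H_bwd_factor (lt0r_neq0 q0) (lt0r_neq0 t0) (lt0r_neq0 a0')).
  rewrite expr0 mul1r sqE tE [q ^+ j.+1]exprS invfM.
  by rewrite subrr mulr0 mul0r.
Qed.

End FiberLower.

(** * The norm of a fibre *)

(** With [r = e / s] and [M = 2^n], Bernoulli and one squaring give [(1 + r)^(2 M) >= (1 + M r)^2],
    which is quadratic in [M] and passes the linear factor [4 M K + 1] as soon as [M r^2 > 4 K]. *)
Lemma growth_gap (R : realType) (s e : R) K : 0 <= s -> 0 < e ->
  exists n, (2 ^ n.+1 * K + 2 ^ n.+1 * K).+1%:R * s ^+ (2 ^ n.+1) < (s + e) ^+ (2 ^ n.+1).
Proof.
move=> s0 e0; have [->|sn0] := eqVneq s 0.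
  by exists 0%N; rewrite add0r expr0n mulr0 exprn_gt0.
have sp : 0 < s by rewrite lt_neqAle eq_sym sn0.
pose r := e / s; have r0 : 0 < r by rewrite divr_gt0.
pose n := Num.truncn (4 * K%:R / r ^+ 2); exists n.
have nP : 4 * K%:R < (2 ^ n)%:R * r ^+ 2.
  rewrite -ltr_pdivrMr ?exprn_gt0//; apply: lt_le_trans (Num.Theory.truncnS_gt _) _.
  by rewrite ler_nat ltn_expl.
have -> : s + e = s * (1 + r) by rewrite /r; field.
rewrite exprMn mulrC ltr_pM2l ?exprn_gt0// expnSr exprM.
have bern M : 1 + M%:R * r <= (1 + r) ^+ M.
  elim: M => [|M ih]; first by rewrite mul0r addr0.
  have r1 : 0 <= 1 + r by rewrite addr_ge0 ?ltW.
  rewrite exprS; have := ler_wpM2l r1 ih; rewrite -natr1.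
  have : 0 <= M%:R * r ^+ 2 by rewrite mulr_ge0 ?sqr_ge0.
  by move: (M%:R) ((1 + r) ^+ M) => m t; nra.
have := bern (2 ^ n)%N; move: nP; have : (0 : R) < (2 ^ n)%:R by rewrite ltr0n expn_gt0.
have -> : (2 ^ n * 2 * K + 2 ^ n * 2 * K).+1%:R = 4 * (2 ^ n)%:R * K%:R + 1 :> R.
  by rewrite -[_.+1%:R]natr1 natrD !natrM; ring.
move: ((2 ^ n)%:R) ((1 + r) ^+ _) (K%:R : R) => M t k M0 h1 h2.
have Mr : 0 < M * r by rewrite mulr_gt0.
have : (1 + M * r) ^+ 2 <= t ^+ 2 by rewrite ler_pXn2r ?nnegrE ?addr_ge0 ?(ltW Mr)// (le_trans _ h2)// addr_ge0 ?(ltW Mr).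
apply: lt_le_trans; have := ltr_pM2l M0 (4 * k) (M * r ^+ 2); rewrite h1 => h3.
nra.
Qed.

Lemma clamp_cts (R : realType) (T : topologicalType) (v : T -> R) (c : R) :
  continuous v -> continuous (fun y => Num.min 1 (v y / c)).
Proof.
move=> vc y; apply: (@continuous_min R T (fun=> 1) (fun y => v y / c) y); first exact: cvg_cst.
by apply: cvgM; [exact: vc|exact: cvg_cst].
Qed.

Lemma trapezoid_cts (R : realType) (T : topologicalType) (v : T -> R) (x d : R) :
  continuous v -> continuous (fun y => Num.max 0 (Num.min 1 (2 - 2 * `|x - v y| / d))).
Proof.
move=> vc y.
apply: (@continuous_max R T (fun=> 0) (fun y => Num.min 1 (2 - 2 * `|x - v y| / d)) y).
  exact: cvg_cst.
apply: (@continuous_min R T (fun=> 1) (fun y => 2 - 2 * `|x - v y| / d) y); first exact: cvg_cst.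
apply: cvgB; first exact: cvg_cst.
apply: cvgM; last exact: cvg_cst.
apply: cvgM; first exact: cvg_cst.
by apply: cvg_norm; apply: cvgB; [exact: cvg_cst|exact: vc].
Qed.

(** * Bounded functions and cut-offs on the base *)

Section Functions.
Context {R : realType}.
Local Notation Y := (Yspace R).
Implicit Types (f g : Y -> cplx R) (r : Y -> R).

(** Larger than [C_0], so as to include constants and every [plateau]. *)
Definition bounded_cts f := continuous f /\ exists c : R, forall y, cabs (f y) <= c.

Definition pullF f : Hspace R -> cplx R := f \o (@H_proj R).

Lemma invariant_pull f : bounded_cts f -> invariant_fun (@Theta R) (pullF f).
Proof.
move=> [fc [c fb]]; split.
- by move=> h; apply: continuous_comp; [exact: H_proj_cts|exact: fc].
- by exists c => h; exact: fb.
- move=> h h' /theta_fwdP[_ E]; rewrite /pullF /=; congr f; apply: val_inj => /=.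
  by rewrite E; case: (set_val h) => [[]].
Qed.

Lemma C0_bounded_cts f : C0 R Y f -> bounded_cts f.
Proof. by move=> f0; split; [exact: C0_cts|have [M _ fM] := C0_bounded f0; exists M]. Qed.

Lemma real_bounded_cts r c : continuous r -> (forall y, `|r y| <= c) ->
  bounded_cts (fun y => (r y)%:C%C).
Proof. by move=> rc rb; split; [exact: real_cts|exists c => y; rewrite cabs_real]. Qed.

Lemma Yval_cts : continuous (fun y : Y => set_val y : R).
Proof. exact: set_val_cts. Qed.

Lemma Yval_itv (y : Y) : 0 < (set_val y : R) <= 1.
Proof. by have := set_val_mem y; rewrite /unit_itv /= in_itv. Qed.

Lemma Yval_C0 : C0 R Y (fun y => (set_val y : R)%:C%C).
Proof.
apply: C0_intro; first exact: (real_cts Yval_cts).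
move=> e e0; exists (set_val @^-1` `[e, 1]%classic).
  apply: compact_set_val; first exact: segment_compact.
  move=> y /=; rewrite /unit_itv /= !in_itv /= => /andP[ey ->].
  by rewrite (lt_le_trans e0 ey).
move=> y; have /andP[y0 y1] := Yval_itv y.
by rewrite cabs_real ger0_norm ?(ltW y0)//= in_itv /= y1 andbT.
Qed.

(** As [c] tends to 0 these form an approximate unit of [C_0((0,1])]. *)
Definition chi (c : R) (y : Y) : R := Num.min 1 (set_val y / c).

Lemma chi_cts c : continuous (chi c).
Proof.
exact: clamp_cts Yval_cts.
Qed.

Lemma chi_itv c y : 0 < c -> 0 <= chi c y <= 1.
Proof.
move=> c0; have /andP[y0 _] := Yval_itv y.
by rewrite /chi ge_min lexx andbT le_min ler01 /= divr_ge0 ?(ltW c0) ?(ltW y0).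
Qed.

Lemma chi1 c y : 0 < c -> c <= set_val y -> chi c y = 1.
Proof. by move=> c0 cy; apply/min_idPl; rewrite ler_pdivlMr// mul1r. Qed.

Lemma chi_C0 c : 0 < c -> C0 R Y (fun y => (chi c y)%:C%C).
Proof.
move=> c0; apply: (C0_dominated (c := c^-1) Yval_C0); first exact: (real_cts (@chi_cts c)).
move=> y; have /andP[p0 p1] := chi_itv y c0; have /andP[y0 _] := Yval_itv y.
rewrite !cabs_real !ger0_norm ?(ltW y0)//.
by rewrite /chi ge_min mulrC lexx orbT.
Qed.

(** The flat top lets one cut-off serve all fibres close to [q] in [pi_usc]. *)
Definition plateau (d : R) (q y : Y) : R :=
  Num.max 0 (Num.min 1 (2 - 2 * `|set_val q - set_val y| / d)).

Lemma plateau_cts d q : continuous (plateau d q).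
Proof.
exact: trapezoid_cts Yval_cts.
Qed.

Lemma plateau_itv d q y : 0 <= plateau d q y <= 1.
Proof. by rewrite /plateau le_max lexx ge_max ler01 ge_min lexx. Qed.

Lemma plateau1 d q y : 0 < d -> `|set_val q - set_val y| < d / 2 -> plateau d q y = 1.
Proof.
move=> d0 h; rewrite /plateau (min_idPl _) ?(max_idPr _)//.
by rewrite lerBrDr -lerBrDl ler_pdivrMr//; lra.
Qed.

Lemma plateau0 d q y : 0 < d -> d <= `|set_val q - set_val y| -> plateau d q y = 0.
Proof.
move=> d0 h; apply/max_idPl; rewrite ge_min; apply/orP; right.
by rewrite subr_le0 ler_pdivlMr//; lra.
Qed.

End Functions.

Section WseqMulF.
Context {R : realType} {X : topologicalType} (Th : partial_aut X).
Hypothesis hausX : hausdorff_space X.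

Lemma invariant_rX (r : X -> R) n : invariant_fun Th (fun h => (r h)%:C%C) ->
  invariant_fun Th (fun h => (r h ^+ n)%:C%C).
Proof.
move=> ri; elim: n => [|n ih].
  have -> : (fun h => (r h ^+ 0)%:C%C) = (fun=> 1 : R[i]%C) by apply/funext => h; rewrite expr0 rmorph1.
  exact: invariant_cst.
have -> : (fun h => (r h ^+ n.+1)%:C%C) = fun_mul (fun h => (r h)%:C%C) (fun h => (r h ^+ n)%:C%C).
  by apply/funext => h; rewrite /fun_mul -rmorphM/= exprS.
exact: invariantM.
Qed.

(** Each step multiplies the real factor by its conjugate, that is, squares it. *)
Lemma wseq_mulF (r : X -> R) x n : invariant_fun Th (fun h => (r h)%:C%C) -> cp_alg Th x ->
  wseq Th (mulF (fun h => (r h)%:C%C) x) n = mulF (fun h => (r h ^+ (2 ^ n))%:C%C) (wseq Th x n).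
Proof.
move=> ri xA; elim: n => [|n ih].
  by congr mulF; apply/funext => h; rewrite expr1.
have rni := invariant_rX (2 ^ n) ri; have wA := cp_alg_wseq hausX n xA.
rewrite !wseqS ih (mulF_star _ rni) (mulF_mul _ _ (invariant_star rni) wA).
congr mulF; apply/funext => h; rewrite /fun_mul /fun_star conj_real -rmorphM/=.
by rewrite expnSr exprM expr2.
Qed.

Lemma sqsum_mulF (r : X -> R) x h : (exists K, forall k, (K < `|k|)%N -> x k = 0) ->
  sqsum (mulF (fun h => (r h)%:C%C) x) h = r h ^+ 2 * sqsum x h.
Proof.
move=> [K xK]; rewrite /sqsum !(zsum_intw (K := K)).
- rewrite mulr_sumr; apply: eq_bigr => k _.
  by rewrite /mulF cabsM exprMn cabs_real real_normK ?num_real.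
- by move=> k /xK ->; rewrite cabs0 expr0n.
- by move=> k /xK xk; rewrite /mulF xk mulr0 cabs0 expr0n.
Qed.

End WseqMulF.

Lemma restr_wseq (R : realType) (X : topologicalType) (Th : partial_aut X) (S : set X)
    (invS : forall x y, pa_fwd Th x = Some y -> (S x <-> S y)) (x : int -> X -> cplx R) n :
  restr (S := S) (wseq Th x n) = wseq (pa_restrict invS) (restr (S := S) x) n.
Proof. by elim: n => // n ih; rewrite !wseqS -ih -restr_star -restr_mul. Qed.

Section HomFacts.
Context {R : realType} {A B : cstarAlgType R} (f : A -> B).
Hypothesis fH : cstar_hom f.

Lemma cstar_homD a b : f (a + b) = f a + f b.
Proof. by have [/(_ 1 a b I I) + _ _] := fH; rewrite !scale1r. Qed.

Lemma cstar_hom0 : f 0 = 0.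
Proof. by apply: (addrI (f 0)); rewrite -cstar_homD !addr0. Qed.

Lemma cstar_homZ (z : R[i]%C) a : f (z *: a) = z *: f a.
Proof. by have [/(_ z a 0 I I) + _ _] := fH; rewrite cstar_hom0 !addr0. Qed.

Lemma cstar_homB a b : f (a - b) = f a - f b.
Proof. by rewrite cstar_homD -scaleN1r cstar_homZ scaleN1r. Qed.

Lemma cstar_hom_rlim u a : rlim u a -> rlim (fun n => f (u n)) (f a).
Proof.
move=> ua e e0; apply: (rlim_lip (c := 1)) ua _ e0 => x y.
by rewrite mul1r -cstar_homB cstar_hom_norm.
Qed.

End HomFacts.

Section QuotientNorm.
Context {R : realType} {A : cstarAlgType R} (I : set A).

Lemma quotient_norm_le a i : I i -> quotient_norm I a <= rnorm (a - i).
Proof.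
move=> Ii; apply: ge_inf; last by exists i.
by exists 0 => _ [j _ <-]; exact: rnorm_ge0.
Qed.

Lemma quotient_norm_ge a c : I !=set0 -> (forall i, I i -> c <= rnorm (a - i)) ->
  c <= quotient_norm I a.
Proof.
move=> [j Ij] h; apply: lb_le_inf; first by exists (rnorm (a - j)), j.
by move=> _ [i Ii <-]; exact: h.
Qed.

Lemma quotient_norm_approx a e : I !=set0 -> 0 < e ->
  exists2 i, I i & rnorm (a - i) < quotient_norm I a + e.
Proof.
move=> [j Ij] e0; have [|_ [i Ii <-] h] := @inf_adherent _ [set rnorm (a - i) | i in I] e e0.
  by split; [exists (rnorm (a - j)), j|exists 0 => _ [i _ <-]; exact: rnorm_ge0].
by exists i.
Qed.

End QuotientNorm.

(** * The action of functions of q and the norm modulo a fibre ideal *)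

Section Field.
Context {R : realType} {A : cstarAlgType R} (iota : (int -> Hspace R -> cplx R) -> A).
Hypothesis hA : is_crossed_product (@Theta R) iota.
Local Notation Th := (@Theta R).
Local Notation Y := (Yspace R).
Implicit Types (f g : Y -> cplx R) (x : int -> Hspace R -> cplx R) (a b : A) (q : Y).

Let hausH := @Hspace_hausdorff R.
Let iH : is_cp_hom Th iota := proj1 hA.

Definition base_act f : A -> A := mact Th iota (pullF f).
Local Notation T := base_act.

Definition base_mult f : (A -> A) * (A -> A) := (T f, T f).
Local Notation m := base_mult.

Lemma base_act_iota f x : bounded_cts f -> cp_alg Th x ->
  T f (iota x) = iota (mulF (pullF f) x).
Proof. by move=> /invariant_pull fi xA; exact: mact_iota. Qed.

Lemma base_act_lin f (z : R[i]%C) a b : bounded_cts f -> T f (z *: a + b) = z *: T f a + T f b.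
Proof. by move=> /invariant_pull fi; exact: mact_lin. Qed.

Lemma base_actB f a b : bounded_cts f -> T f (a - b) = T f a - T f b.
Proof.
move=> fi; have := base_act_lin (-1) b a fi.
by rewrite !scaleN1r !(addrC (- _)).
Qed.

Lemma base_actM f g a : bounded_cts f -> bounded_cts g -> T (fun_mul f g) a = T f (T g a).
Proof. by move=> /invariant_pull fi /invariant_pull gi; exact: mact_comp. Qed.

Lemma base_act_linf f g (z : R[i]%C) a : bounded_cts f -> bounded_cts g ->
  T (z *: f + g) a = z *: T f a + T g a.
Proof. by move=> /invariant_pull fi /invariant_pull gi; exact: (mact_linF hausH hA z a fi gi). Qed.

Lemma base_act1 a : T (fun=> 1) a = a.
Proof. exact: (mact1 hausH hA a). Qed.

Lemma base_act_le f a (c : R) : bounded_cts f -> 0 <= c -> (forall y, cabs (f y) <= c) ->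
  rnorm (T f a) <= c * rnorm a.
Proof. by move=> /invariant_pull fi c0 fc; apply: mact_le => // h; exact: fc. Qed.

Lemma base_actBf f g a : bounded_cts f -> bounded_cts g -> T (f - g) a = T f a - T g a.
Proof.
move=> fi gi; have := base_act_linf (-1) a gi fi.
by rewrite !scaleN1r !(addrC (- _)).
Qed.

Lemma bounded_ctsB f g : bounded_cts f -> bounded_cts g -> bounded_cts (f - g).
Proof.
move=> [fc [c fb]] [gc [d gb]]; split.
  by move=> y; apply: continuousB; [exact: fc|exact: gc].
by exists (c + d) => y; rewrite (le_trans (cabsD _ _))// cabsN lerD.
Qed.

Lemma bounded_ctsM f g : bounded_cts f -> bounded_cts g -> bounded_cts (fun_mul f g).
Proof.
move=> [fc [c fb]] [gc [d gb]]; split.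
  by move=> y; apply: (@continuousM R[i]%C Y f g y); [exact: fc|exact: gc].
by exists (c * d) => y; rewrite /fun_mul cabsM ler_pM ?cabs_ge0.
Qed.

Lemma bounded_cts1 : bounded_cts (fun=> 1 : cplx R).
Proof. by split; [exact: cst_continuous|exists 1 => y; rewrite cabs1]. Qed.

Lemma C0_away (s : seq int) x (d : R) : (forall k, C0 R (Hspace R) (x k)) -> 0 < d ->
  exists2 c : R, 0 < c & forall k, k \in s -> forall h, d <= cabs (x k h) -> c <= Hq h.
Proof.
move=> x0 d0; elim: s => [|k s [c c0 ih]]; first by exists 1.
have Hqpos (h : Hspace R) : 0 < Hq h by have [] := H_pos (set_val_mem h).
have [c' c'0 h'] := compact_pos_lower (C0_compact (x0 k) d0) (@Hq_cts R) Hqpos.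
exists (Num.min c c'); first by rewrite lt_min c0.
move=> l; rewrite inE => /predU1P[->|ls] h dh; rewrite ge_min.
  by rewrite h' ?orbT.
by rewrite (ih l).
Qed.

(** A coefficient exceeds [d] only on a compact set, hence over [q >= c0], where [chi c = 1]. The
    factor [2 K + 1] in [d] pays for the number of coefficients. *)
Lemma chi_approx x (e : R) : cp_alg Th x -> 0 < e -> exists2 c0 : R, 0 < c0 &
  forall c, 0 < c -> c <= c0 -> rnorm (iota x - T (fun y => (chi c y)%:C%C) (iota x)) <= e.
Proof.
move=> xA e0; have [K xK] := cp_supp xA.
pose d := e / (K + K).+1%:R; have d0 : 0 < d by rewrite divr_gt0.
have xC0 k : C0 R (Hspace R) (x k) by exact: C0_dom_C0 (cp_alg_dom k xA).
have [c0 c00 c0P] := C0_away (intw K) xC0 d0.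
exists c0 => // c cp cc0; have chib := C0_bounded_cts (chi_C0 cp).
have cA := cp_alg_mulF (invariant_pull chib) xA.
have nA := cp_algN cA.
rewrite base_act_iota// -(cp_homN iH)// -(cp_homD iH)//.
have -> : e = (K + K).+1%:R * d by rewrite /d mulrC divfK ?gt_eqF.
apply: (cp_hom_le hausH iH); [exact: cp_algD| |exact: ltW|].
  move=> k /xK E; rewrite -[LHS]/(x k - mulF _ x k) E sub0r; apply/funext => h.
  by rewrite -[LHS]/(- (_ * x k h)) E mulr0 oppr0.
move=> k h; rewrite -[X in cabs X]/(x k h - (chi c (H_proj h))%:C%C * x k h).
have [kK|Kk] := leqP `|k| K; last by rewrite xK// mulr0 subr0 cabs0 ltW.
have -> : x k h - (chi c (H_proj h))%:C%C * x k h = (1 - chi c (H_proj h))%:C%C * x k h :> R[i]%C.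
  by rewrite rmorphB/= mulrBl mul1r.
have /andP[p0 p1] := chi_itv (H_proj h) cp.
rewrite cabsM cabs_real ger0_norm ?subr_ge0//.
have [dx|/ltW xd] := leP d (cabs (x k h)).
  rewrite chi1 ?subrr ?mul0r ?(ltW d0)//; apply: le_trans cc0 _.
  by apply: c0P dx; rewrite mem_intw.
by rewrite (le_trans _ xd)// ler_piMl ?cabs_ge0// gerBl.
Qed.

Section Fiber.
Context (q : Y) {B : cstarAlgType R} (iotaB : (int -> set_type (H_fiber q) -> cplx R) -> B).
Hypothesis hB : is_crossed_product (Theta_fiber q) iotaB.
Context (pi : A -> B).
Hypothesis piH : cstar_hom pi.
Hypothesis piE : forall x, cp_alg Th x -> pi (iota x) = iotaB (cp_restrict x).
Let iHB : is_cp_hom (Theta_fiber q) iotaB := proj1 hB.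
Let clF := @H_fiber_closed R q.
Let hausF := @Hfiber_hausdorff R q.

Lemma pi_base_act f a : bounded_cts f -> pi (T f a) = f q *: pi a.
Proof.
move=> fb; have fi := invariant_pull fb; have [u uA ua] := crossed_product_seq hausH hA a.
apply: (rlim_uniq (cstar_hom_rlim piH (mact_rlim hausH hA fi ua))).
apply: rlim_ext (rlimZ (f q) (cstar_hom_rlim piH ua)) => n.
have FA := cp_alg_mulF fi (uA n).
rewrite /= (mact_iota hausH hA)// !piE// -(cp_homZ iHB); last exact: (cp_alg_restr (@H_fiber_inv R q) clF (uA n)).
congr iotaB; apply/funext => k; apply/funext => h.
by rewrite /cp_restrict /mulF /pullF /= (set_val_mem h : H_proj _ = q).
Qed.

(** [sqsum] of [w_n] is the degree-0 coefficient of [w_(n+1)], which [fiber_lower] bounds by its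
    norm; hence the exponent [2^(n+1)]. *)
Lemma fiber_sqsum x n h : cp_alg Th x -> H_proj h = q ->
  sqsum (wseq Th x n) h <= rnorm (pi (iota x)) ^+ (2 ^ n.+1).
Proof.
move=> xA hq; pose h' : set_type (H_fiber q) := exist _ h (mem_set hq).
have rA : cp_alg (Theta_fiber q) (cp_restrict (q := q) x).
  exact: (cp_alg_restr (@H_fiber_inv R q) clF xA).
rewrite piE// -(rnorm_wseq hausF iHB)//.
have := fiber_lower hB h' (cp_alg_wseq hausF n.+1 rA).
rewrite -(restr_wseq (@H_fiber_inv R q) x n.+1) /restr wseqS cp_star_mul0; last exact: cp_alg_wseq.
by rewrite cabs_real ger0_norm ?sqsum_ge0.
Qed.

(* After the cut-off the growth estimate only sees sqsum near the fibre, where it is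
   controlled by its values on the fibre because its level sets are compact. *)
Lemma localized_norm x (e : R) : cp_alg Th x -> 0 < e -> exists2 d : R, 0 < d &
  rnorm (T (fun y => (plateau d q y)%:C%C) (iota x)) <= rnorm (pi (iota x)) + e.
Proof.
move=> xA e0; have [K xK] := cp_supp xA.
set s := rnorm (pi (iota x)); have s0 : 0 <= s := rnorm_ge0 _.
have [n] := growth_gap K s0 e0; set N := (2 ^ n.+1)%N; set C := (_.+1%:R) => gap.
have Cpos : 0 < C by rewrite /C ltr0n.
(* With [C M = (s + e)^N] the growth estimate will end in [s + e]. The gap means [s^N < M], so the
   compact set where [|g| >= M] misses the fibre over [q], and so its projection misses a
   neighbourhood of [q]. *)
pose M := (s + e) ^+ N / C.
have sM : s ^+ N < M by rewrite /M ltr_pdivlMr// mulrC.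
have M0 : 0 < M by apply: le_lt_trans sM; rewrite exprn_ge0.
pose g := wseq Th x n.+1 0; have gC0 : C0 R (Hspace R) g.
  exact: C0_dom_C0 (cp_alg_dom 0 (cp_alg_wseq hausH n.+1 xA)).
have gE h : g h = (sqsum (wseq Th x n) h)%:C%C.
  by rewrite /g wseqS cp_star_mul0//; exact: cp_alg_wseq.
pose Kc := [set h | M <= cabs (g h)].
have cK : compact (@H_proj R @` Kc).
  apply: continuous_compact; last exact: C0_compact.
  by apply: continuous_subspaceT; exact: H_proj_cts.
have nq : nbhs q (~` (@H_proj R @` Kc)).
  apply: open_nbhs_nbhs; split.
    by apply: closed_openC; apply: compact_closed => //; exact: Yspace_hausdorff.
  move=> [h Mh hq]; move: (Mh : M <= cabs (g h)); rewrite gE cabs_real ger0_norm ?sqsum_ge0// leNgt.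
  by rewrite (le_lt_trans (fiber_sqsum n xA hq)).
have [d d0 dP] : exists2 d : R, 0 < d &
    forall y : Y, `|set_val q - set_val y| < d -> (~` (@H_proj R @` Kc)) y.
  move: nq; rewrite nbhsE => -[_ [[V oV <-] Vq] VK].
  have /nbhs_ballP[d /= d0 dV] : nbhs (set_val q : R) V by apply: open_nbhs_nbhs; split.
  by exists d => // y qy; apply: VK; apply: dV; rewrite -ball_normE.
exists d => //; pose r h := plateau d q (H_proj h).
have rb : bounded_cts (fun y => (plateau d q y)%:C%C : cplx R).
  apply: (real_bounded_cts (c := 1)); first exact: plateau_cts.
  by move=> y; have /andP[p0 p1] := plateau_itv d q y; rewrite ger0_norm.
have ri := invariant_pull rb.
have FA := cp_alg_mulF ri xA.
have FK k : (K < `|k|)%N -> mulF (pullF (fun y => (plateau d q y)%:C%C)) x k = 0.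
  by move=> /xK E; apply/funext => h; rewrite /mulF E mulr0.
have bound h : sqsum (wseq Th (mulF (pullF (fun y => (plateau d q y)%:C%C)) x) n) h <= M.
  rewrite (wseq_mulF hausH (r := r) n ri xA) sqsum_mulF; last first.
    exact: cp_supp (cp_alg_wseq hausH n xA).
  have /andP[p0 p1] := plateau_itv d q (H_proj h).
  have [dh|hd] := leP d `|set_val q - set_val (H_proj h)|.
    by rewrite /r plateau0// expr0n expn_eq0 /= expr0n mul0r ltW.
  have : ~ M <= cabs (g h) by move=> ?; apply: (dP _ hd); exists h.
  move/negP; rewrite -ltNge gE cabs_real ger0_norm ?sqsum_ge0// => /ltW; apply: le_trans.
  by rewrite ler_piMl ?sqsum_ge0// -exprM exprn_ile1.
have := cp_hom_growth hausH iH FA FK (ltW M0) bound.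
rewrite -/N -/C /M mulrCA divff ?gt_eqF// mulr1 base_act_iota// => h.
by rewrite -(@ler_pXn2r _ N) ?nnegrE ?rnorm_ge0 ?addr_ge0 ?(ltW e0)// expn_gt0.
Qed.

Lemma fiber_ideal_ex : fiber_ideal m q !=set0.
Proof.
exists (action m 0 0), 0, 0; split=> //; exact: C0_zero.
Qed.

(** One inequality holds because [pi] contracts and kills the ideal. For the other, subtract
    [X (1 - F) x] from [a], with [F] the plateau of [localized_norm]; the factor [X = chi c] puts
    [X (1 - F)] into [C_0] and changes [x] little. *)
Lemma pi_quotient_norm a : rnorm (pi a) = quotient_norm (fiber_ideal m q) a.
Proof.
apply/eqP; rewrite eq_le; apply/andP; split.
  apply: quotient_norm_ge; first exact: fiber_ideal_ex.
  move=> i [f [b [f0 fq ->]]]; apply: le_trans (cstar_hom_norm piH _).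
  by rewrite cstar_homB// pi_base_act ?fq ?scale0r ?subr0//; exact: C0_bounded_cts.
apply/ler_addgt0Pl => e e0; have e4 : 0 < e / 4 by rewrite divr_gt0.
have [x xA ax] := crossed_product_dense hausH hA a e4.
have [d d0 dP] := localized_norm xA e4.
have [c0 c00 c0P] := chi_approx xA e4.
have /andP[q0 _] := Yval_itv q.
pose c := Num.min c0 (set_val q).
have cp : 0 < c by rewrite lt_min c00.
have cc0 : c <= c0 by rewrite ge_min lexx.
have cq : c <= set_val q by rewrite ge_min lexx orbT.
pose X : Y -> cplx R := fun y => (chi c y)%:C%C.
pose F : Y -> cplx R := fun y => (plateau d q y)%:C%C.
have XC0 : C0 R Y X := chi_C0 cp; have Xb := C0_bounded_cts XC0.
have Fb : bounded_cts F.
  apply: (real_bounded_cts (c := 1)); first exact: plateau_cts.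
  by move=> y; have /andP[p0 p1] := plateau_itv d q y; rewrite ger0_norm.
have XFb := bounded_ctsM Xb Fb.
have iI : fiber_ideal m q (T (X - fun_mul X F) (iota x)).
  exists (X - fun_mul X F), (iota x); split=> //.
    apply: C0D => //; rewrite -scaleN1r; apply: C0Z.
    have -> : fun_mul X F = (fun y => F y * X y) by apply/funext => y; rewrite /fun_mul mulrC.
    have [Fc [cF Fbd]] := Fb; exact: (C0_mulr XC0 Fc Fbd).
  rewrite -[LHS]/(X q - X q * F q) /F plateau1 ?subrr ?normr0 ?divr_gt0// mulr1 subrr//.
apply: le_trans (quotient_norm_le a iI) _.
rewrite base_actBf// base_actM//.
have X1 y : cabs (X y) <= 1.
  by have /andP[p0 p1] := chi_itv y cp; rewrite cabs_real ger0_norm.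
have h2 := base_act_le (T F (iota x)) Xb ler01 X1; rewrite mul1r in h2.
have h1 := c0P c cp cc0; rewrite -/X in h1.
have h3 := cstar_hom_norm piH (iota x - a); rewrite cstar_homB// (rdistC (iota x)) in h3.
have := rdistD (pi (iota x)) (pi a) 0; rewrite !subr0 => h4.
have -> : a - (T X (iota x) - T X (T F (iota x))) =
    (a - iota x) + ((iota x - T X (iota x)) + T X (T F (iota x))).
  by rewrite opprB !addrA subrK addrAC.
have := rnormD (a - iota x) ((iota x - T X (iota x)) + T X (T F (iota x))).
have := rnormD (iota x - T X (iota x)) (T X (T F (iota x))).
rewrite -/F in dP; lra.
Qed.

End Fiber.
End Field.

(** * Cohen factorization *)

Lemma C0_uniform_limit (R : realType) (X : topologicalType) (f : X -> cplx R) :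
  (forall e : R, 0 < e -> exists2 g, C0 R X g & forall x, cabs (f x - g x) <= e) -> C0 R X f.
Proof.
move=> h; apply: C0_intro.
  move=> x; apply/cplx_ctsP => e e0.
  have [|g g0 fg] := h (e / 4); first by rewrite divr_gt0.
  have e4 : 0 < e / 4 by rewrite divr_gt0.
  have /cplx_ctsP/(_ _ e4) := C0_cts g0 (x := x); apply: filterS => y gxy.
  have -> : f x - f y = (f x - g x) + ((g x - g y) - (f y - g y)) :> R[i]%C by ring.
  have := cabsD (f x - g x) ((g x - g y) - (f y - g y)).
  have := cabsD (g x - g y) (- (f y - g y)); rewrite cabsN.
  have := fg x; have := fg y; lra.
move=> e e0; have e2 : 0 < e / 2 by rewrite divr_gt0.
have [g g0 fg] := h _ e2; exists [set x | e / 2 <= cabs (g x)]; first exact: C0_compact.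
move=> x /= ex; have := cabsD (f x - g x) (g x); rewrite subrK; have := fg x; lra.
Qed.

Lemma ratio_cts (R : realType) (X : topologicalType) (u : X -> R) (k : R) :
  continuous u -> (forall x, 0 <= u x) -> 0 < k -> continuous (fun x => u x / (u x + k)).
Proof.
move=> uc u0 k0 x; apply: cvgM; first exact: uc.
have := @continuousV R X (fun x => u x + k) x; apply; first by rewrite gt_eqF// ltr_wpDl.
by apply: cvgD; [exact: uc|exact: cvg_cst].
Qed.

Lemma affine_cts (R : realType) (X : topologicalType) (u v : X -> R) (k : R) :
  continuous u -> continuous v -> continuous (fun x => u x - k * (1 - v x)).
Proof.
move=> uc vc x; apply: cvgB; first exact: uc.
apply: cvgM; first exact: cvg_cst.
by apply: cvgB; [exact: cvg_cst|exact: vc].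
Qed.

Lemma inv_cts (R : realType) (X : topologicalType) (u : X -> R) :
  continuous u -> (forall x, 0 < u x) -> continuous (fun x => (u x)^-1).
Proof.
move=> uc u0 x; have := @continuousV R X u x; apply; first by rewrite gt_eqF.
exact: uc.
Qed.

Lemma cst_bounded_cts (R : realType) (z : R[i]%C) : bounded_cts (fun=> z : cplx R).
Proof. by split; [exact: cst_continuous|exists (cabs z)]. Qed.

Section Cohen.
Context {R : realType} {A : cstarAlgType R} (iota : (int -> Hspace R -> cplx R) -> A).
Hypothesis hA : is_crossed_product (@Theta R) iota.
Local Notation Th := (@Theta R).
Local Notation Y := (Yspace R).
Local Notation T := (base_act iota).
Implicit Types (f g : Y -> cplx R) (a b : A) (q : Y).

Let hausH := @Hspace_hausdorff R.

(** If [f b] is close to [a], take [r = |f| / (|f| + k)]. Then [(1 - r) |f| <= k], so [1 - r] almost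
    kills [f b], and it contracts the remainder [a - f b]. *)
Lemma ideal_approx_unit q a (d : R) : 0 < d ->
  (exists2 i, fiber_ideal (base_mult iota) q i & rnorm (a - i) < d / 2) ->
  exists r : Y -> R, [/\ continuous r, forall y, 0 <= r y <= 1, r q = 0,
    C0 R Y (fun y => (r y)%:C%C) & rnorm (a - T (fun y => (r y)%:C%C) a) <= d].
Proof.
move=> d0 [_ [f [b [f0 fq ->]]]]; rewrite /action /= => afb.
have fc := C0_cts f0; have fb := C0_bounded_cts f0.
have b1 : 0 < rnorm b + 1 by rewrite ltr_wpDl ?rnorm_ge0.
pose k := d / 2 / (rnorm b + 1); have k0 : 0 < k by rewrite !divr_gt0.
have fk y : 0 < cabs (f y) + k by rewrite ltr_wpDl ?cabs_ge0.
pose r y := cabs (f y) / (cabs (f y) + k).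
have r01 y : 0 <= r y <= 1.
  by rewrite /r divr_ge0 ?cabs_ge0 ?(ltW (fk _))//= ler_pdivrMr// mul1r lerDl ltW.
have rc : continuous r by exact: (ratio_cts (cabs_continuous fc) (fun y => cabs_ge0 (f y)) k0).
have rC0 : C0 R Y (fun y => (r y)%:C%C).
  apply: (C0_dominated (c := k^-1) f0); first exact: real_cts.
  move=> y; have /andP[p0 _] := r01 y; rewrite cabs_real ger0_norm// /r mulrC.
  by rewrite ler_wpM2r ?cabs_ge0// lef_pV2 ?posrE// lerDr cabs_ge0.
exists r; split=> //; first by rewrite /r fq cabs0 mul0r.
have rb := C0_bounded_cts rC0; have b1' := @bounded_cts1 R.
pose u : Y -> cplx R := (fun=> 1) - (fun y => (r y)%:C%C).
have ub : bounded_cts u by exact: bounded_ctsB.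
have uE y : u y = (1 - r y)%:C%C by rewrite rmorphB.
have u1 y : cabs (u y) <= 1.
  by have /andP[p0 p1] := r01 y; rewrite uE cabs_real ger0_norm ?subr_ge0// gerBl.
have ufb := bounded_ctsM ub fb.
have ufk y : cabs (fun_mul u f y) <= k.
  have /andP[p0 p1] := r01 y; rewrite /fun_mul uE cabsM cabs_real ger0_norm ?subr_ge0// /r.
  have -> : 1 - cabs (f y) / (cabs (f y) + k) = k / (cabs (f y) + k).
    by field; rewrite gt_eqF ?fk.
  rewrite mulrAC ler_pdivrMr// ler_pM2l// lerDl ltW//.
have E : a - T (fun y => (r y)%:C%C) a = T u (a - T f b) + T (fun_mul u f) b.
  by rewrite (base_actM hA)// (base_actB hA)// subrK (base_actBf hA)// (base_act1 hA).
rewrite E; apply: le_trans (rnormD _ _) _.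
have := base_act_le hA (a - T f b) ub ler01 u1.
have := base_act_le hA b ufb (ltW k0) ufk.
have : k * rnorm b <= d / 2.
  by rewrite /k mulrAC ler_pdivrMr// ler_pM2l ?divr_gt0// lerDl.
lra.
Qed.

Local Notation h := (2^-1 : R).

(* Cohen factorization: a = F c with F = lim phi_n and c = lim phi_n^-1 a, where
   phi_n = 2^-n + sum_(j < n) 2^-(j+1) r_j for approximate units r_j of the ideal. *)
Lemma fiber_ideal_closed q a :
  (forall e : R, 0 < e -> exists2 i, fiber_ideal (base_mult iota) q i & rnorm (a - i) < e) ->
  fiber_ideal (base_mult iota) q a.
Proof.
move=> ha; have h0 : 0 < h by rewrite invr_gt0.
have h01 : 0 <= h < 1 by rewrite ltW//= invf_lt1// ltr1n.
have hS n : h ^+ n = h ^+ n.+1 + h ^+ n.+1 by rewrite exprS; lra.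
have hp n : 0 < h ^+ n by rewrite exprn_gt0.
(* One factor [h ^+ n] of the precision compensates the bound of [V] below, the other leaves a
   geometric series. *)
have /choice[r rP] n : exists r : Y -> R, [/\ continuous r, forall y, 0 <= r y <= 1, r q = 0,
    C0 R Y (fun y => (r y)%:C%C) & rnorm (a - T (fun y => (r y)%:C%C) a) <= h ^+ n * h ^+ n].
  apply: ideal_approx_unit; first by rewrite mulr_gt0.
  by apply: ha; rewrite divr_gt0// mulr_gt0.
pose phi := fix phi n (y : Y) : R :=
  if n is n'.+1 then phi n' y - h ^+ n'.+1 * (1 - r n' y) else 1.
have phiS n y : phi n.+1 y = phi n y - h ^+ n.+1 * (1 - r n y) by [].
have phi_b n y : h ^+ n <= phi n y <= 1.
  elim: n => [|n /andP[p1 p2]]; first by rewrite lexx.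
  have [_ /(_ y)/andP[r0 r1] _ _ _] := rP n; rewrite phiS.
  have := hS n; have := hp n.+1; move: (h ^+ n.+1) => t t0 tE.
  apply/andP; split; nra.
have phip n y : 0 < phi n y by have /andP[+ _] := phi_b n y; exact: lt_le_trans.
have phic n : continuous (phi n).
  elim: n => [|n ih]; first exact: cst_continuous.
  have [rc _ _ _ _] := rP n; exact: affine_cts.
(* Without its constant part [h ^+ n], [phi n] is a combination of the [r j], hence in [C_0]; all
   [r j] vanish at [q], so [phi n q] tends to 0. *)
have phiC0 n : C0 R Y (fun y => (phi n y - h ^+ n)%:C%C) /\ phi n q = h ^+ n.
  elim: n => [|n [ih1 ih2]].
    split=> //; rewrite (_ : (fun y => _) = 0); first exact: C0_zero.
    by apply/funext => y; rewrite /= expr0 subrr.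
  have [_ _ rq rC0 _] := rP n; split; last by rewrite phiS ih2 rq subr0 mulr1 (hS n) addrK.
  rewrite (_ : (fun y => _) = (fun y => (phi n y - h ^+ n)%:C%C) +
      (h ^+ n.+1)%:C%C *: (fun y => (r n y)%:C%C : cplx R)).
    by apply: C0D => //; exact: C0Z.
  apply/funext => y; rewrite -[RHS]/((phi n y - h ^+ n)%:C%C + (h ^+ n.+1)%:C%C * (r n y)%:C%C).
  by rewrite -rmorphM -rmorphD phiS (hS n); congr (_%:C%C); ring.
pose P n : Y -> cplx R := fun y => (phi n y)%:C%C.
pose U n : Y -> cplx R := fun y => ((phi n y)^-1)%:C%C.
have Pb n : bounded_cts (P n).
  by apply: (real_bounded_cts (c := 1)) => // y; have /andP[_ p1] := phi_b n y; rewrite ger0_norm// ltW.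
have Ule n y : (phi n y)^-1 <= (h ^+ n)^-1 by rewrite lef_pV2 ?posrE//; have /andP[] := phi_b n y.
have Ub n : bounded_cts (U n).
  apply: (real_bounded_cts (c := (h ^+ n)^-1)); first exact: inv_cts.
  by move=> y; rewrite ger0_norm ?Ule// invr_ge0 ltW.
pose b n := T (U n) a.
have bstep n : rnorm (b n.+1 - b n) <= 1 * h ^+ n.
  have [rc r01 _ rC0 ra] := rP n; have rb := C0_bounded_cts rC0.
  (* [V] is designed so that [phi_(n+1)^-1 - phi_n^-1 = V (1 - r_n)]. *)
  pose V : Y -> cplx R := fun y => (h ^+ n.+1 * ((phi n y)^-1 * (phi n.+1 y)^-1))%:C%C.
  have Vle y : cabs (V y) <= (h ^+ n)^-1.
    rewrite cabs_real ger0_norm; last by rewrite !mulr_ge0 ?invr_ge0 ?(ltW (phip _ _)) ?(ltW (hp _)).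
    have -> : (h ^+ n)^-1 = h ^+ n.+1 * ((h ^+ n)^-1 * (h ^+ n.+1)^-1).
      by field; rewrite !gt_eqF.
    by rewrite ler_pM2l ?hp// ler_pM ?invr_ge0 ?Ule ?(ltW (phip _ _)).
  have Vb : bounded_cts V.
    have := bounded_ctsM (bounded_ctsM (Ub n) (Ub n.+1)) (cst_bounded_cts (h ^+ n.+1)%:C%C).
    rewrite (_ : fun_mul _ _ = V)//; apply/funext => y.
    by rewrite /fun_mul /U /V -!rmorphM/=; congr (_%:C%C); ring.
  have rr := bounded_ctsM Vb rb.
  have -> : b n.+1 - b n = T V (a - T (fun y => (r n y)%:C%C) a).
    rewrite (base_actB hA)// -(base_actM hA)// -!(base_actBf hA)//; congr (T _ a).
    apply/funext => y; rewrite -[LHS]/(U n.+1 y - U n y) -[RHS]/(V y - V y * (r n y)%:C%C).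
    rewrite /U /V -rmorphM -!rmorphB; congr (_%:C%C); rewrite phiS; field.
    by rewrite -phiS !gt_eqF ?phip.
  apply: le_trans (base_act_le hA _ Vb _ Vle) _; first by rewrite invr_ge0 (ltW (hp n)).
  by rewrite mul1r mulrC ler_pdivrMr.
have [c bc _] := geometric_rlim ler01 h01 bstep.
have phid n k y : `|phi (n + k)%N y - phi n y| <= h ^+ n.
  suff : phi n y - h ^+ n + h ^+ (n + k) <= phi (n + k)%N y <= phi n y.
    by move=> /andP[p1 p2]; rewrite ler_norml; have := hp (n + k)%N; lra.
  elim: k => [|k /andP[p1 p2]]; first by rewrite addn0 subrK !lexx.
  rewrite addnS phiS; have [_ /(_ y)/andP[r0 r1] _ _ _] := rP (n + k)%N.
  have := hS (n + k)%N; have := hp (n + k).+1; move: (h ^+ (n + k).+1) => t t0 tE.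
  apply/andP; split; nra.
have hsmall e : 0 < e -> exists n, h ^+ n < e.
  move=> e0; have [||n nP] := @exprn_small R h (e / 2).
  - by rewrite h0 /=; case/andP: h01.
  - by rewrite divr_gt0.
  by exists n; lra.
have /choice[L LP] y : exists l, forall e : R, 0 < e ->
    exists N, forall n, (N <= n)%N -> `|phi n y - l| < e.
  apply: real_cauchy => e e0; have [|N NP] := hsmall (e / 2); first by rewrite divr_gt0.
  exists N => i j Ni Nj; have := phid N (i - N)%N y; have := phid N (j - N)%N y.
  rewrite !subnKC// => d1 d2; have := ler_distD (phi N y) (phi i y) (phi j y).
  rewrite (distrC (phi N y) (phi j y)); lra.
have Ld n y : `|phi n y - L y| <= h ^+ n.
  apply/ler_addgt0Pl => e /(LP y)[N NP]; have := NP _ (leq_addl n N); have := phid n N y.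
  have := ler_distD (phi (n + N)%N y) (phi n y) (L y); rewrite (distrC (phi n y) (phi (n + N)%N y)); lra.
pose F : Y -> cplx R := fun y => (L y)%:C%C.
have Fd n y : `|L y - (phi n y - h ^+ n)| <= 2 * h ^+ n.
  have -> : L y - (phi n y - h ^+ n) = h ^+ n - (phi n y - L y) by ring.
  apply: le_trans (ler_normB _ _) _; rewrite (ger0_norm (ltW (hp n))).
  by have := Ld n y; lra.
have FC0 : C0 R Y F.
  apply: C0_uniform_limit => e e0; have [|n nP] := hsmall (e / 2); first by rewrite divr_gt0.
  exists (fun y => (phi n y - h ^+ n)%:C%C); first by have [] := phiC0 n.
  by move=> y; rewrite -rmorphB cabs_real; apply: le_trans (Fd n y) _; lra.
have Fb := C0_bounded_cts FC0.
exists F, c; split=> //.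
  suff E : L q = 0 by rewrite /F E.
  apply/eqP; rewrite -normr_eq0 eq_le normr_ge0 andbT; apply/ler_addgt0Pl => e e0.
  have [|n nP] := hsmall (e / 2); first by rewrite divr_gt0.
  have := Fd n q; have [_ ->] := phiC0 n; rewrite subrr subr0; lra.
rewrite /action /=.
apply: (rlim_uniq (rlim_const a)).
have lim1 := mact_rlim hausH hA (invariant_pull Fb) bc.
have lim2 : rlim (fun n => T (P n - F) (b n)) 0.
  move=> e e0; have c1 : 0 < rnorm c + 1 by rewrite ltr_wpDl ?rnorm_ge0.
  have [|n nP] := hsmall (e / (rnorm c + 1)); first by rewrite divr_gt0.
  have [N NP] := bc 1 ltr01; exists (maxn n N) => l; rewrite geq_max => /andP[nl Nl].
  have PF y : cabs ((P l - F) y) <= h ^+ l.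
    by rewrite -[(P l - F) y]/((phi l y)%:C%C - (L y)%:C%C) -rmorphB cabs_real.
  rewrite subr0; apply: le_lt_trans (base_act_le hA _ (bounded_ctsB (Pb l) Fb) (ltW (hp l)) PF) _.
  have hl : h ^+ l <= h ^+ n by rewrite ler_wiXn2l ?ltW//; case/andP: h01.
  have bl : rnorm (b l) <= rnorm c + 1.
    by have := NP l Nl; have := rdistD (b l) c 0; rewrite !subr0; lra.
  rewrite ltr_pdivlMr// in nP; apply: le_lt_trans nP.
  by apply: ler_pM => //; rewrite ?rnorm_ge0// ltW.
(* [P n] applied to [b n] returns [a] for every [n], while [P n] converges uniformly to [F] and
   [b n] to [c]. *)
have := rlimD lim2 lim1; rewrite add0r; apply: rlim_ext => n.
rewrite (base_actBf hA)// -[mact _ _ _ _]/(T F (b n)) subrK /b -(base_actM hA)//.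
rewrite (_ : fun_mul _ _ = fun=> 1) ?(base_act1 hA)//.
by apply/funext => y; rewrite /fun_mul /P /U -rmorphM/= divff ?rmorph1// gt_eqF.
Qed.

End Cohen.

(** * The continuous field *)

Lemma semicontinuous_cts (R : realType) (X : topologicalType) (F : X -> R) :
  (forall x e, 0 < e -> \forall y \near x, F y <= F x + e) ->
  (forall x e, 0 < e -> \forall y \near x, F x - e <= F y) -> continuous F.
Proof.
move=> usc lsc x; apply/cvgrPdist_le => e e0.
have h1 := usc x _ e0; have h2 := lsc x _ e0.
by apply: filterS2 h1 h2 => y u l; rewrite ler_norml; lra.
Qed.

Lemma uniform_limit_cts (R : realType) (X : topologicalType) (F : X -> R) :
  (forall e : R, 0 < e -> exists2 G : X -> R, continuous G & forall x, `|F x - G x| < e) ->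
  continuous F.
Proof.
move=> h x; apply/cvgrPdist_lt => e e0; have e3 : 0 < e / 3 by rewrite divr_gt0.
have [G Gc FG] := h _ e3; have /cvgrPdist_lt/(_ _ e3) := Gc x.
apply: filterS => y; have := FG x; have := FG y; rewrite !ltr_norml; lra.
Qed.

(** * The quotient map onto the crossed product of a fibre *)

Section FiberQuotient.
Context {R : realType} {A : cstarAlgType R} (iota : (int -> Hspace R -> cplx R) -> A).
Hypothesis hA : is_crossed_product (@Theta R) iota.
Local Notation Th := (@Theta R).
Local Notation Y := (Yspace R).
Context (q : Y) {B : cstarAlgType R} (iotaB : (int -> set_type (H_fiber q) -> cplx R) -> B).
Hypothesis hB : is_crossed_product (Theta_fiber q) iotaB.
Context (pi : A -> B).
Hypothesis piH : cstar_hom pi.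
Hypothesis piE : forall x, cp_alg Th x -> pi (iota x) = iotaB (cp_restrict x).
Local Notation I := (fiber_ideal (base_mult iota) q).
Let iHB : is_cp_hom (Theta_fiber q) iotaB := proj1 hB.
Let clF := @H_fiber_closed R q.
Let hausF := @Hfiber_hausdorff R q.

Lemma pi_dense (b : B) (e : R) : 0 < e -> exists a, rnorm (b - pi a) < e.
Proof.
move=> e0; have e2 : 0 < e / 2 by rewrite divr_gt0.
have [y yA by_] := crossed_product_dense hausF hB b e2.
have [K yK] := cp_supp yA.
pose d := e / 2 / (K + K).+1%:R; have d0 : 0 < d by rewrite !divr_gt0.
have /choice[g gP] k : exists g, C0_dom Th k g /\ forall h, cabs (y k h - g (set_val h)) <= d.
  have [g g1 g2] := C0_dom_extension clF (@Hspace_normal R) (@Ht_C0 R) (@Ht_cts R) (@Ht_gt0 R)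
    d0 (cp_alg_dom k yA).
  by exists g.
pose x k := if (`|k| <= K)%N then g k else 0.
have xA : cp_alg Th x.
  apply/cp_algP; split; first by exists K => k; rewrite ltnNge /x => /negPf ->.
  by move=> k; rewrite /x; case: ifP => _; [case: (gP k)|exact: C0_dom0].
have rA : cp_alg (Theta_fiber q) (cp_restrict (q := q) x).
  exact: (cp_alg_restr (@H_fiber_inv R q) clF xA).
exists (iota x); rewrite piE//.
have : rnorm (iotaB y - iotaB (cp_restrict (q := q) x)) <= e / 2.
  have nA := cp_algN rA; rewrite -(cp_homN iHB)// -(cp_homD iHB)//.
  have -> : e / 2 = (K + K).+1%:R * d by rewrite /d [RHS]mulrC divfK ?gt_eqF.
  apply: (cp_hom_le hausF iHB); [exact: cp_algD| |exact: ltW|].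
    move=> k kK; rewrite -[LHS]/(y k - cp_restrict (q := q) x k) yK// sub0r.
    apply/funext => h; rewrite -[LHS]/(- x k (set_val h)) /x leqNgt kK.
    exact: oppr0.
  move=> k h; rewrite -[X in cabs X]/(y k h - x k (set_val h)) /x.
  have [kK|Kk] := leqP `|k| K; first by have [_] := gP k; apply.
  by rewrite yK// subr0 cabs0 ltW.
have := rdistD b (iotaB y) (iotaB (cp_restrict (q := q) x)); lra.
Qed.

(** By [pi_quotient_norm] an approximate preimage can be corrected within the ideal until its norm
    is close to that of its image; this control makes the series in [pi_surjective] converge. *)
Lemma pi_lift (b : B) (e : R) : 0 < e -> exists a, rnorm (b - pi a) < e /\ rnorm a < rnorm b + 2 * e.
Proof.
move=> e0; have [a ab] := pi_dense b e0.
have [i Ii ai] := quotient_norm_approx a (fiber_ideal_ex iota q) e0.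
have pii : pi i = 0.
  have [f [c [f0 fq ->]]] := Ii.
  by rewrite (pi_base_act hA hB piH piE _ (C0_bounded_cts f0)) fq scale0r.
exists (a - i); rewrite (cstar_homB piH) pii subr0; split=> //.
rewrite -(pi_quotient_norm hA hB piH piE) in ai.
have := rdistD (pi a) b 0; rewrite !subr0 (rdistC (pi a)); lra.
Qed.

(** Successive lifting of the residual, as in the open mapping theorem. *)
Lemma pi_surjective (b : B) : exists a, pi a = b.
Proof.
pose h : R := 2^-1; have h0 : 0 < h by rewrite invr_gt0.
have hp n : 0 < h ^+ n by rewrite exprn_gt0.
have /choice[L LP] (cn : B * nat) : exists a,
    rnorm (cn.1 - pi a) < h ^+ cn.2 /\ rnorm a < rnorm cn.1 + 2 * h ^+ cn.2 by exact: pi_lift.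
pose S := fix S n := if n is n'.+1 then S n' + L (b - pi (S n'), n') else 0.
have SS n : S n.+1 = S n + L (b - pi (S n), n) by [].
have SP n : rnorm (b - pi (S n.+1)) < h ^+ n.
  rewrite SS (cstar_homD piH) opprD addrA.
  by have [] := LP (b - pi (S n), n).
(* After a step the residual is below [h ^+ n = 2 h ^+ n.+1], to which [pi_lift] adds [2 h ^+ n.+1];
   hence the 4. The summand [rnorm b] serves [n = 0]. *)
have step n : rnorm (S n.+1 - S n) <= (rnorm b + 4) * h ^+ n.
  rewrite SS addrC addKr; have [_ /=] := LP (b - pi (S n), n).
  have b0 : 0 <= rnorm b * h ^+ n by rewrite mulr_ge0 ?rnorm_ge0 ?(ltW (hp n)).
  case: n b0 => [|n] b0.
    have -> : b - pi (S 0%N) = b by rewrite -[S 0%N]/(0 : A) (cstar_hom0 piH) subr0.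
    by rewrite expr0; lra.
  have := SP n; have := hp n; move: b0; rewrite [h ^+ n.+1]exprS.
  have hE : h = 2^-1 by [].
  move: (h ^+ n) (rnorm b) (rnorm (b - _)) (rnorm _) => t u v w; rewrite hE; lra.
have C0 : 0 <= rnorm b + 4 by rewrite addr_ge0 ?rnorm_ge0.
have h01 : 0 <= h < 1 by rewrite (ltW h0)/= invf_lt1// ltr1n.
have [a Sa _] := geometric_rlim C0 h01 step.
exists a; apply: (rlim_uniq (cstar_hom_rlim piH (rlim_shift Sa))) => e e0.
have [||N NP] := @exprn_small R h (e / 2).
- by rewrite h0 /=; case/andP: h01.
- by rewrite divr_gt0.
exists N => n Nn; rewrite rdistC; apply: lt_trans (SP n) _.
have : h ^+ n <= h ^+ N by rewrite ler_wiXn2l// ltW//; case/andP: h01.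
lra.
Qed.

(** An element of the kernel has quotient norm 0, so it is a limit of elements of the ideal, and
    [fiber_ideal_closed] writes it as a single product [f b]. *)
Lemma pi_is_quotient : is_quotient I pi.
Proof.
split=> //; [exact: pi_surjective| |exact: (pi_quotient_norm hA hB piH piE)].
move=> a; split=> [pa|[f [c [f0 fq ->]]]]; last first.
  by rewrite (pi_base_act hA hB piH piE _ (C0_bounded_cts f0)) fq scale0r.
apply: (fiber_ideal_closed hA) => e e0.
have [i Ii ai] := quotient_norm_approx a (fiber_ideal_ex iota q) e0.
exists i => //; move: ai; rewrite -(pi_quotient_norm hA hB piH piE) pa rnorm0 add0r.
exact.
Qed.

Lemma fiber_nonempty : exists h : set_type (H_fiber q), True.
Proof.
have /andP[q0 q1] := Yval_itv q.
have Hh : H_set (set_val q, set_val q, 1 : R).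
  have [E|qn1] := eqVneq (set_val q : R) 1.
    by rewrite E; apply/H_set_eq1; split; rewrite ?expr1n ?mulr1 ?ltr01.
  apply/HsetP => //; split=> //; first by rewrite lt_neqAle qn1.
  by exists 0%N, 0%N; rewrite !expr0 invr1 sqrtr1 expr1 mulr1.
pose h : Hspace R := exist _ (set_val q, set_val q, 1) (mem_set Hh).
have hq : H_fiber q h by apply: val_inj.
by exists (exist _ h (mem_set hq)).
Qed.

(** Gives injectivity of the action: [f q] can be read off from [pi (f a) = f q *: pi a] once some
    [pi a] is nonzero. *)
Lemma pi_nonzero : exists a, pi a != 0.
Proof.
have [h _] := fiber_nonempty.
have xA := cp_alg_single (C0_dom_0 Th (@Ht_C0 R)).
have rA := cp_alg_restr (@H_fiber_inv R q) clF xA.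
exists (iota (single 0 (fun h => (Ht h)%:C%C))); rewrite piE//.
apply/eqP => E0; have := fiber_lower hB h rA.
rewrite [iotaB _]E0 rnorm0 /restr /single eqxx cabs_real ger0_norm ?(ltW (Ht_gt0 _))//.
by rewrite leNgt Ht_gt0.
Qed.

End FiberQuotient.

(** * Continuity of the norm along the base *)

Section ContinuousField.
Context {R : realType} {A : cstarAlgType R} (iota : (int -> Hspace R -> cplx R) -> A).
Hypothesis hA : is_crossed_product (@Theta R) iota.
Local Notation Th := (@Theta R).
Local Notation Y := (Yspace R).
Local Notation m := (base_mult iota).
Context (B : Y -> cstarAlgType R)
  (iotaB : forall q : Y, (int -> set_type (H_fiber q) -> cplx R) -> B q).
Hypothesis hB : forall q, is_crossed_product (Theta_fiber q) (@iotaB q).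
Context (pi : forall q, A -> B q).
Hypothesis piH : forall q, cstar_hom (pi q).
Hypothesis piE : forall q x, cp_alg Th x -> pi q (iota x) = iotaB (cp_restrict (q := q) x).
Let hausH := @Hspace_hausdorff R.

Lemma near_Y (q : Y) (d : R) (P : Y -> Prop) : 0 < d ->
  (forall y, `|set_val q - set_val y| < d -> P y) -> \forall y \near q, P y.
Proof.
move=> d0 dP; change (nbhs q [set y | P y]); rewrite nbhsE.
exists (set_val @^-1` ball (set_val q : R) d).
  split; last by rewrite /=; exact: ballxx.
  by exists (ball (set_val q : R) d) => //; exact: ball_open.
by move=> y /=; rewrite -ball_normE /=; exact: dP.
Qed.

(** Fibres within [d / 2] of [q] do not see the cut-off by the plateau, and the element so cut off
    already has norm at most [|x_q| + e]. *)
Lemma pi_usc q x (e : R) : cp_alg Th x -> 0 < e ->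
  \forall y \near q, rnorm (pi y (iota x)) <= rnorm (pi q (iota x)) + e.
Proof.
move=> xA e0; have [d d0 dP] := localized_norm hA (hB q) (piE q) xA e0.
apply: (@near_Y q (d / 2)) => [|y qy]; first by rewrite divr_gt0.
apply: le_trans dP; have Fb : bounded_cts (fun y => (plateau d q y)%:C%C : cplx R).
  apply: (real_bounded_cts (c := 1)); first exact: plateau_cts.
  by move=> z; have /andP[p0 p1] := plateau_itv d q z; rewrite ger0_norm.
apply: le_trans (cstar_hom_norm (piH y) _).
by rewrite (pi_base_act hA (hB y) (piH y) (piE y) _ Fb) plateau1// scale1r.
Qed.

(* A point of the fibre over q that nearly attains the norm has neighbours in all
   nearby fibres, because H -> (0, 1] is open. *)
Lemma pi_lsc q x (e : R) : cp_alg Th x -> 0 < e ->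
  \forall y \near q, rnorm (pi q (iota x)) - e <= rnorm (pi y (iota x)).
Proof.
move=> xA e0; set s := rnorm (pi q (iota x)).
have [se|es] := ltP (s - e) 0.
  by apply: (@near_Y q 1) => // y _; rewrite (le_trans (ltW se))// rnorm_ge0.
have [K xK] := cp_supp xA; have [n] := growth_gap K es e0; rewrite subrK.
set N := (2 ^ n.+1)%N => gap.
have N0 : (0 < N)%N by rewrite expn_gt0.
have rA := cp_alg_restr (@H_fiber_inv R q) (@H_fiber_closed R q) xA.
have rK k : (K < `|k|)%N -> restr x k = 0 :> (set_type (H_fiber q) -> cplx R).
  by move=> /xK E; apply/funext => h; rewrite /restr E.
(* Otherwise the growth estimate in the fibre over [q] would bound [s ^+ N] by the coefficient count
   times [(s - e) ^+ N], against the gap. *)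
have [h0 h0P] : exists h : set_type (H_fiber q),
    (s - e) ^+ N < sqsum (wseq Th x n) (set_val h).
  apply: contrapT => /forallNP nh.
  have M0 : 0 <= (s - e) ^+ N by rewrite exprn_ge0.
  have bound h : sqsum (wseq (Theta_fiber q) (restr x) n) h <= (s - e) ^+ N.
    rewrite -(restr_wseq (@H_fiber_inv R q)); rewrite leNgt; apply/negP; exact: (nh h).
  have := cp_hom_growth (@Hfiber_hausdorff R q) (proj1 (hB q)) rA rK M0 bound.
  by rewrite -/N leNgt -[iotaB _](piE q xA) -/s gap.
have gc : continuous (fun h => cabs (wseq Th x n.+1 0 h)).
  apply: cabs_continuous; apply: C0_cts; apply: (C0_dom_C0 (Th := Th) (k := 0)).
  exact/cp_alg_dom/cp_alg_wseq.
have gE h : cabs (wseq Th x n.+1 0 h) = sqsum (wseq Th x n) h.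
  rewrite wseqS cp_star_mul0; last exact: cp_alg_wseq.
  by rewrite cabs_real ger0_norm ?sqsum_ge0.
have near_h : nbhs (set_val h0) [set h | (s - e) ^+ N < sqsum (wseq Th x n) h].
  rewrite (_ : mkset _ = (fun h => cabs (wseq Th x n.+1 0 h)) @^-1` [set t | (s - e) ^+ N < t]).
    apply: open_nbhs_nbhs; split; last by rewrite /= -wseqS gE.
    by apply: open_comp => [h _|]; [exact: gc|exact: open_gt].
  by apply/seteqP; split=> h /=; rewrite -wseqS gE.
have hq : H_proj (set_val h0) = q by exact: (set_val_mem h0).
have := H_proj_open near_h; rewrite hq; apply: filterS => y [h hP hy].
rewrite -(@ler_pXn2r _ N) ?nnegrE ?rnorm_ge0//.
apply: le_trans (ltW hP) _.
exact: (fiber_sqsum (hB y) (piE y) n xA hy).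
Qed.

Lemma pi_iota_cts x : cp_alg Th x -> continuous (fun q => rnorm (pi q (iota x))).
Proof.
move=> xA; apply: semicontinuous_cts => q e e0; first exact: pi_usc.
exact: pi_lsc.
Qed.

Lemma pi_norm_cts a : continuous (fun q => rnorm (pi q a)).
Proof.
apply: uniform_limit_cts => e e0; have [x xA ax] := crossed_product_dense hausH hA a e0.
exists (fun q => rnorm (pi q (iota x))); first exact: pi_iota_cts.
move=> q; apply: le_lt_trans (rnorm_dist _ _) _; rewrite -(cstar_homB (piH q)).
exact: le_lt_trans (cstar_hom_norm (piH q) _) ax.
Qed.

Lemma base_action_C0_algebra : is_C0_algebra m.
Proof.
split.
- by move=> f f0; apply: (mact_center hausH hA); exact/invariant_pull/C0_bounded_cts.
- split.
  + move=> c f g /C0_bounded_cts fb /C0_bounded_cts gb.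
    by congr pair; apply/funext => a; exact: base_act_linf.
  + move=> f g /C0_bounded_cts fb /C0_bounded_cts gb.
    rewrite /multiplier_mul /=; congr pair; apply/funext => a /=.
      exact: base_actM.
    rewrite -(base_actM hA)//; congr (base_act iota _ a).
    by apply/funext => y; rewrite /fun_mul mulrC.
  + move=> f /C0_bounded_cts/invariant_pull fi; rewrite /multiplier_star /=.
    by congr pair; apply/funext => a /=; rewrite (mact_star hausH hA).
- move=> f g; rewrite !inE => f0 g0 [fg _]; apply/funext => q.
  have [a pa] := pi_nonzero (hB q) (piE q).
  have := pi_base_act hA (hB q) (piH q) (piE q) a (C0_bounded_cts f0).
  rewrite fg (pi_base_act hA (hB q) (piH q) (piE q) a (C0_bounded_cts g0)).
  move/eqP; rewrite -subr_eq0 -scalerBl scaler_eq0 (negPf pa) orbF subr_eq0.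
  by move/eqP.
- move=> U [a Ua] oU.
  have /nbhs_rnormP[e e0 eU] : nbhs a U by apply: open_nbhs_nbhs.
  have e2 : 0 < e / 2 by rewrite divr_gt0.
  have [x xA ax] := crossed_product_dense hausH hA a e2.
  have [c c0 cP] := chi_approx hA xA e2.
  exists (base_act iota (fun y => (chi c y)%:C%C) (iota x)); split.
    apply: eU; have := cP c c0 (lexx _).
    have := rdistD a (iota x) (base_act iota (fun y => (chi c y)%:C%C) (iota x)).
    lra.
  exists 1%N, (fun=> fun y => (chi c y)%:C%C), (fun=> iota x); split=> [_|].
    exact: chi_C0.
  by rewrite big_ord1.
Qed.

End ContinuousField.

Theorem corollary1p16 (R : realType)
    (A : cstarAlgType R) (iota : (int -> Hspace R -> cplx R) -> A)
    (B : Yspace R -> cstarAlgType R)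
    (iotaB : forall q : Yspace R,
       (int -> set_type (H_fiber q) -> cplx R) -> B q)
    (hA : is_crossed_product (@Theta R) iota)
    (hB : forall q : Yspace R,
       is_crossed_product (Theta_fiber q) (iotaB q)) :
  exists m : (Yspace R -> cplx R) -> (A -> A) * (A -> A),
    [/\ forall (f : Yspace R -> cplx R) (x : int -> Hspace R -> cplx R),
          C0 R (Yspace R) f -> cp_alg (@Theta R) x ->
          action m f (iota x) = iota (cp_pullback f x),
        is_continuous_field m
      & forall q : Yspace R, exists pi : A -> B q,
          is_quotient (fiber_ideal m q) pi /\
          forall x : int -> Hspace R -> cplx R, cp_alg (@Theta R) x ->
            pi (iota x) = iotaB q (cp_restrict x)].
Proof.
(* Restricting coefficients to the closed invariant set [H_q] respects the operations; the universal
   property of [A] turns this into [pi]. *)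
have pi_ex (q : Yspace R) : exists pi : A -> B q, cstar_hom pi /\
    forall x, cp_alg (@Theta R) x -> pi (iota x) = iotaB q (cp_restrict x).
  have [_ univ] := hA.
  have [pi [piP _]] := univ _ _ (restr_hom (@H_fiber_closed R q) (proj1 (hB q))).
  by exists pi.
pose pi q := projT1 (cid (pi_ex q)).
have piH q : cstar_hom (pi q) by have [] := projT2 (cid (pi_ex q)).
have piE q x : cp_alg (@Theta R) x -> pi q (iota x) = iotaB q (cp_restrict x).
  by have [_] := projT2 (cid (pi_ex q)); apply.
exists (base_mult iota); split.
- move=> f x /C0_bounded_cts fb xA; exact: (base_act_iota hA fb xA).
- split; first exact: (base_action_C0_algebra hA hB piH piE).
  move=> a.
  rewrite (_ : (fun y => _) = fun q => rnorm (pi q a)).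
    exact: (pi_norm_cts hA hB piH piE).
  by apply/funext => q; rewrite (pi_quotient_norm hA (hB q) (piH q) (piE q)).
- move=> q; exists (pi q); split; last exact: piE.
  exact: (pi_is_quotient hA (hB q) (piH q) (piE q)).
Qed.
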